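(* Let $(\mathbf u,p,C)$ be the solution of $(V_a)$, $(\mathbf u_h,p_h,C_h)$ the solution of $(V_{ah})$, and $(\mathbf u_h^{i},p_h^{i},C_h^{i})$ the iterates defined by $(V_{ahi})$ with parameter $\gamma>0$ and initial guess $(\mathbf u_h^0,C_h^0)\in X_h\times Y_h$. Assume that $\mathbf f_0\in L^2(\Omega)^d$, $C\in H^2(\Omega)$, $\mathbf u\in W^{1,3}(\Omega)^d\cap L^\infty(\Omega)^d$, $p\in H^2(\Omega)$, that $$S_6^0|C|_{W^{1,3}(\Omega)}+\|C\|_{L^\infty(\Omega)}\le\frac{\alpha\mu K_m}{2\sqrt2\,\rho\,c_{\mathbf f_1}S_2^0}\quad\text{and}\quad S_6^0|C|_{W^{1,3}(\Omega)}+\|C\|_{L^\infty(\Omega)}\le\frac{\alpha\mu K_m}{8\rho\,c_{\mathbf f_1}^2S_2^0},$$ that $\|\mathbf u_h^0\|_{L^2(\Omega)^d}\le L_1(\mathbf f,g)$, that $\gamma>\max\{\gamma_*,\gamma_{**}\}$, and that $$h\le\Big(\frac1{2c_Ic_1}\Big(|C|_{W^{1,3}(\Omega)}+\frac{\|C\|_{L^\infty(\Omega)}}{S_6^0}\Big)\Big)^{6/(6-d)}.$$ Then there exists an integer $i_0$ depending on $h$ such that for all $i\ge i_0$, $$\|\mathbf u-\mathbf u_h^{i+1}\|_{L^2(\Omega)^d}+\|C-C_h^{i+1}\|_{H^1(\Omega)}+\|\mathbf v_r\|_{L^3(\Omega)^d}\le\tilde c_3\sum_{\kappa\in\mathcal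 T_h}\Big(\eta_{\kappa,i}^{(D_1)}+\eta_{\kappa,i}^{(D_2)}+\eta_{\kappa,i}^{(D_3)}+\eta_{\kappa,i}^{(L_1)}+\eta_{\kappa,i}^{(L_2)}+h_\kappa\|g-g_h\|_{L^2(\kappa)}+\|\mathbf f(\cdot,C)-\mathbf f_h(\cdot,C)\|_{L^2(\kappa)}\Big),$$ where $\tilde c_3$ is a positive constant independent of $h$.
   Context: Setting. $d\in\{2,3\}$ and $\Omega\subset\mathbb R^d$ is a bounded, simply connected open polygon ($d=2$) or polyhedron ($d=3$) with Lipschitz boundary and outer unit normal $\mathbf n$. $|\cdot|$ is the Euclidean norm. $\mu,\rho,\beta,\alpha,r_0$ are strictly positive constants. $K$ is a uniformly positive definite, bounded tensor field with $0<K_m\le\|K^{-1}\|_{L^\infty(\Omega)^{d\times d}}\le K_M$, where $K_m$ is not larger than the smallest eigenvalue of $K^{-1}$ over $\Omega$. The data satisfy $\mathbf f(\mathbf x,C)=\mathbf f_0(\mathbf x)+\mathbf f_1(C)$ with $\mathbf f_0\in L^{3/2}(\Omega)^d$, $\mathbf f_1:\mathbb R\to\mathbb R^d$ Lipschitz with constant $c_{\mathbf f_1}>0$ and $\mathbf f_1(0)=0$, and $g\in L^2(\Omega)$. For a function $C$, $\mathbf f(\cdot,C)$ denotes $\mathbf x\mapsto\mathbf f(\mathbf x,C(\mathbf x))$. $|\cdot|_{W^{1,p}(\Omega)}$ is the seminorm $\|\nabla\cdot\|_{L^p}$. $S_p^0$ is a constant such that $\|v\|_{L^p(\Omega)}\le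 S_p^0|v|_{H^1(\Omega)}$ for all $v\in H^1_0(\Omega)$. Spaces: $X=L^3(\Omega)^d$, $M=W^{1,3/2}(\Omega)\cap L^2_0(\Omega)$ ($L^2_0$: zero-mean functions of $L^2$), $Y=H^1_0(\Omega)$. Problem $(V_a)$: find $(\mathbf u,p,C)\in X\times M\times Y$ such that for all $\mathbf v\in X$, $q\in M$, $S\in Y$: $\frac\mu\rho\int_\Omega K^{-1}\mathbf u\cdot\mathbf v+\frac\beta\rho\int_\Omega|\mathbf u|\mathbf u\cdot\mathbf v+\int_\Omega\nabla p\cdot\mathbf v=\int_\Omega\mathbf f(\cdot,C)\cdot\mathbf v$; $\int_\Omega\nabla q\cdot\mathbf u=0$; $\alpha\int_\Omega\nabla C\cdot\nabla S+\int_\Omega(\mathbf u\cdot\nabla C)S+r_0\int_\Omega CS=\int_\Omega gS$. Meshes: $(\mathcal T_h)_h$ is a family of conforming triangulations of $\overline\Omega$ by closed nondegenerate triangles/tetrahedra $\kappa$, of maximal diameter $h$; $h_\kappa$ is the diameter of $\kappa$, $\rho_\kappa$ that of its inscribed ball, $h_e$ the diameter of an edge ($d=2$) or face ($d=3$) $e$. It is regular ($\max_\kappa h_\kappa/\rho_\kappa\le\sigma$, $\sigma$ independent of $h$) and uniformly regular ($h_\kappa\ge\beta_0h$, $\beta_0>0$ independent of $h$). $w_\kappa$ is the union of the elements of $\mathcal T_h$ meeting $\kappa$, $w_e$ the union of the elements adjacent to $e$. Discrete spaces: with $b_\kappa=\lambda_1\cdots\lambda_{d+1}$ the product of the barycentric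 coordinates of $\kappa$ and $\mathcal P(\kappa)=\mathbb P_1(\kappa)\oplus\mathrm{Vect}\{b_\kappa\}$, $X_h=\{\mathbf v_h\in C^0(\overline\Omega)^d:\mathbf v_h|_\kappa\in\mathcal P(\kappa)^d\ \forall\kappa\}$, $M_h=\{q_h\in C^0(\overline\Omega):q_h|_\kappa\in\mathbb P_1(\kappa)\ \forall\kappa\}\cap L_0^2(\Omega)$, $Y_h=\{q_h\in C^0(\overline\Omega):q_h|_\kappa\in\mathbb P_1(\kappa)\ \forall\kappa\}\cap H_0^1(\Omega)$. Problem $(V_{ah})$: find $(\mathbf u_h,p_h,C_h)\in X_h\times M_h\times Y_h$ such that for all $\mathbf v_h\in X_h$, $q_h\in M_h$, $S_h\in Y_h$: $\frac\mu\rho\int_\Omega K^{-1}\mathbf u_h\cdot\mathbf v_h+\frac\beta\rho\int_\Omega|\mathbf u_h|\mathbf u_h\cdot\mathbf v_h+\int_\Omega\nabla p_h\cdot\mathbf v_h=\int_\Omega\mathbf f(\cdot,C_h)\cdot\mathbf v_h$; $\int_\Omega\nabla q_h\cdot\mathbf u_h=0$; $\alpha\int_\Omega\nabla C_h\cdot\nabla S_h+\int_\Omega(\mathbf u_h\cdot\nabla C_h)S_h+\frac12\int_\Omega\operatorname{div}(\mathbf u_h)C_hS_h+r_0\int_\Omega C_hS_h=\int_\Omega gS_h$. Iterative problem $(V_{ahi})$: given $(\mathbf u_h^i,C_h^i)\in X_h\times Y_h$, find $(\mathbf u_h^{i+1},p_h^{i+1},C_h^{i+1})\in X_h\times M_h\times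 Y_h$ such that for all $\mathbf v_h\in X_h$, $q_h\in M_h$, $S_h\in Y_h$: $\gamma\int_\Omega(\mathbf u_h^{i+1}-\mathbf u_h^i)\cdot\mathbf v_h+\frac\mu\rho\int_\Omega K^{-1}\mathbf u_h^{i+1}\cdot\mathbf v_h+\frac\beta\rho\int_\Omega|\mathbf u_h^i|\mathbf u_h^{i+1}\cdot\mathbf v_h+\int_\Omega\nabla p_h^{i+1}\cdot\mathbf v_h=\int_\Omega\mathbf f(\cdot,C_h^i)\cdot\mathbf v_h$; $\int_\Omega\nabla q_h\cdot\mathbf u_h^{i+1}=0$; $\alpha\int_\Omega\nabla C_h^{i+1}\cdot\nabla S_h+\int_\Omega(\mathbf u_h^{i+1}\cdot\nabla C_h^{i+1})S_h+\frac12\int_\Omega\operatorname{div}(\mathbf u_h^{i+1})C_h^{i+1}S_h+r_0\int_\Omega C_h^{i+1}S_h=\int_\Omega gS_h$. Constants. $c_I>0$ is the constant (independent of $h$) of the inverse inequality $\|v_h\|_{L^p}\le c_Ih^{d/p-d/2}\|v_h\|_{L^2}$ for discrete functions, $p\in\{3,6\}$. $c_1>0$ is the constant, independent of $h$, of the known a priori error estimate $|C-C_h|_{H^1(\Omega)}+\|\mathbf u-\mathbf u_h\|_{L^2(\Omega)^d}+\|\nabla(p-p_h)\|_{L^{3/2}(\Omega)^d}\le c_1h$. With $F=\|\mathbf f_0\|_{L^2(\Omega)^d}+c_{\mathbf f_1}\frac{(S_2^0)^2}{\alpha}\|g\|_{L^2(\Omega)}$: $L_1(\mathbf f,g)=\frac{\rho}{\mu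 K_m}F$, $\gamma_*=\frac{32\beta}{27\rho}c_I^3h^{-d/2}\big(\frac{\rho}{\mu K_m}+\frac{\rho K_M}{\mu K_m^2}\big)F+\frac{32\beta^2\rho}{27\mu^3K_m^3}c_I^6h^{-d}F^2$, $\gamma_{**}=2c_I^4h^{-2d/3}\frac{\rho^{1/3}\beta^{4/3}}{\mu^{5/3}K_m^{5/3}}F^{4/3}$. Approximations: $g_h$ is an approximation of $g$ that is constant on each $\kappa$; on each $\kappa$, $\mathbf f_h(\cdot,C)=\frac1{|\kappa|}\int_\kappa\mathbf f(\mathbf x,C(\mathbf x))\,d\mathbf x$. $\Gamma_h^i$ is the set of edges/faces not contained in $\partial\Omega$, $\Gamma_h^b$ those contained in $\partial\Omega$; $[\cdot]_e$ is the jump across $e$; $\phi_{h,1}^e=\frac12[\mathbf u_h^{i+1}\cdot\mathbf n]_e$ if $e\in\Gamma_h^i$ and $\phi_{h,1}^e=\mathbf u_h^{i+1}\cdot\mathbf n$ if $e\in\Gamma_h^b$. Indicators for $\kappa\in\mathcal T_h$: $\eta_{\kappa,i}^{(L_1)}=\|\mathbf u_h^{i+1}-\mathbf u_h^i\|_{L^2(\kappa)}$; $\eta_{\kappa,i}^{(L_2)}=\|C_h^i-C_h^{i+1}\|_{H^1(\kappa)}$; $\eta_{\kappa,i}^{(D_1)}=h_\kappa\|\alpha\Delta C_h^{i+1}-\mathbf u_h^{i+1}\cdot\nabla C_h^{i+1}-\frac12\operatorname{div}(\mathbf u_h^{i+1})C_h^{i+1}-r_0C_h^{i+1}+g_h\|_{L^2(\kappa)}+\frac12\sum_{e\in\partial\kappa\cap\Gamma_h^i}h_e^{1/2}\|\alpha[\nabla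 C_h^{i+1}\cdot\mathbf n]_e\|_{L^2(e)}$; $\eta_{\kappa,i}^{(D_2)}=\|-\nabla p_h^{i+1}-\gamma(\mathbf u_h^{i+1}-\mathbf u_h^i)-\frac\mu\rho K^{-1}\mathbf u_h^{i+1}-\frac\beta\rho|\mathbf u_h^i|\mathbf u_h^{i+1}+\mathbf f_h(\cdot,C_h^i)\|_{L^2(\kappa)}$; $\eta_{\kappa,i}^{(D_3)}=h_\kappa\|\operatorname{div}\mathbf u_h^{i+1}\|_{L^3(\kappa)}+\sum_{e\in\partial\kappa}h_e^{1/3}\|\phi_{h,1}^e\|_{L^3(e)}$. $r_h$ is a Clément-type interpolation operator onto continuous piecewise $\mathbb P_1$ functions with $\|q-r_hq\|_{L^{3/2}(\kappa)}\le c_\kappa h_\kappa|q|_{W^{1,3/2}(w_\kappa)}$ and $\|q-r_hq\|_{L^{3/2}(e)}\le c_eh_e^{1/3}|q|_{W^{1,3/2}(w_e)}$ for $q\in W^{1,3/2}(\Omega)$, $c_\kappa,c_e$ independent of $h$. $\mathbf v_r\in L^3(\Omega)^d$ (depending on $h$ and $i$) denotes a velocity such that for all $q\in M$, $\int_\Omega\nabla q\cdot\mathbf v_r=\sum_{\kappa}\big(\int_\kappa(q-r_hq)\operatorname{div}\mathbf u_h^{i+1}-\sum_{e\in\partial\kappa}\int_e\phi_{h,1}^e(q-r_hq)\,ds\big)$ and $\|\mathbf v_r\|_{L^3(\Omega)^d}\le c_2'\sum_\kappa\eta_{\kappa,i}^{(D_3)}$ with $c_2'$ independent of $h$ (such a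 velocity exists). *)

(* Defs.v *)
From HB Require Import structures.
From mathcomp Require Import all_boot all_order all_algebra finmap.
From mathcomp Require Import all_classical all_reals all_analysis.

Set Implicit Arguments.
Unset Strict Implicit.
Unset Printing Implicit Defensive.

Import Order.TTheory GRing.Theory Num.Theory.
Import numFieldNormedType.Exports.

Local Open Scope classical_set_scope.
Local Open Scope ring_scope.

(* R^d is the type of row vectors, with the product Borel sigma-algebra. *)
Section measurable_rV.
Context {R : realType} (d : nat).

Let coord (i : 'I_d) (x : 'rV[R]_d) : R := x ord0 i.

Let rV_set0 : g_sigma_preimage coord set0.
Proof. exact: sigma_algebra0. Qed.

Let rV_setC A : g_sigma_preimage coord A -> g_sigma_preimage coord (~` A).
Proof. exact: sigma_algebraC. Qed.

Let rV_bigcup (F : (set 'rV[R]_d)^nat) :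
  (forall i, g_sigma_preimage coord (F i)) ->
  g_sigma_preimage coord (\bigcup_i (F i)).
Proof. exact: sigma_algebra_bigcup. Qed.

HB.instance Definition _ := @isMeasurable.Build
  (measure_tuple_display R.-ocitv.-measurable.-sigma) 'rV[R]_d
  (g_sigma_preimage coord) rV_set0 rV_setC rV_bigcup.

End measurable_rV.

Definition consr {R : realType} {d : nat} (p : measurableTypeR R * 'rV[R]_d) :
  'rV[R]_d.+1 := \row_j oapp (fun k => p.2 ord0 k) p.1 (unlift ord0 j).

Section lebesgue_rV.
Context {R : realType}.

Lemma measurable_coord d (i : 'I_d) :
  measurable_fun [set: 'rV[R]_d] (fun x : 'rV[R]_d => x ord0 i : R).
Proof.
move=> _ Y mY; rewrite setTI; apply: sub_sigma_algebra => /=.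
rewrite -bigcup_seq/=; exists i => /=; first by rewrite mem_index_enum.
by exists Y => //; rewrite setTI.
Qed.

Lemma measurable_fun_rV dT (T : measurableType dT) d (f : T -> 'rV[R]_d) :
  (forall i, measurable_fun [set: T] (fun x => f x ord0 i : R)) ->
  measurable_fun [set: T] f.
Proof.
move=> mf.
suff H : g_sigma_preimage (fun i => (fun x : 'rV[R]_d => x ord0 i : R) \o f)
    `<=` measurable.
  by move=> _ A mA; apply: H; rewrite g_sigma_preimage_comp; exists A.
apply: smallest_sub; first exact: sigma_algebra_measurable.
case: d f mf => [|d] f mf; first by rewrite big_ord0.
rewrite -bigcup_mkord_ord; apply: bigcup_sub => i Ii.
by move=> A [B mB <-]; exact: mf.
Qed.

Lemma measurable_consr d :
  measurable_fun [set: measurableTypeR R * 'rV[R]_d] (@consr R d).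
Proof.
apply: measurable_fun_rV => j; rewrite /consr.
case: (unliftP ord0 j) => [k ->|->].
  rewrite (_ : (fun _ => _) =
      (fun x : 'rV[R]_d => x ord0 k : R) \o (@snd (measurableTypeR R) _)).
    by apply: measurableT_comp => //; exact: measurable_coord.
  by apply/funext => x /=; rewrite mxE liftK.
rewrite (_ : (fun _ => _) = @fst (measurableTypeR R) 'rV[R]_d) //.
by apply/funext => x /=; rewrite mxE unlift_none.
Qed.

Definition unconsr d (x : 'rV[R]_d.+1) : measurableTypeR R * 'rV[R]_d :=
  (x ord0 ord0, \row_j x ord0 (lift ord0 j)).

Lemma consrK d : cancel (@consr R d) (@unconsr d).
Proof.
move=> [a x]; rewrite /unconsr /consr /=; congr pair.
  by rewrite mxE unlift_none.
by apply/rowP => j; rewrite !mxE liftK.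
Qed.

Lemma measurable_unconsr d : measurable_fun [set: 'rV[R]_d.+1] (@unconsr d).
Proof.
apply/measurable_fun_pairP; split; first exact: measurable_coord.
apply: measurable_fun_rV => j.
rewrite (_ : (fun _ => _) = (fun x : 'rV[R]_d.+1 => x ord0 (lift ord0 j) : R)).
  exact: measurable_coord.
by apply/funext => x; rewrite /= mxE.
Qed.

Section step.
Variables (d : nat) (m : {sigma_finite_measure set 'rV[R]_d -> \bar R}).

Definition consr_measure : set 'rV[R]_d.+1 -> \bar R :=
  pushforward (@lebesgue_measure R \x m)%E (@consr R d).

Let preimage_consr A : measurable A -> measurable (@consr R d @^-1` A).
Proof. by move=> mA; rewrite -[X in measurable X]setTI; exact: measurable_consr. Qed.

Let consr_measure0 : consr_measure set0 = 0%E.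
Proof. by rewrite /consr_measure /pushforward preimage_set0 measure0. Qed.

Let consr_measure_ge0 A : (0 <= consr_measure A)%E.
Proof. by rewrite /consr_measure /pushforward; exact: measure_ge0. Qed.

Let consr_measure_sigma_additive : semi_sigma_additive consr_measure.
Proof.
move=> F mF tF mUF; rewrite /consr_measure /pushforward preimage_bigcup.
apply: measure_semi_sigma_additive.
- by move=> n; exact: preimage_consr.
- apply/trivIsetP => /= i j _ _ ij; rewrite -preimage_setI.
  by move/trivIsetP : tF => /(_ _ _ _ _ ij) ->//; rewrite preimage_set0.
- by rewrite -preimage_bigcup; exact: preimage_consr.
Qed.

HB.instance Definition _ := isMeasure.Build _ _ _ consr_measure
  consr_measure0 consr_measure_ge0 consr_measure_sigma_additive.

Let consr_measure_sigma_finite : sigma_finite setT consr_measure.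
Proof.
have /sigma_finiteP[F [TF ndF Foo]] := sigma_finiteT (@lebesgue_measure R).
have /sigma_finiteP[G [TG ndG Goo]] := sigma_finiteT m.
have TFG : setT = \bigcup_k (F k `*` G k).
  rewrite -setXTT TF TG predeqE => -[x y]; split.
    move=> [/= [n _ Fnx] [k _ Gky]]; exists (maxn n k) => //; split.
    - by move: x Fnx; exact/subsetPset/ndF/leq_maxl.
    - by move: y Gky; exact/subsetPset/ndG/leq_maxr.
  by move=> [n _ []/= ? ?]; split; exists n.
exists (fun k => @unconsr d @^-1` (F k `*` G k)).
  by rewrite -preimage_bigcup -TFG preimage_setT.
move=> k; have [mFk Fk] := Foo k; have [mGk Gk] := Goo k; split.
  by rewrite -[X in measurable X]setTI; apply: measurable_unconsr => //; exact: measurableX.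
rewrite /consr_measure /pushforward -comp_preimage (_ : _ \o _ = id).
  by rewrite product_measure1E// lte_mul_pinfty// ge0_fin_numE.
by apply/funext => x; exact: consrK.
Qed.

HB.instance Definition _ := Measure_isSigmaFinite.Build _ _ _ consr_measure
  consr_measure_sigma_finite.

End step.

(* Product Lebesgue measure on R^d, by recursion on d. *)
Fixpoint leb (d : nat) : {sigma_finite_measure set 'rV[R]_d -> \bar R} :=
  match d with
  | 0 => @dirac _ 'rV[R]_0 0 R
  | d'.+1 => consr_measure (leb d')
  end.

Lemma leb_box d (a b : 'I_d -> R) : (forall i, a i <= b i) ->
  leb d [set x | forall i, a i <= x ord0 i <= b i] = (\prod_i (b i - a i))%:E.
Proof.
elim: d a b => [|d IH] a b ab.
  rewrite big_ord0 /= /dirac indicE mem_set//= => i; by case: i.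
pose B := [set y : 'rV[R]_d | forall i, a (lift ord0 i) <= y ord0 i <= b (lift ord0 i)].
have mB : measurable B.
  rewrite (_ : B = \bigcap_(i in [set: 'I_d])
      ((fun y : 'rV[R]_d => y ord0 i : measurableTypeR R) @^-1`
        `[a (lift ord0 i), b (lift ord0 i)])); last first.
    apply/seteqP; split => [y By i _|y By i]; first by rewrite /= in_itv/=; exact: By.
    by have := By i I; rewrite /= in_itv.
  apply: fin_bigcap_measurable => // i _.
  by rewrite -[X in measurable X]setTI; apply: measurable_coord.
rewrite /= /consr_measure /pushforward /=.
rewrite (_ : _ @^-1` _ = `[a ord0, b ord0]%classic `*` B); last first.
  apply/seteqP; split => -[t y] /=.
    move=> H; split; first by have := H ord0; rewrite mxE unlift_none /= in_itv.
    by move=> i; have := H (lift ord0 i); rewrite mxE liftK.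
  move=> [] /=; rewrite in_itv /= => H1 H2 i; rewrite mxE.
  by case: unliftP => [k ->|->] //=; exact: H2.
rewrite product_measure1E//= lebesgue_measure_itv/= lte_fin IH; last first.
  by move=> i; exact: ab.
rewrite big_ord_recl EFinM; congr (_ * _)%E.
have := ab ord0; rewrite le_eqVlt => /orP[/eqP ->|->]; last by rewrite EFinB.
by rewrite ltxx subrr.
Qed.

End lebesgue_rV.

Section euclidean.
Context {R : realType} {d : nat}.
Local Notation E := 'rV[R]_d.
Implicit Types (x y u v : E) (A : set E).

Definition dot u v : R := \sum_i u ord0 i * v ord0 i.

(* The library norm of a row vector is the max norm. *)
Definition enorm u : R := Num.sqrt (dot u u).

Definition mxapp (M : 'M[R]_d) v : E := (M *m v^T)^T.

Definition opnorm (M : 'M[R]_d) : R :=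
  sup [set enorm (mxapp M v) | v in [set v | enorm v <= 1]].

Definition diam A : R :=
  sup [set r | exists x y, [/\ A x, A y & r = enorm (x - y)]].

(* Diameter of the largest Euclidean ball contained in A. *)
Definition indiam A : R :=
  sup [set r | 0 <= r /\ exists c, [set x | enorm (x - c) <= r / 2] `<=` A].

Definition bd A : set E := closure A `\` interior A.

Definition path_in A (gamma : R -> E) x y :=
  [/\ {within `[0, 1], continuous gamma}, gamma 0 = x, gamma 1 = y &
      forall t, 0 <= t <= 1 -> A (gamma t)].

Definition simply_connected A :=
  [/\ A !=set0,
      forall x y, A x -> A y -> exists gamma, path_in A gamma x y &
      forall x gamma, path_in A gamma x x -> exists H : R * R -> E,
        [/\ {within `[0, 1] `*` `[0, 1], continuous H},
            forall s t, 0 <= s <= 1 -> 0 <= t <= 1 -> A (H (s, t)),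
            forall t, 0 <= t <= 1 -> H (0, t) = gamma t /\ H (1, t) = x &
            forall s, 0 <= s <= 1 -> H (s, 0) = x /\ H (s, 1) = x]].

Definition hull (V : {fset E}) : set E :=
  [set x | exists l : E -> R,
    [/\ forall v, v \in V -> 0 <= l v,
        \sum_(v <- V) l v = 1 & x = \sum_(v <- V) l v *: v]].

(* A simplex is represented by the finite set of its vertices. *)
Definition nondegenerate (k : {fset E}) :=
  #|` k| = d.+1 /\
  forall l : E -> R, \sum_(v <- k) l v = 0 -> \sum_(v <- k) l v *: v = 0 ->
    forall v, v \in k -> l v = 0.

End euclidean.

Section domains.
Context {R : realType} {d : nat}.
Local Notation E := 'rV[R]_d.

Definition polyhedral (Om : set E) := exists S : {fset {fset E}},
  (forall k, k \in S -> nondegenerate k) /\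
  closure Om = [set x | exists2 k, k \in S & hull k x].

(* Near each boundary point, Om is the strict epigraph of a Lipschitz function
   in the orthonormal frame made of the columns of T and of nu. *)
Definition lipschitz_boundary (Om : set E) := forall x, bd Om x ->
  exists (T : 'M[R]_(d, d.-1)) (nu : E) (psi : 'rV[R]_d.-1 -> R) (L : R),
    [/\ [/\ T^T *m T = 1%:M, nu *m T = 0 & enorm nu = 1],
        forall y z, `|psi y - psi z| <= L * enorm (y - z) &
        \forall y \near x, Om y <-> psi (y *m T) < dot y nu].

Definition domain (Om : set E) :=
  [/\ open Om, bounded_set Om, simply_connected Om, polyhedral Om &
      lipschitz_boundary Om].

End domains.

Section sobolev.
Context {R : realType} {d : nat}.
Local Notation E := 'rV[R]_d.
Implicit Types (A Om : set E) (f g phi : E -> R) (v w G : E -> E).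

Definition partial (i : 'I_d) f (x : E) : R := 'D_(delta_mx ord0 i) f x.
Definition grad f (x : E) : E := \row_i partial i f x.
Definition div v (x : E) : R := \sum_i partial i (fun y => v y ord0 i) x.
Definition lap f (x : E) : R := \sum_i partial i (partial i f) x.

Fixpoint Ck (k : nat) f : Prop :=
  continuous f /\
  match k with
  | 0 => True
  | k'.+1 => forall i, (forall x, derivable f x (delta_mx ord0 i)) /\
                       Ck k' (partial i f)
  end.

Definition smooth f := forall k, Ck k f.

Definition test_function Om phi :=
  [/\ smooth phi, compact (closure [set x | phi x != 0]) &
      closure [set x | phi x != 0] `<=` Om].

(* Norms are extended reals; those of R^d-valued functions are the norms of
   their pointwise Euclidean length. *)
Definition Lp (p : \bar R) A f : \bar R :=
  Lnorm (leb d) p (fun x => (\1_A x * f x)%:E).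
Definition vLp (p : \bar R) A v : \bar R := Lp p A (fun x => enorm (v x)).

Definition inLp p A f := measurable_fun A f /\ (Lp p A f < +oo)%E.
Definition vinLp p A v := measurable_fun A v /\ (vLp p A v < +oo)%E.

Definition loc_integrable Om f := measurable_fun Om f /\
  forall B, compact B -> B `<=` Om -> (leb d).-integrable B (EFin \o f).

Definition weak_grad Om f G :=
  [/\ loc_integrable Om f, forall i, loc_integrable Om (fun x => G x ord0 i) &
      forall phi, test_function Om phi -> forall i,
        \int[leb d]_(x in Om) (f x * partial i phi x) =
        - \int[leb d]_(x in Om) (G x ord0 i * phi x)].

(* A representative of the weak gradient, unique up to null sets. *)
Definition wgrad Om f : E -> E := xget (cst 0) [set G | weak_grad Om f G].

Definition wdiv Om v (x : E) : R :=
  \sum_i wgrad Om (fun y => v y ord0 i) x ord0 i.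

Definition W1 p Om f :=
  inLp p Om f /\ exists2 G, weak_grad Om f G & vinLp p Om G.

Definition W1seminorm p Om f : \bar R := vLp p Om (wgrad Om f).

Definition H1norm Om f : \bar R :=
  ((Lp 2%:E Om f ^+ 2 + W1seminorm 2%:E Om f ^+ 2) `^ 2^-1)%E.

Definition H2 Om f :=
  W1 2%:E Om f /\ forall i, W1 2%:E Om (fun x => wgrad Om f x ord0 i).

Definition H10 Om f := W1 2%:E Om f /\
  forall eps : R, 0 < eps -> exists2 phi, test_function Om phi &
    (H1norm Om (f \- phi)%R <= eps%:E)%E.

Definition L20 Om f := inLp 2%:E Om f /\ \int[leb d]_(x in Om) f x = 0.

Definition spaceX Om v := vinLp 3%:E Om v.
Definition spaceM Om f := W1 (3 / 2)%:E Om f /\ L20 Om f.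
Definition spaceY Om f := H10 Om f.

End sobolev.

Section meshes.
Context {R : realType} {d : nat}.
Local Notation E := 'rV[R]_d.
Local Notation cell := {fset E}.
Local Notation mesh := {fset {fset E}}.
Implicit Types (Om : set E) (T : mesh) (k e : cell) (f q : E -> R) (v : E -> E).

Definition triangulation Om T :=
  [/\ forall k, k \in T -> nondegenerate k,
      closure Om = [set x | exists2 k, k \in T & hull k x] &
      forall k k', k \in T -> k' \in T ->
        hull k `&` hull k' = hull (k `&` k')%fset].

Definition meshsize T : R := \big[Num.max/0]_(k <- T) diam (hull k).

(* Norms and integrals on an element are taken on its interior, the boundary
   being a null set. *)
Definition elt k : set E := interior (hull k).

Definition patch_elt T k : set E :=
  [set x | exists2 k', k' \in T & hull k' `&` hull k !=set0 /\ hull k' x].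
Definition patch_face T e : set E :=
  [set x | exists2 k', k' \in T & (e `<=` k')%fset /\ hull k' x].

Definition affine f := exists (a : E) (b : R), forall x, f x = dot a x + b.

(* Barycentric coordinate of the simplex k associated with its vertex w. *)
Definition bary k (w : E) : E -> R := xget (cst 0)
  [set l | [/\ affine l, l w = 1 & forall w', w' \in k -> w' != w -> l w' = 0]].

Definition bubble k (x : E) : R := \prod_(w <- k) bary k w x.

Definition P1_on k q := exists2 l, affine l & forall x, hull k x -> q x = l x.
Definition P_on k q := exists2 l, affine l &
  exists c : R, forall x, hull k x -> q x = l x + c * bubble k x.

(* Discrete functions matter only on the closure of Om. *)
Definition CP1 Om T q := {within closure Om, continuous q} /\
  forall k, k \in T -> P1_on k q.

Definition Xh Om T v := {within closure Om, continuous v} /\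
  forall k, k \in T -> forall i, P_on k (fun x => v x ord0 i).
Definition Mh Om T q := CP1 Om T q /\ L20 Om q.
Definition Yh Om T q := CP1 Om T q /\ H10 Om q.

Definition piecewise_constant T q := forall k, k \in T ->
  exists c : R, forall x, elt k x -> q x = c.

(* The faces of a simplex k are the sets k `\ w, for w a vertex of k.
   A face is parametrized by the reference simplex of R^(d-1), with constant
   area element facejac. *)
Definition ref_simplex : set 'rV[R]_d.-1 :=
  [set t | (forall j, 0 <= t ord0 j) /\ \sum_j t ord0 j <= 1].
Definition facemx e : 'M[R]_(d.-1, d) :=
  \matrix_(j < d.-1) (nth 0 (enum_fset e) j.+1 - nth 0 (enum_fset e) 0).
Definition facemap e (t : 'rV[R]_d.-1) : E :=
  nth 0 (enum_fset e) 0 + t *m facemx e.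
Definition facejac e : R := Num.sqrt (\det (facemx e *m (facemx e)^T)).

Definition face_int e f : R :=
  \int[leb d.-1]_(t in ref_simplex) (f (facemap e t) * facejac e).
Definition face_norm (p : R) e f : \bar R :=
  ((\int[leb d.-1]_(t in ref_simplex)
      (`|f (facemap e t)| `^ p * facejac e)%:E) `^ p^-1)%E.

Definition boundary_face Om e := hull e `<=` bd Om.

(* Unit normal to the face k `\ w, pointing out of k. *)
Definition out_normal k (w : E) : E :=
  - ((enorm (grad (bary k w) 0))^-1 *: grad (bary k w) 0).

(* Jump of the normal component of v across the face k `\ w: the trace from k
   minus the trace from the other side, along the normal pointing out of k.
   It does not depend on the side from which the face is seen. *)
Definition jump k (w : E) v (x : E) : R :=
  lim ((fun t : R => dot (v (x - t *: out_normal k w) -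
                          v (x + t *: out_normal k w)) (out_normal k w))
       @ 0^'+).

(* Trace on the face e of a function of W^{1,p} of an element k: extension by
   density of the restriction of smooth functions. *)
Definition is_trace (p : R) k e q (tau : E -> R) :=
  measurable_fun ref_simplex (fun t => tau (facemap e t)) /\
  forall eps : R, 0 < eps -> exists2 phi, smooth phi &
    [/\ (Lp p%:E (elt k) (q \- phi)%R <= eps%:E)%E,
        (vLp p%:E (elt k) (fun x => wgrad (elt k) q x - grad phi x)%R
           <= eps%:E)%E &
        (face_norm p e (tau \- phi)%R <= eps%:E)%E].
Definition trace (p : R) k e q : E -> R :=
  xget (cst 0) [set tau | is_trace p k e q tau].

End meshes.

Record data (R : realType) (d : nat) := Data {
  mu : R; rho : R; beta : R; alpha : R; r0 : R;
  K : 'rV[R]_d -> 'M[R]_d;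
  f0 : 'rV[R]_d -> 'rV[R]_d;
  f1 : R -> 'rV[R]_d;
  g : 'rV[R]_d -> R
}.

Section problems.
Context {R : realType} {d : nat}.
Local Notation E := 'rV[R]_d.
Local Notation mesh := {fset {fset E}}.
Variable D : data R d.
Implicit Types (Om : set E) (T : mesh) (k : {fset E}) (u v w : E -> E)
  (p q C S : E -> R).

Definition rhs C (x : E) : E := f0 D x + f1 D (C x).

Definition Kinv u (x : E) : E := mxapp (invmx (K D x)) (u x).

Local Notation "'int_' Om F" := (Rintegral (leb d) Om F)
  (at level 10, Om at level 8, F at level 9).

Definition tensor_assumptions Om (Km KM : R) :=
  [/\ forall i j, measurable_fun Om (fun x => K D x i j),
      {ae leb d, forall x, Om x -> (K D x)^T = K D x},
      exists2 k0 : R, 0 < k0 & {ae leb d, forall x, Om x ->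
        forall xi, k0 * dot xi xi <= dot (mxapp (K D x) xi) xi},
      exists k1 : R, {ae leb d, forall x, Om x -> forall i j, `|K D x i j| <= k1} &
   [/\ 0 < Km,
       (Km%:E <= Lp +oo Om (fun x => opnorm (invmx (K D x))))%E,
       (Lp +oo Om (fun x => opnorm (invmx (K D x))) <= KM%:E)%E &
       {ae leb d, forall x, Om x ->
          forall a, eigenvalue (invmx (K D x)) a -> Km <= a}]].

Definition data_assumptions Om (Km KM cf1 : R) :=
  [/\ [/\ 0 < mu D, 0 < rho D, 0 < beta D, 0 < alpha D & 0 < r0 D],
      tensor_assumptions Om Km KM,
      vinLp (3 / 2)%:E Om (f0 D),
      [/\ 0 < cf1, forall a b, enorm (f1 D a - f1 D b) <= cf1 * `|a - b| &
          f1 D 0 = 0] &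
      inLp 2%:E Om (g D)].

Definition Va Om u p C :=
  [/\ spaceX Om u, spaceM Om p, spaceY Om C &
  [/\ forall v, spaceX Om v ->
        mu D / rho D * int_ Om (fun x => dot (Kinv u x) (v x))
        + beta D / rho D * int_ Om (fun x => enorm (u x) * dot (u x) (v x))
        + int_ Om (fun x => dot (wgrad Om p x) (v x))
        = int_ Om (fun x => dot (rhs C x) (v x)),
      forall q, spaceM Om q ->
        int_ Om (fun x => dot (wgrad Om q x) (u x)) = 0 &
      forall S, spaceY Om S ->
        alpha D * int_ Om (fun x => dot (wgrad Om C x) (wgrad Om S x))
        + int_ Om (fun x => dot (u x) (wgrad Om C x) * S x)
        + r0 D * int_ Om (fun x => C x * S x)
        = int_ Om (fun x => g D x * S x)]].

Definition discrete_concentration Om T u C :=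
  forall S, Yh Om T S ->
    alpha D * int_ Om (fun x => dot (wgrad Om C x) (wgrad Om S x))
    + int_ Om (fun x => dot (u x) (wgrad Om C x) * S x)
    + 2^-1 * int_ Om (fun x => wdiv Om u x * C x * S x)
    + r0 D * int_ Om (fun x => C x * S x)
    = int_ Om (fun x => g D x * S x).

Definition Vah Om T u p C :=
  [/\ Xh Om T u, Mh Om T p, Yh Om T C &
  [/\ forall v, Xh Om T v ->
        mu D / rho D * int_ Om (fun x => dot (Kinv u x) (v x))
        + beta D / rho D * int_ Om (fun x => enorm (u x) * dot (u x) (v x))
        + int_ Om (fun x => dot (wgrad Om p x) (v x))
        = int_ Om (fun x => dot (rhs C x) (v x)),
      forall q, Mh Om T q ->
        int_ Om (fun x => dot (wgrad Om q x) (u x)) = 0 &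
      discrete_concentration Om T u C]].

(* One step of the scheme: (u, C) is the current iterate, (u', p', C') the
   next one. *)
Definition Vahi Om T (gamma : R) u C u' p' C' :=
  [/\ Xh Om T u', Mh Om T p', Yh Om T C' &
  [/\ forall v, Xh Om T v ->
        gamma * int_ Om (fun x => dot (u' x - u x) (v x))
        + mu D / rho D * int_ Om (fun x => dot (Kinv u' x) (v x))
        + beta D / rho D * int_ Om (fun x => enorm (u x) * dot (u' x) (v x))
        + int_ Om (fun x => dot (wgrad Om p' x) (v x))
        = int_ Om (fun x => dot (rhs C x) (v x)),
      forall q, Mh Om T q ->
        int_ Om (fun x => dot (wgrad Om q x) (u' x)) = 0 &
      discrete_concentration Om T u' C']].

Definition iterates Om T gamma (u : nat -> E -> E) (p C : nat -> E -> R) :=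
  [/\ Xh Om T (u 0%N), Yh Om T (C 0%N) &
      forall i, Vahi Om T gamma (u i) (C i) (u i.+1) (p i.+1) (C i.+1)].

(* S2 is the Sobolev constant of exponent 2. *)
Definition Fconst Om (cf1 S2 : R) : R :=
  fine (vLp 2%:E Om (f0 D)) +
  cf1 * (S2 ^+ 2 / alpha D) * fine (Lp 2%:E Om (g D)).

Definition L1const Om (Km cf1 S2 : R) : R :=
  rho D / (mu D * Km) * Fconst Om cf1 S2.

Definition gamma_star Om (Km KM cf1 S2 cI h : R) : R :=
  32 * beta D / (27 * rho D) * cI ^+ 3 * h `^ (- (d%:R / 2))
    * (rho D / (mu D * Km) + rho D * KM / (mu D * Km ^+ 2)) * Fconst Om cf1 S2
  + 32 * beta D ^+ 2 * rho D / (27 * mu D ^+ 3 * Km ^+ 3)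
    * cI ^+ 6 * h `^ (- d%:R) * Fconst Om cf1 S2 ^+ 2.

Definition gamma_star2 Om (Km cf1 S2 cI h : R) : R :=
  2 * cI ^+ 4 * h `^ (- (2 * d%:R / 3))
    * (rho D `^ (1 / 3) * beta D `^ (4 / 3) / (mu D `^ (5 / 3) * Km `^ (5 / 3)))
    * Fconst Om cf1 S2 `^ (4 / 3).

Definition cell_mean k (F : E -> R) : R :=
  (fine (leb d (elt k)))^-1 * int_ (elt k) F.

(* Value on k of f_h(., C). *)
Definition fh k C : E := \row_j cell_mean k (fun x => rhs C x ord0 j).

Definition phi1 Om k (e0 : E) u (x : E) : R :=
  if `[< boundary_face Om (k `\ e0)%fset >]
  then dot (u x) (out_normal k e0) else 2^-1 * jump k e0 u x.

Local Open Scope ereal_scope.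

Definition etaL1 k u u' : \bar R := vLp 2%:E (elt k) (fun x => u' x - u x)%R.

Definition etaL2 k C C' : \bar R := H1norm (elt k) (fun x => C x - C' x)%R.

Definition etaD1 Om k gh u' C' : \bar R :=
  (diam (hull k))%:E * Lp 2%:E (elt k) (fun x =>
     alpha D * lap C' x - dot (u' x) (grad C' x) - 2^-1 * div u' x * C' x
     - r0 D * C' x + gh x)%R
  + (2^-1)%:E *
    \sum_(e0 <- k | ~~ `[< boundary_face Om (k `\ e0)%fset >])
      (diam (hull (k `\ e0)%fset) `^ (1 / 2))%:E *
      face_norm 2 (k `\ e0)%fset (fun x => alpha D * jump k e0 (grad C') x)%R.

Definition etaD2 k gamma u C u' p' : \bar R :=
  vLp 2%:E (elt k) (fun x =>
    - grad p' x - gamma *: (u' x - u x) - (mu D / rho D) *: Kinv u' x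
    - (beta D / rho D * enorm (u x)) *: u' x + fh k C)%R.

Definition etaD3 Om k u' : \bar R :=
  (diam (hull k))%:E * Lp 3%:E (elt k) (div u')
  + \sum_(e0 <- k) (diam (hull (k `\ e0)%fset) `^ (1 / 3))%:E *
      face_norm 3 (k `\ e0)%fset (phi1 Om k e0 u').

Local Close Scope ereal_scope.

Definition clement Om T (r : (E -> R) -> (E -> R)) (ck ce : R) :=
  forall q, W1 (3 / 2)%:E Om q ->
  CP1 Om T (r q) /\
  forall k, k \in T ->
    (Lp (3 / 2)%:E (elt k) (q \- r q)%R <=
       (ck * diam (hull k))%:E * vLp (3 / 2)%:E (patch_elt T k) (wgrad Om q))%E /\
    forall e0, e0 \in k ->
      (face_norm (3 / 2) (k `\ e0)%fset
          (trace (3 / 2) k (k `\ e0)%fset q \- r q)%R <=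
       (ce * diam (hull (k `\ e0)%fset) `^ (1 / 3))%:E *
         vLp (3 / 2)%:E (patch_face T (k `\ e0)%fset) (wgrad Om q))%E.

Definition correction_velocity Om T (r : (E -> R) -> (E -> R)) (c2 : R) u' w :=
  [/\ vinLp 3%:E Om w,
      forall q, spaceM Om q ->
        int_ Om (fun x => dot (wgrad Om q x) (w x)) =
        \sum_(k <- T) (int_ (elt k) (fun x => (q x - r q x) * div u' x)
          - \sum_(e0 <- k) face_int (k `\ e0)%fset (fun x =>
              phi1 Om k e0 u' x * (trace (3 / 2) k (k `\ e0)%fset q x - r q x))) &
      (vLp 3%:E Om w <= c2%:E * \sum_(k <- T) etaD3 Om k u')%E].

End problems.

(* Main.v *)
(** Both sides of the estimate are compared with h.  For fixed h, testing the
    difference of the velocity equations with the error shows that the iterates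
    converge to the discrete solution: gamma > gamma_star absorbs the nonlinear
    increment, and the smallness of C, through the skew symmetry of the convection
    term, controls the concentration error by the velocity error.  Hence, by the a
    priori estimate, the first two terms of the left-hand side are at most of order
    h for large i, while v_r is bounded by the indicators D3 by assumption.
    Conversely the indicators D1 and D3 and the oscillation of g dominate h times
    the norms of the residual of the concentration equation and of the divergence
    of the velocity, and the discrete equation for C_h^{i+1} bounds the L^1 norm
    of g by these norms, so the right-hand side is at least of order h unless
    g = 0.  In that case C = 0, and the restriction on h excludes every mesh. *)

Require Import Defs.
From HB Require Import structures.
From mathcomp Require Import all_boot all_order all_algebra finmap.
From mathcomp Require Import all_classical all_reals all_analysis.
From mathcomp Require Import measurable_realfun ess_sup_inf.
From mathcomp Require Import ring lra.

Set Implicit Arguments.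
Unset Strict Implicit.
Unset Printing Implicit Defensive.

Import Order.TTheory GRing.Theory Num.Theory.
Import numFieldNormedType.Exports.

Local Open Scope classical_set_scope.
Local Open Scope ring_scope.

(** * Lebesgue measure on row vectors *)

(** [wgrad], and with it [wdiv], is picked by choice among all weak gradients, so nothing about a
    discrete function can be computed before its elementwise gradient is known to be a weak gradient
    on [Om]. In place of Green's formula on simplices, difference quotients are shifted from the
    function to the test function; this takes translation invariance of [leb] and a Lipschitz bound
    along coordinate segments, and uniqueness up to null sets then identifies [wgrad]. Skew symmetry
    of the convection is checked on test functions and extended to H^1_0 by density, which calls for
    bounded velocities. The hypotheses fit together numerically. Let N be S6 times the W^{1,3}
    seminorm of C plus its sup norm. The mesh restriction and the a priori estimate bound the
    inverse-inequality factor times S6 |C - C_h| by N / 2, so replacing C_h by C costs no more than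
    the exact part. The first smallness condition leaves a perturbation of 1 / (2 sqrt 2) <= 3/8 of
    the coercivity mu Km / rho, and the second summand of [gamma_star] is 32/27 times the value that
    absorbs the velocity increment. *)

Lemma ge0_integral_measure_preserving d (T : measurableType d) (R : realType)
    (m : {measure set T -> \bar R}) (phi : T -> T) (f : T -> \bar R) :
  measurable_fun [set: T] phi ->
  (forall A, measurable A -> m (phi @^-1` A) = m A) ->
  measurable_fun [set: T] f -> (forall x, 0 <= f x)%E ->
  (\int[m]_x f (phi x) = \int[m]_x f x)%E.
Proof.
move=> mphi pres mf f0.
have := ge0_integral_pushforward mphi m measurableT mf (fun y _ => f0 y).
rewrite preimage_setT => <-.
by apply: (eq_measure_integral m) => A mA _; exact: pres.
Qed.

Section leb_theory.
Context {R : realType}.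

(** Uniqueness of the Lebesgue measure: its image under a translation gives half-open intervals the
    same length. *)
Lemma lebesgue_measure_translate (a : R) (A : set (measurableTypeR R)) :
  measurable A ->
  @lebesgue_measure R ((fun x => x + a) @^-1` A) = lebesgue_measure A.
Proof.
have mt : measurable_fun [set: measurableTypeR R]
    ((fun x => x + a) : _ -> measurableTypeR R).
  exact: measurable_funD.
move=> mA; have := @lebesgue_measure_unique R
  (pushforward lebesgue_measure
    ((fun x => x + a) : measurableTypeR R -> measurableTypeR R)).
move=> /(_ mt) H; rewrite (H _ A mA)// => _ [[x y]] _ <-.
transitivity (@lebesgue_measure R `]x - a, y - a]%classic); last first.
  rewrite /pushforward; congr lebesgue_measure.
  by apply/seteqP; split => t /=; rewrite !in_itv/= ltrBlDr lerBrDr.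
by rewrite !lebesgue_measure_itv/= !lte_fin ltrD2r; case: ifP => // _;
  rewrite -!EFinB; congr EFin; lra.
Qed.

Lemma measurable_translate d (a : 'rV[R]_d) :
  measurable_fun [set: 'rV[R]_d] (fun x => x + a).
Proof.
apply: measurable_fun_rV => i; under eq_fun do rewrite mxE.
by apply: measurable_funD => //; exact: measurable_coord.
Qed.

Lemma preim_measurable d1 d2 (T1 : measurableType d1) (T2 : measurableType d2)
    (f : T1 -> T2) (A : set T2) :
  measurable_fun [set: T1] f -> measurable A -> measurable (f @^-1` A).
Proof. by move=> mf mA; rewrite -[X in measurable X]setTI; exact: mf. Qed.

(** Induction on the dimension: the product measure integrates the measures of sections, which are
    invariant by induction, and the remaining integral over the first coordinate is invariant by the
    one-dimensional case. In dimension 0 every translation is the identity. *)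
Lemma leb_translate d (a : 'rV[R]_d) (A : set 'rV[R]_d) : measurable A ->
  leb d ((fun x => x + a) @^-1` A) = leb d A.
Proof.
elim: d a A => [|d IH] a A mA.
  rewrite (_ : _ @^-1` _ = A)//; apply/seteqP; split=> x /=;
    rewrite (_ : x + a = x)//; by apply/rowP => -[].
rewrite /= /consr_measure /pushforward /= /product_measure1.
pose a' : 'rV[R]_d := \row_j a ord0 (lift ord0 j).
pose B := @consr R d @^-1` A.
have mB : measurable B by apply: preim_measurable mA; exact: measurable_consr.
rewrite (_ : _ @^-1` _ = (fun p => (p.1 + a ord0 ord0, p.2 + a')) @^-1` B);
    last first.
  rewrite -[RHS]/((fun p => consr (p.1 + a ord0 ord0, p.2 + a')) @^-1` A).
  congr (_ @^-1` A); apply/funext => -[t y]; apply/rowP => j; rewrite !mxE.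
  by case: unliftP => [k ->|->] //=; rewrite !mxE.
have E (x : measurableTypeR R) : (leb d \o xsection ((fun p =>
    (p.1 + a ord0 ord0, p.2 + a')) @^-1` B)) x
    = (leb d \o xsection B) (x + a ord0 ord0).
  rewrite /= -(IH a' (xsection B _)); last exact: measurable_xsection.
  by congr (leb d _); apply/seteqP; split => y; rewrite /xsection/= !inE.
under eq_integral do rewrite E.
set F := leb d \o xsection B.
have mF : measurable_fun setT F by exact: measurable_fun_xsection.
have mt : measurable_fun [set: measurableTypeR R]
    ((fun x => x + a ord0 ord0) : _ -> measurableTypeR R).
  exact: measurable_funD.
apply: (ge0_integral_measure_preserving mt) => // C mC.
exact: lebesgue_measure_translate.
Qed.

Lemma ge0_integral_leb_translate d (a : 'rV[R]_d) (f : 'rV[R]_d -> \bar R) :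
  measurable_fun [set: 'rV[R]_d] f -> (forall x, 0 <= f x)%E ->
  (\int[leb d]_x f (x + a)%R = \int[leb d]_x f x)%E.
Proof.
move=> mf f0; apply: (ge0_integral_measure_preserving (measurable_translate a)) => //.
exact: leb_translate.
Qed.

Lemma integral_leb_translate d (a : 'rV[R]_d) (f : 'rV[R]_d -> \bar R) :
  measurable_fun [set: 'rV[R]_d] f ->
  (\int[leb d]_x f (x + a)%R = \int[leb d]_x f x)%E.
Proof.
move=> mf; rewrite integralE [RHS]integralE.
congr (_ - _)%E.
- have /= <- := ge0_integral_leb_translate a (measurable_funepos mf); last by [].
  by apply: eq_integral => x _; rewrite !funeposE.
- have /= <- := ge0_integral_leb_translate a (measurable_funeneg mf); last by [].
  by apply: eq_integral => x _; rewrite !funenegE.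
Qed.

(** Over a fixed first coordinate the section is a hyperplane of one dimension less, null by
    induction. If the remaining normal [a'] vanishes, the sections are empty except above the single
    point [b / a ord0 ord0]. Faces of simplices are null for this reason. *)
Lemma leb_hyperplane d (a : 'rV[R]_d) (b : R) : a != 0 ->
  leb d [set x | dot a x = b] = 0%E.
Proof.
have mdot n (c : 'rV[R]_n) : measurable_fun setT (fun x => dot c x).
  rewrite /dot; apply: measurable_sum => i.
  by apply: measurable_funM => //; exact: measurable_coord.
have mH n (c : 'rV[R]_n) e : measurable [set x | dot c x = e].
  rewrite -[X in measurable X]/((fun x => dot c x) @^-1` [set e]).
  exact: (preim_measurable (mdot _ _) (measurable_set1 _)).
elim: d a b => [|d IH] a b a0.
  by move: a0; rewrite (_ : a = 0) ?eqxx//; apply/rowP => -[].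
rewrite /= /consr_measure /pushforward /= /product_measure1.
set B := _ @^-1` _.
have mB : measurable B by apply: preim_measurable (mH _ _ _); exact: measurable_consr.
pose a' : 'rV[R]_d := \row_j a ord0 (lift ord0 j).
have BE t : xsection B t = [set y | dot a' y = b - a ord0 ord0 * t].
  have dotE y : dot a (consr (t, y)) = a ord0 ord0 * t + dot a' y.
    rewrite /dot big_ord_recl !mxE unlift_none/=; congr (_ + _).
    by apply: eq_bigr => i _; rewrite !mxE liftK.
  apply/seteqP; split => y; rewrite /xsection/= inE /B /= dotE.
    by move=> <-; rewrite addrAC subrr add0r.
  by move=> ->; rewrite subrKC.
have [a'0|a'N] := eqVneq a' 0; last first.
  rewrite integral0_eq// => t _ /=; rewrite BE; exact: IH.
have a00 : a ord0 ord0 != 0.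
  apply: contra_neq a0 => a00; apply/rowP => j; rewrite mxE.
  have [k ->|->//] := unliftP ord0 j.
  by move/rowP : a'0 => /(_ k); rewrite !mxE.
rewrite (ae_eq_integral (cst 0%E))//.
- by rewrite integral0.
- exact: measurable_fun_xsection.
- exists [set b / a ord0 ord0]; split => //; first exact: lebesgue_measure_set1.
  move=> t /= /not_implyP[_]; rewrite BE.
  have [->//|tb] := eqVneq t (b / a ord0 ord0); case.
  rewrite a'0 (_ : [set _ | _] = set0) ?measure0//.
  apply/seteqP; split => // y /=; rewrite /dot big1; last by move=> i _; rewrite mxE mul0r.
  move/eqP; rewrite eq_sym subr_eq0 => /eqP bt.
  by move/eqP : tb; apply; rewrite bt mulrAC divff ?mul1r.
Qed.

Lemma rV_ballP d (x y : 'rV[R]_d) (e : R) : 0 < e ->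
  ball x e y <-> forall i, `|x ord0 i - y ord0 i| < e.
Proof.
move=> e0; split => [[_ H] i|H]; first exact: H.
by split => // i j; rewrite (ord1 i); exact: H.
Qed.

Lemma rV_norm_coord d (x : 'rV[R]_d) i : `|x ord0 i| <= `|x|.
Proof.
have /mapP[j Hj ->] : `|x ord0 i| \in [seq `|x k.1 k.2| | k : 'I_1 * 'I_d].
  by apply/mapP; exists (ord0, i) => //=; rewrite mem_enum.
by rewrite [leRHS]/Num.norm /= mx_normrE; apply/bigmax_geP; right => /=; exists j.
Qed.

Lemma measurable_coord_itv d (I : 'I_d -> interval R) :
  measurable [set x : 'rV[R]_d | forall i, x ord0 i \in I i].
Proof.
rewrite (_ : mkset _ = \bigcap_(i in [set: 'I_d])
    ((fun y : 'rV[R]_d => y ord0 i : measurableTypeR R) @^-1` [set` I i]));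
    last first.
  by apply/seteqP; split => [x xI i _|x xI i]; [exact: xI|exact: (xI i)].
apply: fin_bigcap_measurable => // i _.
by apply: (preim_measurable (@measurable_coord R d i)); exact: measurable_itv.
Qed.

(** The sigma-algebra on row vectors is generated by the coordinates, so open sets must be written
    as countable unions of cubes with rational centres. *)
Lemma open_measurable_rV d (A : set 'rV[R]_d) : open A -> measurable A.
Proof.
move=> oA.
have [w [w0 wlt]] : exists w : nat -> R,
    (forall n, 0 < w n) /\ forall e, 0 < e -> exists n, w n < e.
  exists (fun n => n.+1%:R^-1); split=> [n|e e0]; first by rewrite invr_gt0.
  exists (Num.truncn e^-1); rewrite invf_plt ?posrE//.
  exact: Num.Theory.truncnS_gt.
(* The open cube of half-width [w n] around the rational point of code [k]. Below, [w n < e / 2]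
   puts every cube that contains x inside the ball of radius [e] around x. *)
pose Q (n : nat) (k : nat) : set 'rV[R]_d :=
  if choice.unpickle k is Some q then
    [set x | forall i, x ord0 i \in
      `](ratr ((q : 'rV[rat]_d) ord0 i) - w n), (ratr (q ord0 i) + w n)[ ]
  else set0.
rewrite (_ : A = \bigcup_n \bigcup_(k in [set k | Q n k `<=` A]) Q n k).
  apply: bigcupT_measurable => n; apply: bigcup_measurable => k _.
  rewrite /Q; case: choice.unpickle => [q|]; last exact: measurable0.
  exact: measurable_coord_itv.
apply/seteqP; split; last by move=> x [n _ [k kA Qx]]; exact: kA.
move=> x Ax; have /nbhs_ballP[e /= e0 eA] := open_nbhs_nbhs (conj oA Ax).
have [n ne] := wlt _ (divr_gt0 e0 (ltr0n _ 2)).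
have ratP (y a : R) : 0 < a -> exists q : rat, `|y - ratr q| < a.
  move=> a0; have /rat_in_itvoo[q] : y - a < y + a by lra.
  rewrite in_itv/= => /andP[q1 q2]; exists q.
  by rewrite ltr_norml; apply/andP; split; lra.
have qE i := ratP (x ord0 i) _ (w0 n).
pose q : 'rV[rat]_d := \row_i xchoose (qE i).
have qP i : `|x ord0 i - ratr (q ord0 i)| < w n.
  by rewrite mxE; exact: (xchooseP (qE i)).
exists n => //; exists (choice.pickle q); rewrite /Q /= choice.pickleK.
  move=> y yq; apply: eA; apply/rV_ballP => // i.
  have := yq i; have := qP i; rewrite in_itv/= ltr_norml.
  move=> /andP[? ?] /andP[? ?].
  by rewrite ltr_norml; apply/andP; split; lra.
move=> i; have := qP i; rewrite in_itv/= ltr_norml.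
move=> /andP[? ?].
by apply/andP; split; lra.
Qed.

Lemma closed_measurable_rV d (A : set 'rV[R]_d) : closed A -> measurable A.
Proof.
by move=> cA; rewrite -[A]setCK; apply: measurableC; apply: open_measurable_rV;
  exact: closed_openC.
Qed.

Lemma continuous_measurable_rV d (f : 'rV[R]_d -> R) :
  continuous f -> measurable_fun [set: 'rV[R]_d] f.
Proof.
move=> /continuousP cf; apply: (measurability _ (RGenOpens.measurableE R)).
move=> _ [_ [a [b ->] <-]]; rewrite setTI.
by apply: open_measurable_rV; apply: cf; exact: interval_open.
Qed.

Lemma leb_bounded_fin d (A : set 'rV[R]_d) :
  bounded_set A -> measurable A -> (leb d A < +oo)%E.
Proof.
move=> [M [_ HM]] mA; pose m := `|M| + 1.
have m0 : 0 <= m by rewrite addr_ge0.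
have Mm : M < m by rewrite (le_lt_trans (ler_norm M))// ltrDl.
apply: (@le_lt_trans _ _ (leb d [set x | forall i, - m <= x ord0 i <= m])).
  apply: le_measure; rewrite ?inE//.
    have := @measurable_coord_itv d (fun=> `[(- m), m]).
    by congr measurable; apply/seteqP; split => x /= + i => /(_ i); rewrite in_itv.
  move=> x Ax i /=; rewrite -ler_norml.
  by apply: (le_trans (rV_norm_coord x i)); exact: (HM _ Mm).
by rewrite leb_box ?ltry// => i; rewrite ge0_cp.
Qed.

End leb_theory.

Lemma is_derive_congr (R : realType) (V : normedModType R) (f : V -> R) x v (df df' : R) :
  is_derive x v f df -> df = df' -> is_derive x v f df'.
Proof. by move=> ? <-. Qed.

(** * Smooth functions and integration by parts *)

Section calculus.
Context {R : realType} {d : nat}.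
Local Notation E := 'rV[R]_d.
Implicit Types (x y v : E) (A Om K : set E) (f g phi psi : E -> R).

Lemma is_derive_line f x v (s df : R) :
  is_derive (x + s *: v) v f df -> is_derive s (1 : R) (fun s => f (x + s *: v)) df.
Proof.
move=> [fv fvE].
have E : (fun h => h^-1 *: (((fun s => f (x + s *: v)) \o shift s) (h *: 1) - f (x + s *: v)))
   = (fun h => h^-1 *: ((f \o shift (x + s *: v)) (h *: v) - f (x + s *: v))).
  apply/funext => h /=; congr (_ *: (f _ - _)).
  by rewrite [h *: 1]mulr1 scalerDl addrCA.
by split; rewrite /derivable /derive E.
Qed.

Lemma Ck_continuous k f : Ck k f -> continuous f.
Proof. by case: k => [|k] []. Qed.

Lemma Ck_le k l f : (k <= l)%N -> Ck l f -> Ck k f.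
Proof.
elim: l k f => [|l IH] [|k] f //=; first by move=> _ [].
rewrite ltnS => kl [cf H]; split => // i; have [? ?] := H i.
by split => //; exact: IH.
Qed.

Lemma CkD k f g : Ck k f -> Ck k g -> Ck k (f \+ g)%R.
Proof.
elim: k f g => [|k IH] f g [cf Hf] [cg Hg].
  by split => // x; apply: continuousD; [exact: cf|exact: cg].
split; first by move=> x; apply: continuousD; [exact: cf|exact: cg].
move=> i; have [df Cf] := Hf i; have [dg Cg] := Hg i; split.
  by move=> x; exact: derivableD.
rewrite (_ : partial i (f \+ g)%R = (partial i f \+ partial i g)%R).
  exact: IH.
by apply/funext => x; rewrite /partial deriveD.
Qed.

Lemma CkM k f g : Ck k f -> Ck k g -> Ck k (f \* g)%R.
Proof.
elim: k f g => [|k IH] f g [cf Hf] [cg Hg].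
  by split => // x; apply: continuousM; [exact: cf|exact: cg].
split; first by move=> x; apply: continuousM; [exact: cf|exact: cg].
move=> i; have [df Cf] := Hf i; have [dg Cg] := Hg i; split.
  by move=> x; exact: derivableM.
rewrite (_ : partial i (f \* g)%R = (f \* partial i g)%R \+ (g \* partial i f)%R); last first.
  by apply/funext => x; rewrite /partial deriveM.
apply: CkD; apply: IH => //; [|].
  exact: (@Ck_le k k.+1).
exact: (@Ck_le k k.+1).
Qed.

Lemma smoothD f g : smooth f -> smooth g -> smooth (f \+ g)%R.
Proof. by move=> sf sg k; exact: CkD. Qed.

Lemma smoothM f g : smooth f -> smooth g -> smooth (f \* g)%R.
Proof. by move=> sf sg k; exact: CkM. Qed.

Lemma smooth_continuous f : smooth f -> continuous f.
Proof. by move=> /(_ 0%N) []. Qed.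

Lemma smooth_derivable f i x : smooth f -> derivable f x (delta_mx ord0 i).
Proof. by move=> /(_ 1%N) [_ /(_ i) []]. Qed.

Lemma smooth_partial f i : smooth f -> smooth (partial i f).
Proof. by move=> sf k; have [_ /(_ i) []] := sf k.+1. Qed.

Lemma smooth_is_derive f i x : smooth f ->
  is_derive x (delta_mx ord0 i : E) f (partial i f x).
Proof. by move=> sf; split => //; exact: smooth_derivable. Qed.

Lemma test_out Om phi x : test_function Om phi ->
  ~ closure [set x | phi x != 0] x -> phi x = 0.
Proof.
by move=> _ H; apply/eqP; apply: contrapT => /negP p0; apply: H; exact: subset_closure.
Qed.

Lemma subset_test Om f g : test_function Om f -> smooth g ->
  [set x | g x != 0] `<=` closure [set x | f x != 0] -> test_function Om g.
Proof.
move=> [sf cf fOm] sg gf.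
have gf' : closure [set x | g x != 0] `<=` closure [set x | f x != 0].
  by rewrite closureE => x; apply; split => //; exact: closed_closure.
split => //; last exact: subset_trans fOm.
by apply: subclosed_compact cf gf'; exact: closed_closure.
Qed.

Lemma test_partial Om phi i : test_function Om phi -> test_function Om (partial i phi).
Proof.
move=> tphi; have [sphi _ _] := tphi; apply: (subset_test tphi).
  exact: smooth_partial.
move=> x /= dx; apply: contrapT => xK; move/eqP : dx; apply.
have oK : open (~` closure [set x | phi x != 0]) by apply: closed_openC; exact: closed_closure.
have := open_nbhs_nbhs (conj oK xK).
rewrite /partial => nx.
rewrite (@near_eq_derive _ _ _ phi (cst 0)) ?derive_cst//.
by near do apply: (test_out tphi).
Unshelve. all: by end_near. Qed.

Lemma testM Om phi psi : test_function Om phi -> smooth psi ->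
  test_function Om (phi \* psi)%R.
Proof.
move=> tphi spsi; have [sphi _ _] := tphi; apply: (subset_test tphi).
  exact: smoothM.
move=> x /= px; apply: subset_closure => /=; apply: contraNN px => /eqP ->.
by rewrite mul0r.
Qed.

Lemma test_bounded Om phi : test_function Om phi ->
  exists2 M : R, 0 <= M & forall x, `|phi x| <= M.
Proof.
move=> tphi; have [sphi cK _] := tphi.
have := continuous_compact (continuous_subspaceT (smooth_continuous sphi)) cK.
move=> /compact_bounded [M [_ HM]]; exists (`|M| + 1); first by rewrite addr_ge0.
move=> x; have [xK|xK] := pselect (closure [set x | phi x != 0] x); last first.
  by rewrite (test_out tphi)// normr0 addr_ge0.
apply: HM; last by exists x.
by rewrite (le_lt_trans (ler_norm M))// ltrDl.
Qed.

(** The near-covering form of compactness makes one [e] serve for the whole of [K]; it later keeps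
    shifted supports of test functions inside [Om]. *)
Lemma compact_thick K Om : compact K -> K `<=` Om -> open Om ->
  exists2 e : R, 0 < e & forall x y, K x -> `|y| < e -> Om (x + y).
Proof.
move=> /compact_near_coveringP cK KOm oOm.
have : nbhs (0 : E) [set y | K `<=` (fun x => Om (x + y))].
  apply: (cK E (nbhs (0 : E) : set_system E) (fun y x => Om (x + y))) => x Kx.
  have H : (fun p : E * E => p.1 + p.2) @ (x, 0 : E) --> x.
    by rewrite -[X in _ --> X]addr0; apply: cvgD; [exact: cvg_fst|exact: cvg_snd].
  by apply: (H Om); exact: open_nbhs_nbhs (conj oOm (KOm _ Kx)).
move=> /nbhs_ballP[e /= e0 eP]; exists e => // x y Kx ye; apply: (eP y) => //.
by rewrite -ball_normE /= sub0r normrN.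
Qed.

(** Mean value theorem on the segment from [x] to [x + t e_i]. The parameter runs through [0, 1] and
    multiplies [t], so that the sign of [t] never has to be distinguished. *)
Lemma deriv_lip2 f i x (t L : R) : (forall s : R, 0 <= s <= 1 ->
    derivable f (x + (s * t) *: delta_mx ord0 i) (delta_mx ord0 i)) ->
  (forall s : R, 0 <= s <= 1 -> `|partial i f (x + (s * t) *: delta_mx ord0 i)| <= L) ->
  `|f (x + t *: delta_mx ord0 i) - f x| <= L * `|t|.
Proof.
set v : E := delta_mx ord0 i => df dfL.
pose g (s : R) := f (x + s *: v).
pose h (s : R) := g (s * t).
have dh (s : R) : 0 <= s <= 1 -> is_derive s (1 : R) h (partial i f (x + (s * t) *: v) * t).
  move=> s01; apply: (@is_derive1_comp _ g (fun s => s * t)).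
    by apply: is_derive_line; split; first exact: df.
  have H := is_deriveM (is_derive_id s (1 : R)) (is_derive_cst t s (1 : R)).
  by apply: (is_derive_congr H); rewrite scaler0 add0r [t *: 1]mulr1.
have [||c] := @MVT _ h (fun s => partial i f (x + (s * t) *: v) * t) _ _ ltr01.
- by move=> c; rewrite in_itv/= => /andP[? ?]; apply: dh; rewrite !ltW.
- apply: continuous_in_subspaceT => c; rewrite inE/= in_itv/= => /dh [dhc _].
  exact/differentiable_continuous/derivable1_diffP.
rewrite in_itv/= => /andP[c0 c1]; rewrite /h /g mul1r mul0r scale0r addr0 => ->.
by rewrite subr0 mulr1 normrM ler_wpM2r// dfL// !ltW.
Qed.

Lemma deriv_lip f i x (t L : R) : (forall s, `|s| <= `|t| ->
    derivable f (x + s *: delta_mx ord0 i) (delta_mx ord0 i)) ->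
  (forall s, `|s| <= `|t| -> `|partial i f (x + s *: delta_mx ord0 i)| <= L) ->
  `|f (x + t *: delta_mx ord0 i) - f x| <= L * `|t|.
Proof.
have H (s : R) : 0 <= s <= 1 -> `|s * t| <= `|t|.
  by move=> /andP[s0 s1]; rewrite normrM ger0_norm// ler_piMl.
by move=> df dfL; apply: deriv_lip2 => s /H; [exact: df|exact: dfL].
Qed.

(** Measurable and essentially bounded functions: stable under sums and products and, on a set of
    finite measure, members of every L^p, so that integrability of discrete quantities follows from
    their shape. *)
Definition bdf A f := measurable_fun A f /\
  exists2 M : R, 0 <= M & {ae leb d, forall x, A x -> `|f x| <= M}.

Lemma bdf_integrable A f : measurable A -> (leb d A < +oo)%E -> bdf A f ->
  (leb d).-integrable A (EFin \o f).
Proof.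
move=> mA Afin [mf [M M0 fM]]; apply/integrableP; split; first exact/measurable_EFinP.
apply: (@le_lt_trans _ _ (\int[leb d]_(x in A) M%:E)%E).
  apply: ae_ge0_le_integral => //.
  by apply: measurableT_comp => //; exact/measurable_EFinP.
by rewrite integral_cst// lte_mul_pinfty ?lee_fin.
Qed.

Lemma bdf_bounded A f (M : R) : measurable_fun A f -> 0 <= M ->
  (forall x, A x -> `|f x| <= M) -> bdf A f.
Proof. by move=> mf M0 fM; split => //; exists M => //; exact: aeW. Qed.

Lemma cvg_dnbhs0 (u : R^nat) : u @ \oo --> 0 -> (forall n, u n != 0) ->
  u @ \oo --> 0^'.
Proof.
move=> u0 un0 A; rewrite /dnbhs /within /= => /u0.
by rewrite !near_simpl; apply: filterS => n; exact.
Qed.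

Lemma is_derive_cvg_seq f x v (df : R) (t : R^nat) : is_derive x v f df ->
  t @ \oo --> 0 -> (forall n, t n != 0) ->
  (f (x + t n *: v) - f x) / t n @[n --> \oo] --> df.
Proof.
move=> [fv <-] t0 tn0.
have := cvg_comp _ _ (cvg_dnbhs0 t0 tn0) fv.
apply: cvg_trans; apply: near_eq_cvg; near=> n => /=.
by rewrite [X in f X]addrC [RHS]mulrC.
Unshelve. all: by end_near. Qed.

(* Summation by parts on difference quotients, then dominated convergence. *)
Lemma weak_partial Om f (G : E -> R) (i : 'I_d) (M L : R) phi :
  open Om -> bounded_set Om -> measurable_fun Om f -> measurable_fun Om G ->
  (forall x, Om x -> `|f x| <= M) ->
  (forall x (t : R), (forall s, `|s| <= `|t| -> Om (x + s *: delta_mx ord0 i)) ->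
     `|f (x + t *: delta_mx ord0 i) - f x| <= L * `|t|) ->
  {ae leb d, forall x, Om x -> is_derive x (delta_mx ord0 i : E) f (G x)} ->
  test_function Om phi ->
  \int[leb d]_(x in Om) (f x * partial i phi x) =
  - \int[leb d]_(x in Om) (G x * phi x).
Proof.
move=> oOm bOm mf mG fM fL dfG tphi.
have [sphi cK KOm] := tphi.
pose v : E := delta_mx ord0 i.
have mOm : measurable Om := open_measurable_rV oOm.
have Omfin : (leb d Om < +oo)%E := leb_bounded_fin bOm mOm.
have [Mp Mp0 phiM] := test_bounded tphi.
have [Lp Lp0 phiL] := test_bounded (test_partial i tphi).
have [e e0 eP] := compact_thick cK KOm oOm.
have phi0 x : ~ Om x -> phi x = 0.
  by move=> xOm; apply: (test_out tphi) => /KOm.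
(* Extension by zero, so that translation invariance on the whole space applies. The support of
   [phi] keeps the distance [e] from the complement of [Om], hence shifts shorter than [e] never see
   the extension where [phi] is nonzero. *)
pose F := f \_ Om.
have FOm x : Om x -> F x = f x by move=> Ox; rewrite /F patchE mem_set.
have F0 x : ~ Om x -> F x = 0 by move=> Ox; rewrite /F patchE memNset.
pose M' := `|M|.
have FM x : `|F x| <= M'.
  have [Ox|Ox] := pselect (Om x); last by rewrite F0// normr0 /M'.
  by rewrite FOm// (le_trans (fM _ Ox))// ler_norm.
have mF : measurable_fun [set: E] F by apply/(measurable_restrictT _ mOm).
have mphi : measurable_fun [set: E] phi.
  by apply: continuous_measurable_rV; exact: smooth_continuous.
(* Steps that are nonzero, strictly below [e], and tend to 0. *)
pose t (n : nat) : R := e / (n%:R + 2).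
have tgt0 n : 0 < t n by rewrite divr_gt0// addr_gt0.
have tlte n : t n < e.
  rewrite /t ltr_pdivrMr; last by rewrite ltr_wpDl.
  by have := mulr_ge0 (ltW e0) (ler0n R n); rewrite mulrDr; lra.
have tn0 n : t n != 0 by rewrite gt_eqF.
have tcvg : t @ \oo --> 0.
  have -> : t = (fun n => e * n.+2%:R^-1).
    by apply/funext => n; rewrite /t -natrD addn2.
  rewrite -[X in _ --> X](mulr0 e); apply: cvgMr.
  rewrite (_ : (fun _ => _) = (fun n => harmonic (n + 1)%N)).
    by rewrite (cvg_shiftn 1 (harmonic : R^nat)); exact: cvg_harmonic.
  by apply/funext => n; rewrite /harmonic /= addn1.
have normtv (s : R) : `|s *: v| <= `|s|.
  rewrite normrZ ler_piMr// /v.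
  by rewrite [leLHS]/Num.norm /= mx_normrE; apply: bigmax_le => // k _; rewrite !mxE;
     case: (_ && _); rewrite /= ?normr1 ?normr0.
have Kin x (s : R) : phi x != 0 -> `|s| < e -> Om (x + s *: v).
  by move=> px se; apply: eP; [exact: subset_closure|exact: le_lt_trans (normtv s) se].
have mtr (a : E) (h : E -> R) : measurable_fun [set: E] h ->
    measurable_fun [set: E] (fun x => h (x + a)).
  by move=> mh; exact: (measurableT_comp mh (measurable_translate a)).
pose D n x := F x * ((phi (x + t n *: v) - phi x) / t n).
pose D' n x := (F (x + (- t n) *: v) - F x) / t n * phi x.
have restr (h : E -> R) : (forall x, ~ Om x -> h x = 0) ->
    (\int[leb d]_x (h x)%:E = \int[leb d]_(x in Om) (h x)%:E)%E.
  move=> h0; rewrite [RHS]integral_mkcond; apply: eq_integral => x _.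
  by rewrite patchE; case: ifPn => // /negP; rewrite inE => /h0 ->.
have intb (h : E -> R) : measurable_fun [set: E] h -> (forall x, ~ Om x -> h x = 0) ->
    (exists M, forall x, `|h x| <= M) -> (leb d).-integrable [set: E] (EFin \o h).
  move=> mh h0 [Mh hM]; apply/integrableP; split; first exact/measurable_EFinP.
  rewrite [ltLHS](_ : _ = \int[leb d]_x (`|h x|%R)%:E)%E//.
  rewrite restr; last by move=> x /h0 ->; rewrite normr0.
  have : bdf Om h.
    apply: (@bdf_bounded _ _ `|Mh|) => //; first exact: measurable_funTS.
    by move=> x _; rewrite (le_trans (hM x))// ler_norm.
  by move=> /(bdf_integrable mOm Omfin) /integrableP[].
(* Discrete integration by parts: a translation by [- t n] carries the difference quotient from
   [phi] over to [F]. It remains to pass to the limit on both sides, with dominating constants from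
   the derivative of [phi] and from the Lipschitz bound [L]. *)
have DE n : (\int[leb d]_(x in Om) (D n x)%:E = \int[leb d]_(x in Om) (D' n x)%:E)%E.
  rewrite -restr; last by move=> x /F0 Fx; rewrite /D Fx mul0r.
  rewrite -restr; last by move=> x /phi0 px; rewrite /D' px mulr0.
  pose H x := F x * phi (x + t n *: v).
  have mH : measurable_fun [set: E] H by apply: measurable_funM => //; exact: mtr.
  have iH : (leb d).-integrable [set: E] (EFin \o H).
    apply: intb => //; first by move=> x /F0 Fx; rewrite /H Fx mul0r.
    by exists (M' * Mp) => x; rewrite normrM ler_pM.
  have iFp : (leb d).-integrable [set: E] (EFin \o (F \* phi)%R).
    apply: intb => //.
    - exact: measurable_funM.
    - by move=> x /F0 Fx /=; rewrite Fx mul0r.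
    - by exists (M' * Mp) => x; rewrite normrM ler_pM.
  have iH' : (leb d).-integrable [set: E] (EFin \o (fun x => H (x + (- t n) *: v))).
    apply/integrableP; split; first by apply/measurable_EFinP; exact: mtr.
    have /integrableP[_] := iH.
    rewrite -(@integral_leb_translate _ _ ((- t n) *: v) (abse \o (EFin \o H)))//.
    by apply: measurableT_comp => //; exact/measurable_EFinP.
  transitivity ((t n)^-1%:E * (\int[leb d]_x (H x)%:E - \int[leb d]_x ((F \* phi)%R x)%:E))%E.
    rewrite -integralB_EFin// -integralZl//; last exact: (integrableB measurableT iH iFp).
    by apply: eq_integral => x _; rewrite -!EFinM /D /H /=; congr EFin; ring.
  rewrite -(@integral_leb_translate _ _ ((- t n) *: v) (EFin \o H)); last exact/measurable_EFinP.
  rewrite -integralB_EFin// -integralZl//; last exact: (integrableB measurableT iH' iFp).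
  apply: eq_integral => x _; rewrite -!EFinM /D' /H /=; congr EFin.
  rewrite -addrA -scalerDl addNr scale0r addr0; ring.
have icst (c : R) : (leb d).-integrable Om (cst c%:E).
  by apply: (@bdf_integrable _ (cst c) mOm Omfin); apply: (@bdf_bounded _ _ `|c|).
have mphiOm : measurable_fun Om phi by exact: measurable_funTS.
have [|||||iFG _ cD] := @dominated_convergence _ _ _ (leb d) Om mOm
    (fun n => EFin \o D n) (fun x => (F x * partial i phi x)%:E) (cst (M' * Lp)%:E).
- move=> n; apply/measurable_EFinP; apply: measurable_funTS.
  apply: measurable_funM => //; apply: measurable_funM => //.
  by apply: measurable_funB => //; exact: mtr.
- apply/measurable_EFinP; apply: measurable_funTS; apply: measurable_funM => //.
  apply: continuous_measurable_rV; exact/smooth_continuous/smooth_partial.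
- apply: aeW => x Ox; apply/fine_cvgP; split; first by near=> n.
  apply: cvgMr; exact: (is_derive_cvg_seq (smooth_is_derive i x sphi) tcvg tn0).
- exact: icst.
- apply: aeW => x n Ox /=; rewrite lee_fin normrM ler_pM//.
  rewrite normrM normfV ler_pdivrMr ?normr_gt0//.
  apply: deriv_lip => s _; [exact: smooth_derivable|exact: phiL].
have [|||||iGp _ cD'] := @dominated_convergence _ _ _ (leb d) Om mOm
    (fun n => EFin \o D' n) (fun x => (- (G x * phi x))%:E) (cst (`|L| * Mp)%:E).
- move=> n; apply/measurable_EFinP; apply: measurable_funTS.
  apply: measurable_funM => //; apply: measurable_funM => //.
  by apply: measurable_funB => //; exact: mtr.
- by apply/measurable_EFinP; apply: measurableT_comp => //; exact: measurable_funM.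
- apply: filterS dfG => x dfx Ox; apply/fine_cvgP; split; first by near=> n.
  (* Where [phi] vanishes the quotient of [F] may feel the jump across the boundary of [Om], but it
     is multiplied by zero; elsewhere both points lie in [Om] and [F] is [f]. *)
  rewrite -mulNr; have [px0|px0] := eqVneq (phi x) 0.
    rewrite (_ : fine \o _ = cst 0) ?px0 ?mulr0//; first exact: cvg_cst.
    by apply/funext => n; rewrite /= /D' px0 mulr0.
  apply: cvgMl.
  rewrite (_ : (fun n => _) = - (fun n => (f (x + (- t n) *: v) - f x) / (- t n))).
    apply: cvgN; apply: (is_derive_cvg_seq (dfx Ox)).
      by rewrite -oppr0; exact: cvgN.
    by move=> n; rewrite oppr_eq0.
  apply/funext => n /=; rewrite !FOm//; last first.
    by apply: Kin => //; rewrite normrN gtr0_norm.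
  by rewrite -[RHS]/(- ((f (x + - t n *: v) - f x) / - t n)) invrN mulrN opprK.
- exact: icst.
- apply: aeW => x n Ox /=; rewrite lee_fin normrM.
  have [px0|px0] := eqVneq (phi x) 0; first by rewrite px0 normr0 mulr0 mulr_ge0.
  rewrite ler_pM// normrM normfV ler_pdivrMr ?normr_gt0//.
  rewrite !FOm//; last by apply: Kin => //; rewrite normrN gtr0_norm.
  apply: le_trans (fL _ _ _) _.
    by move=> s; rewrite normrN => st; apply: Kin => //; apply: (le_lt_trans st); rewrite gtr0_norm.
  by rewrite normrN ler_wpM2r// ler_norm.
have cDD : (fun n => \int[leb d]_(x in Om) (EFin \o D n) x)%E =
          (fun n => \int[leb d]_(x in Om) (EFin \o D' n) x)%E.
  by apply/funext => n; exact: DE.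
rewrite cDD in cD.
have EE := cvg_unique (@ereal_hausdorff R) cD cD'.
rewrite /Rintegral -mulN1r -RintegralZl//; last first.
  have := integrableN iGp; apply: eq_integrable => // x _ /=.
  by rewrite opprK.
rewrite /Rintegral; congr fine.
transitivity (\int[leb d]_(x in Om) (F x * partial i phi x)%:E)%E.
  by apply: eq_integral => x; rewrite inE => Ox; rewrite FOm.
by rewrite EE; apply: eq_integral => x _; rewrite mulN1r.
Unshelve. all: by end_near. Qed.
End calculus.

(** * Bump functions and weak gradients *)

Section bump.
Context {R : realType}.
Implicit Types (P Q : {poly R}) (t : R).

Lemma is_derive_horner P t : is_derive t (1 : R) (horner P) (P^`()).[t].
Proof.
elim/poly_ind: P => [|P c IH].
  rewrite deriv0 horner0 (_ : horner 0 = cst 0); first exact: is_derive_cst.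
  by apply/funext => x; rewrite horner0.
rewrite (_ : horner (P * 'X + c%:P) = horner P * id + cst c); last first.
  by apply/funext => x; rewrite !hornerE.
have := is_deriveD (is_deriveM IH (is_derive_id t (1 : R))) (is_derive_cst c t (1 : R)).
move=> H; apply: (is_derive_congr H).
by rewrite derivD derivM derivX derivC !hornerE /= /GRing.scale/=; ring.
Qed.

(** The functions P(1/t) exp(-1/t), extended by zero to t <= 0. The family is closed under
    differentiation, so smoothness reduces to a single derivative. *)
Definition flat P t : R := if 0 < t then P.[t^-1] * expR (- t^-1) else 0.

Lemma poly_expR_bound P : exists2 M : R, 0 <= M &
  forall s, 0 <= s -> `|P.[s]| * expR (- s) <= M.
Proof.
have mono n s : 0 <= s -> s ^+ n <= n`!%:R * expR s.
  case: n => [|n] s0; first by rewrite expr0 mul1r -expR0 ler_expR.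
  rewrite -ler_pdivrMl ?ltr0n ?fact_gt0// mulrC.
  by apply: le_trans (expR_ge1Dxn n s0); rewrite lerDr.
exists (\sum_(i < size P) `|P`_i| * i`!%:R).
  by apply: sumr_ge0 => i _; rewrite mulr_ge0.
move=> s s0; rewrite expRN ler_pdivrMr ?expR_gt0// horner_coef.
apply: le_trans (ler_norm_sum _ _ _) _; rewrite mulr_suml; apply: ler_sum => i _.
by rewrite normrM -mulrA ler_wpM2l// ger0_norm ?exprn_ge0// mono.
Qed.

(** The previous bound for ['X^2 * P] at 1/t: the factor t^-2 turns into quadratic decay, which
    gives a zero derivative at the origin. *)
Lemma flat_small P : exists2 M : R, 0 <= M & forall t, `|flat P t| <= M * t ^+ 2.
Proof.
have [M M0 H] := poly_expR_bound ('X^2 * P); exists M => // t.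
rewrite /flat; case: ifPn => t0; last by rewrite normr0 mulr_ge0// sqr_ge0.
have := H t^-1; rewrite invr_ge0 ltW// => /(_ isT).
rewrite hornerM hornerXn !normrM (ger0_norm (expR_ge0 _)).
rewrite -ler_pdivrMr ?exprn_gt0//; apply: le_trans.
rewrite (@gtr0_norm _ t^-1) ?invr_gt0// le_eqVlt; apply/orP; left; apply/eqP.
by field; rewrite gt_eqF.
Qed.

Lemma is_derive_flat P t :
  is_derive t (1 : R) (flat P) (flat ('X^2 * (P - P^`())) t).
Proof.
have [t0|t0|->] := ltgtP t 0.
- rewrite {2}/flat (lt_gtF t0).
  apply: (near_eq_is_derive _ (is_derive_cst (0 : R) t (1 : R))).
  near=> s; rewrite /flat ifF//; apply/negbTE; rewrite -leNgt ltW//.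
  by near: s; exact: lt_nbhsl.
- rewrite {2}/flat t0.
  have dV : is_derive t (1 : R) (fun s : R => s^-1) (- t ^- 2 *: 1).
    by apply: (is_deriveV (f := id)); rewrite gt_eqF.
  have dN := is_deriveN dV.
  have H := is_deriveM (is_derive1_comp (is_derive_horner P _) dV)
     (is_derive1_comp (is_derive_expR _) dN).
  have := near_eq_is_derive _ H; move/(_ (flat P)) => H'.
  apply: (is_derive_congr (H' _)); first by near=> s; rewrite /flat ifT//; near: s; exact: lt_nbhsr.
  rewrite !hornerE /= -!exprVn.
  by set e := expR _; rewrite /GRing.scale/=; ring.
have [M M0 HM] := flat_small P.
rewrite {2}/flat ltxx.
have cv0 : h^-1 *: ((flat P \o shift 0) (h *: (1 : R)) - flat P 0) @[h --> 0^'] --> (0 : R).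
  apply/cvgrPdist_lt => e e0; near=> h.
  rewrite sub0r normrN /flat ltxx subr0 -/(flat P _) /= addr0 normrZ normfV.
  have h0 : h != 0 by near: h; exact: nbhs_dnbhs_neq.
  rewrite [h *: 1]mulr1 ltr_pdivrMl ?normr_gt0//.
  apply: (le_lt_trans (HM h)); rewrite -real_normK ?num_real// expr2 mulrA.
  rewrite [ltLHS]mulrC ltr_pM2l ?normr_gt0//.
  apply: (@le_lt_trans _ _ ((M + 1) * `|h|)); first by rewrite ler_wpM2r// lerDl.
  rewrite mulrC -ltr_pdivlMr ?ltr_wpDl//.
  near: h; apply: dnbhs0_lt; exact: divr_gt0 e0 (ltr_wpDl M0 ltr01).
split; first by apply/cvg_ex; exists 0.
exact: (cvg_lim (@Rhausdorff R) cv0).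
Unshelve. all: by end_near. Qed.

Lemma is_derive_coord d (G : R -> R) (dG : R) (x : 'rV[R]_d) i j :
  is_derive (x ord0 i) (1 : R) G dG ->
  is_derive x (delta_mx ord0 j : 'rV[R]_d) (fun x => G (x ord0 i))
    (if j == i then dG else 0).
Proof.
move=> [dv dvE].
have [->|ji] := eqVneq j i.
  have E : (fun h => h^-1 *: (((fun x => G (x ord0 i)) \o shift x)
        (h *: (delta_mx ord0 i : 'rV[R]_d)) - G (x ord0 i)))
     = (fun h => h^-1 *: ((G \o shift (x ord0 i)) (h *: (1 : R)) - G (x ord0 i))).
    by apply/funext => h /=; rewrite !mxE !eqxx.
  by split; rewrite /derivable /derive E.
have E : (fun h => h^-1 *: (((fun x => G (x ord0 i)) \o shift x)
      (h *: (delta_mx ord0 j : 'rV[R]_d)) - G (x ord0 i)))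
   = cst 0.
  apply/funext => h /=; rewrite !mxE eqxx eq_sym (negbTE ji) mulr0 add0r subrr.
  by rewrite scaler0.
split; rewrite /derivable /derive E; first exact: is_cvg_cst.
by apply: cvg_lim => //; exact: cvg_cst.
Qed.

(** A family of one-variable functions stable under derivation consists of smooth functions of a
    coordinate; the zero function must belong to it because the partial derivatives in the other
    directions vanish. *)
Lemma Ck_coord d (S : set (R -> R)) : S (cst 0) ->
  (forall G, S G -> exists2 G', S G' & forall s, is_derive s (1 : R) G (G' s)) ->
  forall k G (i : 'I_d), S G -> Ck k (fun x : 'rV[R]_d => G (x ord0 i)).
Proof.
move=> S0 HS; elim=> [|k IH] G i SG.
  split => // x; apply: continuous_comp; first exact: coord_continuous.
  have [G' _ dG] := HS _ SG.
  by apply/differentiable_continuous/derivable1_diffP; by have [] := dG (x ord0 i).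
split; first exact: (Ck_continuous (IH _ i SG)).
have [G' SG' dG] := HS _ SG.
move=> j; split; first by move=> x; have [] := is_derive_coord j (dG (x ord0 i)).
rewrite (_ : partial j _ = (fun x => (if j == i then G' else cst 0) (x ord0 i))).
  by apply: IH; case: eqP.
apply/funext => x; rewrite /partial.
by have [_ ->] := is_derive_coord j (dG (x ord0 i)); case: eqP.
Qed.

Lemma smooth_flat d P (a b : R) (i : 'I_d) :
  smooth (fun x : 'rV[R]_d => flat P (x ord0 i * a + b)).
Proof.
move=> k; pose S := [set G | exists P, G = (fun s => flat P (s * a + b))].
apply: (@Ck_coord d S _ _ k (fun s => flat P (s * a + b)) i); last by exists P.
  by exists 0; apply/funext => s; rewrite /flat horner0 mul0r if_same.
move=> _ [Q ->]; exists (fun s => flat (a *: ('X^2 * (Q - Q^`()))) (s * a + b)).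
  by eexists.
move=> s.
have da : is_derive s (1 : R) (fun s : R => s * a + b) a.
  have := is_deriveD (is_deriveM (is_derive_id s (1 : R)) (is_derive_cst a s (1 : R)))
    (is_derive_cst b s (1 : R)).
  by move=> H; apply: (is_derive_congr H); rewrite scaler0 add0r addr0 [a *: 1]mulr1.
have := @is_derive1_comp _ (flat Q) (fun s => s * a + b) s _ _ (is_derive_flat Q (s * a + b)) da.
move=> H; apply: (is_derive_congr H); rewrite /flat; case: ifP => _; last by rewrite mul0r.
by rewrite hornerZ; ring.
Qed.

Lemma smooth_cst d (c : R) : smooth (cst c : 'rV[R]_d -> R).
Proof.
move=> k; elim: k c => [|k IH] c; first by split => // x; exact: cst_continuous.
split; first exact: cst_continuous.
move=> i; split; first by move=> x; exact: derivable_cst.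
rewrite (_ : partial i _ = cst 0)//; apply/funext => x.
by rewrite /partial derive_cst.
Qed.

Lemma smooth_prod d n (f : 'I_n -> 'rV[R]_d -> R) :
  (forall i, smooth (f i)) -> smooth (fun x => \prod_(i < n) f i x).
Proof.
elim: n f => [|n IH] f sf.
  rewrite (_ : (fun _ => _) = cst 1); first exact: smooth_cst.
  by apply/funext => x; rewrite big_ord0.
rewrite (_ : (fun _ => _) = (f ord0 \* (fun x => \prod_(i < n) f (lift ord0 i) x))%R).
  by apply: smoothM => //; apply: IH.
by apply/funext => x; rewrite big_ord_recl.
Qed.

(** For t > 0 this is exp(-1 / ((n+1) t)): a smooth function with values in [0, 1] that tends
    pointwise to the indicator of the positive half-line. *)
Definition mollif (n : nat) (t : R) : R := flat 1 (n.+1%:R * t).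

Lemma mollif_ge0 n t : 0 <= mollif n t <= 1.
Proof.
rewrite /mollif /flat; case: ifPn => [t0|]; last by rewrite lexx ler01.
by rewrite hornerC mul1r expR_ge0 -[leRHS]expR0 ler_expR oppr_le0 invr_ge0 ltW.
Qed.

Lemma mollif0 n t : t <= 0 -> mollif n t = 0.
Proof. by move=> t0; rewrite /mollif /flat ifF// pmulr_rgt0// ltNge t0. Qed.

Lemma mollif_cvg t : 0 < t -> mollif n t @[n --> \oo] --> (1 : R).
Proof.
move=> t0.
rewrite (_ : (fun n => _) = (fun n => expR (- (t^-1 * harmonic n)))); last first.
  by apply/funext => n; rewrite /mollif /flat pmulr_rgt0// t0 hornerC mul1r invfM mulrC.
rewrite -expR0; apply: (cvg_comp _ expR); last exact: continuous_expR.
rewrite -oppr0; apply: cvgN; rewrite -(mulr0 t^-1); apply: cvgMr; exact: cvg_harmonic.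
Qed.

End bump.

Lemma cvg_prod_ord (R : realType) n (f : 'I_n -> R^nat) (l : 'I_n -> R) :
  (forall i, f i k @[k --> \oo] --> l i) ->
  \prod_(i < n) f i k @[k --> \oo] --> \prod_(i < n) l i.
Proof.
elim: n f l => [|n IH] f l fl.
  rewrite big_ord0 (_ : (fun _ => _) = cst 1); first exact: cvg_cst.
  by apply/funext => k; rewrite big_ord0.
rewrite big_ord_recl.
rewrite (_ : (fun k => _) = (fun k => f ord0 k * \prod_(i < n) f (lift ord0 i) k)).
  by apply: cvgM => //; exact: IH.
by apply/funext => k; rewrite big_ord_recl.
Qed.

(** * The fundamental lemma of the calculus of variations *)

Section fundamental.
Context {R : realType} {d : nat}.
Local Notation E := 'rV[R]_d.
Implicit Types (a b : 'I_d -> R) (Om : set E).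

Definition cbox a b : set E := [set x | forall i, a i <= x ord0 i <= b i].
Definition obox a b : set E := [set x | forall i, a i < x ord0 i < b i].

Lemma measurable_cbox a b : measurable (cbox a b).
Proof.
have := @measurable_coord_itv R d (fun i => `[(a i), (b i)]).
by congr measurable; apply/seteqP; split => x /= + i => /(_ i); rewrite in_itv.
Qed.

Lemma measurable_obox a b : measurable (obox a b).
Proof.
have := @measurable_coord_itv R d (fun i => `](a i), (b i)[).
by congr measurable; apply/seteqP; split => x /= + i => /(_ i); rewrite in_itv.
Qed.

Lemma compact_cbox a b : compact (cbox a b).
Proof.
have := @rV_compact R d (fun i => `[(a i), (b i)]%classic)
  (fun i => @segment_compact R (a i) (b i)).
congr compact; by apply/seteqP; split => x /= + i => /(_ i); rewrite in_itv.
Qed.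

Lemma obox_cbox a b : obox a b `<=` cbox a b.
Proof. by move=> x xab i; have /andP[? ?] := xab i; rewrite !ltW. Qed.

Definition bump_box a b (n : nat) (x : E) : R :=
  \prod_(i < d) (mollif n (x ord0 i - a i) * mollif n (b i - x ord0 i)).

Lemma smooth_bump_box a b n : smooth (bump_box a b n).
Proof.
apply: smooth_prod => i; apply: smoothM.
  rewrite (_ : (fun _ => _) =
      (fun x : E => flat 1 (x ord0 i * n.+1%:R + (- (n.+1%:R * a i))))).
    exact: smooth_flat.
  by apply/funext => x; rewrite /mollif; congr flat; ring.
rewrite (_ : (fun _ => _) =
    (fun x : E => flat 1 (x ord0 i * (- n.+1%:R) + n.+1%:R * b i))).
  exact: smooth_flat.
by apply/funext => x; rewrite /mollif; congr flat; ring.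
Qed.

Lemma bump_box0 a b n x : ~ obox a b x -> bump_box a b n x = 0.
Proof.
move=> /existsNP[i /negP]; rewrite negb_and -!leNgt => xab.
rewrite /bump_box (bigD1 i)//=; case/orP : xab => xab.
  by rewrite mollif0 ?mul0r// subr_le0.
by rewrite [X in _ * X * _]mollif0 ?mulr0 ?mul0r// subr_le0.
Qed.

Lemma bump_box_ge0 a b n x : 0 <= bump_box a b n x <= 1.
Proof.
apply/andP; split.
  apply: prodr_ge0 => i _; have /andP[? _] := mollif_ge0 n (x ord0 i - a i).
  by have /andP[? _] := mollif_ge0 n (b i - x ord0 i); rewrite mulr_ge0.
rewrite /bump_box -[leRHS](big1_eq (R := R) (idx := 1) (op := *%R) (index_enum 'I_d) xpredT).
apply: ler_prod => i _.
have /andP[? ?] := mollif_ge0 n (x ord0 i - a i).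
have /andP[? ?] := mollif_ge0 n (b i - x ord0 i).
by rewrite mulr_ge0//= mulr_ile1.
Qed.

Lemma bump_box_cvg a b x :
  bump_box a b n x @[n --> \oo] --> (\1_(obox a b) x : R).
Proof.
rewrite indicE; have [xab|xab] := pselect (obox a b x); last first.
  rewrite memNset// (_ : (fun _ => _) = cst 0); first exact: cvg_cst.
  by apply/funext => n; rewrite bump_box0.
rewrite mem_set//= /bump_box.
rewrite (_ : 1%:R = \prod_(i < d) (1 * 1)); last first.
  by rewrite big1// => i _; rewrite mulr1.
apply: (@cvg_prod_ord _ _ (fun i n => mollif n (x ord0 i - a i) * mollif n (b i - x ord0 i))) => i.
have /andP[xa xb] := xab i.
by apply: cvgM; apply: mollif_cvg; rewrite subr_gt0.
Qed.

Lemma test_bump_box Om a b n : cbox a b `<=` Om ->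
  test_function Om (bump_box a b n).
Proof.
move=> bOm.
have clb : closed (cbox a b).
  by apply: compact_closed; [exact: norm_hausdorff|exact: compact_cbox].
have sub : closure [set x | bump_box a b n x != 0] `<=` cbox a b.
  rewrite closureE => x; apply; split => // y /= yn0; apply: obox_cbox.
  by apply: contrapT => /bump_box0 y0; move: yn0; rewrite y0 eqxx.
split; [exact: smooth_bump_box| |exact: subset_trans bOm].
by apply: subclosed_compact sub => //; [exact: closed_closure|exact: compact_cbox].
Qed.

(** The functions [bump_box] are test functions converging to the indicator of the open box, and |g|
    dominates on the closed box, where it is integrable by compactness. *)
Lemma integral_obox0 Om (g : E -> R) a b : loc_integrable Om g ->
  measurable Om ->
  (forall phi, test_function Om phi -> \int[leb d]_(x in Om) (g x * phi x) = 0) ->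
  cbox a b `<=` Om -> (\int[leb d]_(x in obox a b) (g x)%:E = 0)%E.
Proof.
move=> [mg ig] mOm g0 abOm; pose B := cbox a b.
have mB : measurable B by exact: measurable_cbox.
have iB : (leb d).-integrable B (EFin \o g) by apply: ig => //; exact: compact_cbox.
have mgB : measurable_fun B g by exact: measurable_funS mg.
have mbump n : measurable_fun B (bump_box a b n).
  by apply: measurable_funTS; apply: continuous_measurable_rV; exact/smooth_continuous/smooth_bump_box.
have [|||||_ _] := @dominated_convergence _ _ _ (leb d) B mB
    (fun n x => (g x * bump_box a b n x)%:E)
    (fun x => (g x * \1_(obox a b) x)%:E) (fun x => `|(g x)%:E|%E).
- by move=> n; apply/measurable_EFinP; exact: measurable_funM.
- apply/measurable_EFinP; apply: measurable_funM => //.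
  by apply: measurable_indic; exact: measurable_obox.
- apply: aeW => x Bx; apply/fine_cvgP; split; first by near=> n.
  by apply: cvgMr; exact: bump_box_cvg.
- exact: integrable_abse.
- apply: aeW => x n Bx; rewrite /= lee_fin normrM ler_piMr//.
  by have /andP[? ?] := bump_box_ge0 a b n x; rewrite ger0_norm.
rewrite (_ : [sequence _]_n = cst 0%E); last first.
  apply/funext => n /=.
  have := g0 _ (test_bump_box n abOm); rewrite /Rintegral.
  rewrite [X in fine X](_ : _ = \int[leb d]_(x in B) (g x * bump_box a b n x)%:E)%E.
    move=> /eqP; rewrite fine_eq0; first by move=> /eqP.
    apply: integrable_fin_num => //.
    apply: le_integrable iB => //.
      by apply/measurable_EFinP; exact: measurable_funM.
    move=> x Bx /=; rewrite lee_fin normrM ler_piMr//.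
    by have /andP[? ?] := bump_box_ge0 a b n x; rewrite ger0_norm.
  rewrite [LHS]integral_mkcond [RHS]integral_mkcond; apply: eq_integral => x _.
  rewrite !patchE; case: ifPn => [|/negP]; rewrite inE => xO; case: ifPn => [|/negP];
    rewrite inE => xB //.
  - by rewrite bump_box0 ?mulr0//; move=> /obox_cbox.
  - by case: xO; exact: abOm.
move=> cv; have H := cvg_unique (@ereal_hausdorff R) cv (cvg_cst (0 : \bar R)).
have <- : (\int[leb d]_(x in B) (g x * \1_(obox a b) x)%:E = 0)%E by rewrite H.
rewrite [LHS]integral_mkcond [RHS]integral_mkcond; apply: eq_integral => x _.
rewrite !patchE indicE; case: ifPn => [|/negP]; rewrite inE => xO; case: ifPn => [|/negP];
  rewrite ?inE => xB //.
- by rewrite mulr1.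
- by case: xB; exact: obox_cbox.
- by rewrite mulr0.
Unshelve. all: by end_near. Qed.

(** A pi-system generating the sigma-algebra; it is chosen because an orthant cuts an open box in
    another open box. *)
Definition orthants : set (set E) :=
  [set A : set E | exists b : 'I_d -> R, A = [set x : E | forall i, x ord0 i < b i]].

Lemma measurable_orthants : @measurable _ E = <<s orthants >>.
Proof.
apply/seteqP; split; last first.
  apply: smallest_sub; first exact: sigma_algebra_measurable.
  move=> _ [b ->].
  have := @measurable_coord_itv R d (fun i => `]-oo, (b i)[).
  by congr measurable; apply/seteqP; split => x /= + i => /(_ i); rewrite in_itv.
move=> A mA.
have := @measurable_fun_rV R _ (g_sigma_algebraType orthants) d (fun x : E => x).
move=> /(_ _ measurableT A mA); rewrite setTI; apply => i.
apply: (measurability _ (RGenInftyO.measurableE R)) => _ [_ [c ->] <-].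
(* A half-space [x_i < c] is the increasing union of the orthants whose other bounds are all [n]. *)
rewrite setTI (_ : _ @^-1` _ = \bigcup_n
    [set x : E | forall j, x ord0 j < (if j == i then c else n%:R)]).
  by apply: bigcupT_measurable => n; apply: sub_sigma_algebra; exists (fun j => if j == i then c else n%:R).
apply/seteqP; split => x /=; rewrite in_itv/=; last by case=> n _ /(_ i); rewrite eqxx.
move=> xc; exists (Num.truncn (\sum_j `|x ord0 j|)).+1 => // j.
case: eqP => [->//|_]; apply: le_lt_trans (Num.Theory.truncnS_gt _).
rewrite (le_trans (ler_norm _))// (bigD1 j)//= lerDl.
by apply: sumr_ge0.
Qed.

(** The measurable sets A for which g integrates to zero over the part of A in the box form a Dynkin
    system containing the orthants, hence are all measurable sets; a function with vanishing
    integrals is zero almost everywhere. *)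
Lemma ae0_obox Om (g : E -> R) a b : loc_integrable Om g -> measurable Om ->
  (forall phi, test_function Om phi -> \int[leb d]_(x in Om) (g x * phi x) = 0) ->
  cbox a b `<=` Om -> {ae leb d, forall x, obox a b x -> g x = 0}.
Proof.
move=> lg mOm g0 abOm; pose B := obox a b.
have mB : measurable B by exact: measurable_obox.
have [mg ig] := lg.
have iB : (leb d).-integrable B (EFin \o g).
  apply: (@integrableS _ _ _ _ (cbox a b)) => //; first exact: measurable_cbox.
    exact: obox_cbox.
  by apply: ig => //; exact: compact_cbox.
have iA A : measurable A -> (leb d).-integrable (A `&` B) (EFin \o g).
  by move=> mA; apply: (integrableS mB) iB => //; exact: measurableI.
have ball0 : forall A, <<s orthants >> A -> (\int[leb d]_(x in A `&` B) (g x)%:E = 0)%E.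
  apply: (dynkin_induction measurable_orthants).
  - move=> _ _ [b1 ->] [b2 ->]; exists (fun i => Num.min (b1 i) (b2 i)).
    apply/seteqP; split => x /=.
      by move=> [x1 x2] i; rewrite lt_min x1 x2.
    by move=> x12; split => i; have := x12 i; rewrite lt_min => /andP[].
  - by rewrite setTI; exact: integral_obox0 abOm.
  - move=> _ [b' ->].
    rewrite (_ : _ `&` _ = obox a (fun i => Num.min (b i) (b' i))).
      apply: (integral_obox0 lg) => //; apply: subset_trans abOm => x xab i.
      by have /andP[-> /=] := xab i; rewrite le_min => /andP[].
    apply/seteqP; split => x /=.
      by move=> [x1 x2] i; have /andP[x3 x4] := x2 i; rewrite x3 lt_min x4 x1.
    by move=> x12; split => i; have := x12 i; rewrite lt_min => /and3P[x1 x2 x3] //; rewrite x1 x2.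
  - move=> S mS S0; have : (\int[leb d]_(x in B) (g x)%:E = 0)%E.
      exact: integral_obox0 abOm.
    have BE : B = (S `&` B) `|` (~` S `&` B) by rewrite -setIUl setUv setTI.
    rewrite {1}BE integral_setU ?S0 ?add0e//.
    + exact: measurableI.
    + by apply: measurableI => //; exact: measurableC.
    + by rewrite -BE; have /integrableP[] := iB.
    + by apply/disj_setPS => x [[? _] []].
  - move=> F mF tF F0; rewrite setI_bigcupl integral_bigcup//.
    + by apply: eseries0 => i _ _; exact: F0.
    + apply/trivIsetP => i j _ _ ij; move/trivIsetP : tF => /(_ i j Logic.I Logic.I ij) FF.
      by rewrite setIACA FF set0I.
    + by move=> k; exact: measurableI.
    + by rewrite -setI_bigcupl; apply: iA; exact: bigcupT_measurable.
have := @integral_ae_eq _ _ _ (leb d) B mB (cst 0%E) (EFin \o g) iB (measurable_cst _).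
move=> H; have /= : ae_eq (leb d) B (EFin \o g) (cst 0%E).
  apply: H => A AB mA; rewrite integral0 -(setIidl AB).
  by apply: ball0; rewrite -measurable_orthants.
by apply: filterS => x /[apply] -[].
Qed.

(* Bump functions exhaust the indicators of rational boxes, which cover Om. *)
Lemma weak_zero Om (g : E -> R) : open Om -> loc_integrable Om g ->
  (forall phi, test_function Om phi -> \int[leb d]_(x in Om) (g x * phi x) = 0) ->
  {ae leb d, forall x, Om x -> g x = 0}.
Proof.
move=> oOm lg g0; have mOm := open_measurable_rV oOm.
pose ab (k : nat) : set E :=
  if choice.unpickle k is Some q then
    obox (fun i => ratr ((q : 'rV[rat]_d * 'rV[rat]_d)%type.1 ord0 i)) (fun i => ratr (q.2 ord0 i))
  else set0.
pose cl (k : nat) : set E :=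
  if choice.unpickle k is Some q then
    cbox (fun i => ratr ((q : 'rV[rat]_d * 'rV[rat]_d)%type.1 ord0 i)) (fun i => ratr (q.2 ord0 i))
  else set0.
have : {ae leb d, forall x, forall k, cl k `<=` Om -> ab k x -> g x = 0}.
  apply: ae_foralln => k; have [clO|clO] := pselect (cl k `<=` Om); last exact: aeW.
  have : {ae leb d, forall x, ab k x -> g x = 0}.
    rewrite /ab; move: clO; rewrite /cl; case: choice.unpickle => [q|_]; last exact: aeW.
    exact: ae0_obox.
  by apply: filterS => x + _.
apply: filterS => x H Ox.
have /nbhs_ballP[e /= e0 eOm] := open_nbhs_nbhs (conj oOm Ox).
have L i : exists q : rat, x ord0 i - e / 2 < ratr q < x ord0 i.
  have /rat_in_itvoo[q] : x ord0 i - e / 2 < x ord0 i by rewrite ltrBlDr ltrDl divr_gt0.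
  by rewrite in_itv/=; exists q.
have U i : exists q : rat, x ord0 i < ratr q < x ord0 i + e / 2.
  have /rat_in_itvoo[q] : x ord0 i < x ord0 i + e / 2 by rewrite ltrDl divr_gt0.
  by rewrite in_itv/=; exists q.
pose q : ('rV[rat]_d * 'rV[rat]_d)%type := (\row_i xchoose (L i), \row_i xchoose (U i)).
have qL i : x ord0 i - e / 2 < ratr (q.1 ord0 i) < x ord0 i.
  by rewrite mxE; exact: (xchooseP (L i)).
have qU i : x ord0 i < ratr (q.2 ord0 i) < x ord0 i + e / 2.
  by rewrite mxE; exact: (xchooseP (U i)).
apply: (H (choice.pickle q)); rewrite /cl /ab choice.pickleK.
  move=> y yq; apply: eOm; apply/rV_ballP => // i.
  have /andP[? ?] := yq i; have /andP[? ?] := qL i; have /andP[? ?] := qU i.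
  by rewrite ltr_norml; apply/andP; split; lra.
by move=> i; have /andP[_ ->] := qL i; have /andP[-> _] := qU i.
Qed.

End fundamental.

(** * Uniqueness and calculus of weak gradients *)

Section weak_gradient.
Context {R : realType} {d : nat}.
Local Notation E := 'rV[R]_d.
Implicit Types (x y : E) (Om : set E) (f g phi psi : E -> R) (G : E -> E).

Lemma compact_measurable_rV (B : set E) : compact B -> measurable B.
Proof.
by move=> cB; apply: closed_measurable_rV; exact: compact_closed.
Qed.

Lemma loc_integrableD Om f g : loc_integrable Om f -> loc_integrable Om g ->
  loc_integrable Om (f \+ g).
Proof.
move=> [mf lf] [mg lg]; split; first exact: measurable_funD.
move=> B cB BO; have := integrableD _ (lf _ cB BO) (lg _ cB BO).
by apply; exact: compact_measurable_rV.
Qed.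

Lemma loc_integrableZ Om (c : R) f : loc_integrable Om f ->
  loc_integrable Om (fun x => c * f x).
Proof.
move=> [mf lf]; split; first exact: measurable_funM.
move=> B cB BO; have := integrableZl _ c (lf _ cB BO).
by apply; exact: compact_measurable_rV.
Qed.

Lemma bdf_loc_integrable Om f : measurable Om -> bdf Om f -> loc_integrable Om f.
Proof.
move=> mOm [mf [M M0 fM]]; split => // B cB BO.
have mB : measurable B by exact: compact_measurable_rV.
apply: bdf_integrable => //; first by apply: leb_bounded_fin => //; exact: compact_bounded.
split; first exact: measurable_funS mOm BO mf.
by exists M => //; apply: filterS fM => x H /BO.
Qed.

(** [phi] is bounded and [g] is integrable on the compact support of [phi]; off the support the
    product is zero. *)
Lemma loc_test_integrable Om g phi : open Om -> loc_integrable Om g ->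
  test_function Om phi -> (leb d).-integrable Om (EFin \o (g \* phi)%R).
Proof.
move=> oOm [mg lg] tphi; have [sphi cK KO] := tphi.
have mOm := open_measurable_rV oOm.
pose K := closure [set x | phi x != 0].
have mK : measurable K by apply: closed_measurable_rV; exact: closed_closure.
have [M M0 phiM] := test_bounded tphi.
have mphi D : measurable_fun D phi.
  by apply: measurable_funTS; apply: continuous_measurable_rV; exact: smooth_continuous.
have iK : (leb d).-integrable K (EFin \o (g \* phi)%R).
  apply: (@le_integrable _ _ _ _ _ _ _ (fun x => M%:E * (g x)%:E)%E) => //.
  - by apply/measurable_EFinP; apply: measurable_funM => //; exact: measurable_funS mOm KO mg.
  - by move=> x Kx; rewrite -EFinM /= lee_fin !normrM (ger0_norm M0) mulrC ler_wpM2r.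
  - by apply: integrableZl => //; exact: lg.
apply/(integrable_mkcond _ mOm); move/(integrable_mkcond _ mK) : iK.
apply: eq_integrable => // x _.
rewrite !patchE; case: ifPn => [|/negP]; rewrite inE => xK.
  by rewrite mem_set//; exact: KO.
by case: ifPn => // _ /=; rewrite (test_out tphi)// mulr0.
Qed.

(** Each coordinate of the difference integrates to zero against every test function, so [weak_zero]
    applies. *)
Lemma weak_grad_unique Om f G1 G2 : open Om ->
  weak_grad Om f G1 -> weak_grad Om f G2 ->
  {ae leb d, forall x, Om x -> G1 x = G2 x}.
Proof.
move=> oOm [lf l1 H1] [_ l2 H2].
have mOm := open_measurable_rV oOm.
have Hi i : {ae leb d, forall x, Om x -> G1 x ord0 i = G2 x ord0 i}.
  have : {ae leb d, forall x, Om x -> G1 x ord0 i + (-1) * G2 x ord0 i = 0}.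
    apply: weak_zero => //.
      apply: (loc_integrableD (l1 i)); exact: (loc_integrableZ (-1) (l2 i)).
    move=> phi tphi; under eq_Rintegral do rewrite mulrDl mulN1r mulNr.
    rewrite RintegralB//.
    - by apply/eqP; rewrite subr_eq0 -eqr_opp -H1// -H2.
    - exact: loc_test_integrable (l1 i) tphi.
    - exact: loc_test_integrable (l2 i) tphi.
  by apply: filterS => x /[apply] /eqP; rewrite mulN1r subr_eq0 => /eqP.
suff : {ae leb d, forall x, forall i, Om x -> G1 x ord0 i = G2 x ord0 i}.
  by apply: filterS => x H Ox; apply/rowP => i; exact: H.
exact: (@filter_forall _ _ (fun i x => Om x -> G1 x ord0 i = G2 x ord0 i)).
Qed.

(** Exhibiting one explicit weak gradient both guarantees that the choice behind [wgrad] succeeds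
    and computes it almost everywhere. *)
Lemma wgradP Om f G : open Om -> weak_grad Om f G ->
  weak_grad Om f (wgrad Om f) /\ {ae leb d, forall x, Om x -> wgrad Om f x = G x}.
Proof.
move=> oOm fG; have H : weak_grad Om f (wgrad Om f) by apply: xgetPex; exists G.
by split => //; exact: weak_grad_unique H fG.
Qed.

Lemma weak_gradD Om f g F G : open Om -> weak_grad Om f F -> weak_grad Om g G ->
  weak_grad Om (f \+ g) (fun x => F x + G x).
Proof.
move=> oOm [lf lF HF] [lg lG HG]; have mOm := open_measurable_rV oOm; split.
- exact: loc_integrableD.
- move=> i; rewrite (_ : (fun x => _) = (fun x => F x ord0 i) \+ (fun x => G x ord0 i)).
    exact: loc_integrableD.
  by apply/funext => x; rewrite mxE.
move=> phi tphi i; under eq_Rintegral do rewrite mulrDl.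
rewrite RintegralD//; [|exact: loc_test_integrable lf (test_partial i tphi)|exact: loc_test_integrable lg (test_partial i tphi)].
rewrite HF// HG// -opprD -RintegralD//; [|exact: loc_test_integrable (lF i) tphi|exact: loc_test_integrable (lG i) tphi].
by congr (- _); apply: eq_Rintegral => x _; rewrite mxE mulrDl.
Qed.

Lemma weak_gradZ Om f F (c : R) : open Om -> weak_grad Om f F ->
  weak_grad Om (fun x => c * f x) (fun x => c *: F x).
Proof.
move=> oOm [lf lF HF]; have mOm := open_measurable_rV oOm; split.
- exact: loc_integrableZ.
- move=> i; rewrite (_ : (fun x => _) = (fun x => c * F x ord0 i)).
    exact: loc_integrableZ.
  by apply/funext => x; rewrite mxE.
move=> phi tphi i; under eq_Rintegral do rewrite -mulrA.
rewrite RintegralZl//; last exact: loc_test_integrable lf (test_partial i tphi).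
rewrite HF// mulrN -RintegralZl//; last exact: loc_test_integrable (lF i) tphi.
by congr (- _); apply: eq_Rintegral => x _; rewrite mxE mulrA.
Qed.

Lemma weak_gradB Om f g F G : open Om -> weak_grad Om f F -> weak_grad Om g G ->
  weak_grad Om (f \- g) (fun x => F x - G x).
Proof.
move=> oOm fF gG; have := weak_gradD oOm fF (weak_gradZ (-1) oOm gG).
rewrite (_ : f \+ _ = f \- g); last by apply/funext => x /=; rewrite mulN1r.
by rewrite (_ : (fun x => _) = (fun x => F x - G x))//; apply/funext => x; rewrite scaleN1r.
Qed.

Lemma wgradB Om f g : open Om ->
  weak_grad Om f (wgrad Om f) -> weak_grad Om g (wgrad Om g) ->
  {ae leb d, forall x, Om x -> wgrad Om (f \- g)%R x = wgrad Om f x - wgrad Om g x}.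
Proof. by move=> oOm fF gG; have [] := wgradP oOm (weak_gradB oOm fF gG). Qed.

(** The Lipschitz bound is asked only along coordinate segments contained in [Om], since these are
    the only ones that a test function of small shift sees; [Om] is not convex in general. *)
Lemma weak_grad_lip Om f G (M L : R) : open Om -> bounded_set Om ->
  measurable_fun Om f -> (forall x, Om x -> `|f x| <= M) ->
  (forall i, bdf Om (fun x => G x ord0 i)) ->
  (forall i x (t : R), (forall s, `|s| <= `|t| -> Om (x + s *: delta_mx ord0 i)) ->
     `|f (x + t *: delta_mx ord0 i) - f x| <= L * `|t|) ->
  {ae leb d, forall x, Om x -> forall i, is_derive x (delta_mx ord0 i : E) f (G x ord0 i)} ->
  weak_grad Om f G.
Proof.
move=> oOm bOm mf fM bG fL dfG; have mOm := open_measurable_rV oOm; split.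
- apply: bdf_loc_integrable => //; apply: (@bdf_bounded _ _ _ _ `|M|) => // x Ox.
  by rewrite (le_trans (fM _ Ox))// ler_norm.
- by move=> i; exact: bdf_loc_integrable.
move=> phi tphi i; apply: (@weak_partial _ _ Om f (fun x => G x ord0 i) i M L) => //.
- by case: (bG i).
- by move=> x t; exact: fL.
- by apply: filterS dfG => x H Ox; exact: H.
Qed.

Lemma smooth_bounded Om f : bounded_set Om -> smooth f ->
  exists2 M : R, 0 <= M & forall x, Om x -> `|f x| <= M.
Proof.
move=> [B [_ HB]] sf; pose b := `|B| + 1.
have bB : B < b by rewrite (le_lt_trans (ler_norm B))// ltrDl.
have := continuous_compact (continuous_subspaceT (smooth_continuous sf))
  (@compact_cbox R d (fun=> - b) (fun=> b)).
move=> /compact_bounded [M [_ HM]]; exists (`|M| + 1); first by rewrite addr_ge0.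
move=> x Ox; apply: (HM _ _ (f x)).
  by rewrite (le_lt_trans (ler_norm M))// ltrDl.
exists x => // i; rewrite -ler_norml.
by apply: (le_trans (rV_norm_coord x i)); exact: (HB _ bB).
Qed.

Lemma weak_grad_smooth Om f : open Om -> bounded_set Om -> smooth f ->
  weak_grad Om f (grad f).
Proof.
move=> oOm bOm sf.
have mf D : measurable_fun D f.
  by apply: measurable_funTS; apply: continuous_measurable_rV; exact: smooth_continuous.
have [M M0 fM] := smooth_bounded bOm sf.
have HL i : exists2 M : R, 0 <= M & forall x, Om x -> `|partial i f x| <= M.
  by apply: smooth_bounded => //; exact: smooth_partial.
pose L := \sum_i sval (cid2 (HL i)).
apply: (@weak_grad_lip _ _ _ M L) => //.
- move=> i; have [Mi Mi0 Hi] := HL i; apply: (@bdf_bounded _ _ _ _ Mi) => //.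
    rewrite (_ : (fun x => _) = partial i f); last by apply/funext => x; rewrite mxE.
    by apply: measurable_funTS; apply: continuous_measurable_rV; exact/smooth_continuous/smooth_partial.
  by move=> x Ox; rewrite mxE; exact: Hi.
- move=> i x t tO; apply: deriv_lip => s st; first exact: smooth_derivable.
  rewrite /L (bigD1 i)//=; case: cid2 => Mi /= Mi0 Hi.
  rewrite (le_trans (Hi _ (tO _ st)))// lerDl; apply: sumr_ge0 => j _.
  by case: cid2.
- by apply: aeW => x Ox i; rewrite mxE; exact: smooth_is_derive.
Qed.

End weak_gradient.

(** * Piecewise smooth functions on a triangulation *)

Section lip_cover.
Context {R : realType}.

Lemma closed_sup_mem (J : set R) : closed J -> has_sup J -> J (sup J).
Proof.
move=> cJ hJ; apply: cJ => B /nbhs_ballP[e /= e0 eB].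
have [y Jy ylt] := sup_adherent e0 hJ; exists y; split => //; apply: eB.
have yle : y <= sup J by apply: ub_le_sup => //; case: hJ.
rewrite /ball /= ger0_norm ?subr_ge0//; lra.
Qed.

(* The pieces being closed, no continuity of g is needed. *)
Lemma lip_cover (I : eqType) (g : R -> R) (L : R) (J : I -> set R) (r : seq I) a b :
  0 <= L -> (forall i, i \in r -> closed (J i)) ->
  (forall i s t, i \in r -> J i s -> J i t -> `|g s - g t| <= L * `|s - t|) ->
  (forall y, a < y <= b -> exists2 i, i \in r & J i y) ->
  a <= b -> `|g b - g a| <= L * (b - a).
Proof.
move=> L0; move: {2}(size r) (leqnn (size r)) => n; elim: n r a => [|n IH] r a sr cJ gL cov.
  rewrite le_eqVlt => /predU1P[->|ab]; first by rewrite !subrr normr0 mulr0.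
  have [|i] := cov b; first by rewrite ab lexx.
  by move: sr; rewrite leqn0 => /eqP/size0nil ->.
rewrite le_eqVlt => /predU1P[->|ab]; first by rewrite !subrr normr0 mulr0.
(* The cover says nothing at [a] itself. If no closed piece contained [a], none would meet a
   neighbourhood of [a], against the cover just to the right of it. *)
have [i ir Ja] : exists2 i, i \in r & J i a.
  apply: contrapT => noJ.
  have H : \forall y \near a, forall i, i \in r -> ~ J i y.
    have : forall i, i \in r -> ~ J i a by move=> i ir Ji; apply: noJ; exists i.
    move: cJ; elim: (r) => [|i r' IHr] cJ Hr; first by near=> y.
    have H1 : \forall y \near a, ~ J i y.
      have oJ : open (~` J i) by apply: closed_openC; apply: cJ; rewrite mem_head.
      by apply: (open_nbhs_nbhs (conj oJ _)); apply: Hr; rewrite mem_head.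
    have H2 : \forall y \near a, forall i, i \in r' -> ~ J i y.
      by apply: IHr => j jr; [apply: cJ|apply: Hr]; rewrite inE jr orbT.
    near=> y => j; rewrite inE => /predU1P[->|jr]; first by near: y.
    by move: j jr; near: y.
  have [e /= e0 eP] := (nbhs_ballP _ _).1 H.
  have [|j jr Jj] := cov (Num.min b (a + e / 2)).
    by rewrite lt_min ab ltrDl divr_gt0//= ge_min lexx.
  apply: (eP _ _ j jr Jj); rewrite /ball /= distrC ger0_norm.
    rewrite ltrBlDl gt_min; apply/orP; right; rewrite ltrD2l; lra.
  by rewrite subr_ge0 le_min (ltW ab) lerDl divr_ge0// ltW.
(* The last visit to the piece [i]: beyond the supremum [s] it is not met again, so the induction
   continues on []s, b]] with one piece fewer. This is why the cover is stated on a half-open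
   interval. *)
pose A := J i `&` `[a, b]%classic.
have hA : has_sup A.
  split; first by exists a; split => //=; rewrite in_itv/= lexx ltW.
  by exists b => y [_] /=; rewrite in_itv/= => /andP[].
have cA : closed A by apply: closedI; [exact: cJ|exact: itv_closed].
have [Js] := closed_sup_mem cA hA; rewrite /= in_itv/= => /andP[as_ sb].
set s := sup A in Js as_ sb.
have -> : g b - g a = (g b - g s) + (g s - g a) by ring.
have -> : L * (b - a) = L * (b - s) + L * (s - a) by ring.
rewrite (le_trans (ler_normD _ _))// lerD//; last first.
  by rewrite (le_trans (gL i s a ir Js Ja))// ger0_norm// subr_ge0.
apply: (IH (rem i r)) => //.
- by rewrite size_rem// -subn1 leq_subLR add1n.
- by move=> j /mem_rem jr; exact: cJ.
- by move=> j x y /mem_rem jr; exact: gL.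
- move=> y /andP[sy yb].
  have [|j jr Jy] := cov y; first by rewrite (le_lt_trans as_ sy).
  exists j => //; have [ji|ji] := eqVneq j i; last first.
    by move: jr; rewrite (perm_mem (perm_to_rem ir)) inE (negbTE ji).
  suff : y <= s by rewrite leNgt sy.
  apply: ub_le_sup; first by case: hA.
  split; first by rewrite -ji.
  by rewrite /= in_itv/= yb (le_trans as_ (ltW sy)).
Unshelve. all: by end_near. Qed.

End lip_cover.

(** * Barycentric coordinates and null boundaries of simplices *)

Section simplices.
Context {R : realType} {d : nat}.
Local Notation E := 'rV[R]_d.
Implicit Types (x y : E) (Om : set E) (k : {fset E}) (T : {fset {fset E}}).

Definition vert k (i : 'I_d.+1) : E := nth 0 (enum_fset k) i.

Lemma nondegenerate_sum (V : nmodType) k (F : E -> V) : Defs.nondegenerate k ->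
  \sum_(v <- k) F v = \sum_(i < d.+1) F (vert k i).
Proof.
move=> [sk _]; rewrite (big_nth 0) big_mkord.
by rewrite (_ : size (enum_fset k) = d.+1)//.
Qed.

Lemma mem_vert k i : Defs.nondegenerate k -> vert k i \in k.
Proof. by move=> [sk _]; rewrite mem_nth// [X in (_ < X)%N]sk. Qed.

Lemma vertP k v : Defs.nondegenerate k -> v \in k -> exists2 i, v = vert k i &
  forall j, vert k j = v -> j = i.
Proof.
move=> [sk _] vk; have iv : (index v (enum_fset k) < d.+1)%N by rewrite -sk index_mem.
exists (Ordinal iv); first by rewrite /vert nth_index.
move=> j jv; apply: val_inj => /=.
by rewrite -jv /vert index_uniq ?fset_uniq// [X in (_ < X)%N]sk.
Qed.

(** Each row is a vertex preceded by a 1, so that a product [u *m simplex_mx k] records the total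
    weight and the weighted sum of vertices at once; its inverse yields the barycentric coordinates
    [lam]. *)
Definition simplex_mx k : 'M[R]_d.+1 :=
  \matrix_(i, j) consr (1 : measurableTypeR R, vert k i) ord0 j.

Lemma consr_inj (a b : R) x y : consr (a : measurableTypeR R, x) = consr (b : measurableTypeR R, y) ->
  a = b /\ x = y.
Proof. by move=> H; have := congr1 (@unconsr R d) H; rewrite !consrK => -[]. Qed.

Lemma mul_simplex_mx k (u : 'rV[R]_d.+1) : u *m simplex_mx k =
  consr (\sum_i u ord0 i : measurableTypeR R, \sum_i u ord0 i *: vert k i).
Proof.
apply/rowP => j; rewrite !mxE; case: unliftP => [j' ->|->] /=.
  rewrite summxE; apply: eq_bigr => i _; rewrite !mxE liftK /=.
  by [].
by apply: eq_bigr => i _; rewrite !mxE unlift_none /= mulr1.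
Qed.

Lemma simplex_mx_unit k : Defs.nondegenerate k -> simplex_mx k \in unitmx.
Proof.
move=> nk; have [sk kfree] := nk; rewrite -row_free_unit; apply: inj_row_free => u.
rewrite mul_simplex_mx => u0.
have [s0 v0] : \sum_i u ord0 i = 0 /\ \sum_i u ord0 i *: vert k i = 0.
  apply: consr_inj; rewrite u0; apply/rowP => j; rewrite !mxE.
  by case: unliftP => [j' _|_] /=; rewrite ?mxE.
(* Nondegeneracy speaks of weights on points whereas [u] carries weights on indices; the vertices
   being distinct, each of these sums has a single term. *)
pose l (v : E) := \sum_(i | vert k i == v) u ord0 i.
have lE i : l (vert k i) = u ord0 i.
  have [j _ jP'] := vertP nk (mem_vert i nk).
  have jP i' : vert k i' = vert k i -> i' = i by move=> /jP' ->; rewrite (jP' i erefl).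
  rewrite /l (bigD1 i)//= big1 ?addr0//.
  by move=> i' /andP[/eqP /jP -> /eqP].
apply/rowP => i; rewrite mxE -lE; apply: kfree; last exact: mem_vert.
  by rewrite nondegenerate_sum//; under eq_bigr do rewrite lE.
by rewrite nondegenerate_sum//; under eq_bigr do rewrite lE.
Qed.

Definition lam k x : 'rV[R]_d.+1 :=
  consr (1 : measurableTypeR R, x) *m invmx (simplex_mx k).

Lemma lamP k x (u : 'rV[R]_d.+1) : Defs.nondegenerate k ->
  \sum_i u ord0 i = 1 -> \sum_i u ord0 i *: vert k i = x -> u = lam k x.
Proof.
move=> nk u1 ux; rewrite /lam -[u in LHS](mulmxK (simplex_mx_unit nk)).
by rewrite mul_simplex_mx u1 ux.
Qed.

Lemma lamE k x : Defs.nondegenerate k ->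
  \sum_i lam k x ord0 i = 1 /\ \sum_i lam k x ord0 i *: vert k i = x.
Proof.
move=> nk; apply: consr_inj; rewrite -mul_simplex_mx /lam mulmxKV//.
exact: simplex_mx_unit.
Qed.

Definition lam_grad k (i : 'I_d.+1) : E :=
  \row_j invmx (simplex_mx k) (lift ord0 j) i.

Lemma lam_affine k x i :
  lam k x ord0 i = dot (lam_grad k i) x + invmx (simplex_mx k) ord0 i.
Proof.
rewrite /lam mxE big_ord_recl mxE unlift_none /= mul1r addrC; congr (_ + _).
by apply: eq_bigr => j _; rewrite !mxE liftK /= mulrC.
Qed.

Lemma hullP k x : Defs.nondegenerate k -> hull k x <-> forall i, 0 <= lam k x ord0 i.
Proof.
move=> nk; split.
  move=> [l [l0 l1 lx]] i.
  suff -> : lam k x = \row_i l (vert k i) by rewrite mxE; apply: l0; exact: mem_vert.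
  apply/esym/lamP => //.
    by under eq_bigr do rewrite mxE; rewrite -(nondegenerate_sum l).
  by under eq_bigr do rewrite mxE; rewrite lx -(nondegenerate_sum (fun v => l v *: v)).
move=> lam0; have [lam1 lamx] := lamE x nk.
pose l (v : E) := \sum_(i | vert k i == v) lam k x ord0 i.
have lE i : l (vert k i) = lam k x ord0 i.
  have [j _ jP'] := vertP nk (mem_vert i nk).
  have jP i' : vert k i' = vert k i -> i' = i by move=> /jP' ->; rewrite (jP' i erefl).
  rewrite /l (bigD1 i)//= big1 ?addr0//.
  by move=> i' /andP[/eqP /jP -> /eqP].
exists l; split.
- by move=> v vk; apply: sumr_ge0.
- by rewrite nondegenerate_sum//; under eq_bigr do rewrite lE.
- by rewrite nondegenerate_sum//; under eq_bigr do rewrite lE.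
Qed.

Lemma smooth_coord (i : 'I_d) : smooth (fun x : E => x ord0 i).
Proof.
move=> k; pose S := [set G : R -> R | exists p q : R, G = (fun s => p * s + q)].
apply: (@Ck_coord R d S _ _ k id i).
- by exists 0, 0; apply/funext => s; rewrite mul0r addr0.
- move=> _ [p [q ->]]; exists (fun s => 0 * s + p); first by exists 0, p.
  move=> s; rewrite mul0r add0r.
  have H := is_deriveD (is_deriveM (is_derive_cst p s (1 : R)) (is_derive_id s (1 : R)))
    (is_derive_cst q s (1 : R)).
  by apply: (is_derive_congr H); rewrite scaler0 !addr0 [p *: 1]mulr1.
- by exists 1, 0; apply/funext => s; rewrite mul1r addr0.
Qed.

Lemma smooth_sum n (f : 'I_n -> E -> R) :
  (forall i, smooth (f i)) -> smooth (fun x => \sum_(i < n) f i x).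
Proof.
elim: n f => [|n IH] f sf.
  rewrite (_ : (fun _ => _) = cst 0); first exact: smooth_cst.
  by apply/funext => x; rewrite big_ord0.
rewrite (_ : (fun _ => _) = (f ord0 \+ (fun x => \sum_(i < n) f (lift ord0 i) x))%R).
  by apply: smoothD => //; apply: IH.
by apply/funext => x; rewrite big_ord_recl.
Qed.

Lemma smooth_affine (l : E -> R) : affine l -> smooth l.
Proof.
move=> [a [b lE]]; rewrite (_ : l = (dot a \+ cst b)%R); last by apply/funext.
apply: smoothD; last exact: smooth_cst.
apply: (@smooth_sum d (fun i x => a ord0 i * x ord0 i)) => i.
by apply: (@smoothM _ _ (cst (a ord0 i))); [exact: smooth_cst|exact: smooth_coord].
Qed.

Lemma smooth_bubble k : smooth (bubble k).
Proof.
rewrite /bubble; elim: (enum_fset k) => [|w r IH].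
  rewrite (_ : (fun _ => _) = cst 1); first exact: smooth_cst.
  by apply/funext => x; rewrite big_nil.
rewrite (_ : (fun _ => _) = (bary k w \* (fun x => \prod_(w <- r) bary k w x))%R).
  apply: smoothM => //; rewrite /bary.
  case: xgetP => [_ -> [al _ _]|_]; [exact: smooth_affine|exact: smooth_cst].
by apply/funext => x; rewrite big_cons.
Qed.

(** The pieces are smooth on the whole space and agree with [f] on closed cells, so neighbouring
    pieces coincide on common faces and continuity across faces is built in. *)
Definition pw_smooth T (f : E -> R) := forall k, k \in T ->
  exists2 P : E -> R, smooth P & forall x, hull k x -> f x = P x.

Lemma P_on_smooth T f : (forall k, k \in T -> P_on k f) -> pw_smooth T f.
Proof.
move=> Pf k /Pf [l al [c lE]]; exists (l \+ (cst c \* bubble k))%R => //.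
apply: smoothD; first exact: smooth_affine.
by apply: smoothM; [exact: smooth_cst|exact: smooth_bubble].
Qed.

Lemma P1_on_smooth T f : (forall k, k \in T -> P1_on k f) -> pw_smooth T f.
Proof. by move=> Pf k /Pf [l al lE]; exists l => //; exact: smooth_affine. Qed.

Lemma smooth_lam k i : smooth (fun x => lam k x ord0 i).
Proof.
apply: smooth_affine; exists (lam_grad k i), (invmx (simplex_mx k) ord0 i) => x.
exact: lam_affine.
Qed.

Lemma continuous_lam k i : continuous (fun x => lam k x ord0 i).
Proof. exact: smooth_continuous (smooth_lam k i). Qed.

Lemma closed_hull k : Defs.nondegenerate k -> closed (hull k).
Proof.
move=> nk; rewrite (_ : hull k = \bigcap_(i in [set: 'I_d.+1])
    ((fun x => lam k x ord0 i) @^-1` [set y | 0 <= y])).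
  apply: closed_bigI => i _.
  apply: closed_comp; last exact: closed_ge.
  by move=> x _; exact: continuous_lam.
apply/seteqP; split => x.
  by move=> /(hullP _ nk) H i _; exact: H.
by move=> H; apply/hullP => // i; exact: H.
Qed.

Lemma elt_lam k x : Defs.nondegenerate k -> (forall i, 0 < lam k x ord0 i) -> elt k x.
Proof.
move=> nk lx; rewrite /elt /interior /=.
have : \forall y \near x, forall i, 0 < lam k y ord0 i.
  apply: (@filter_forall _ _ (fun (i : 'I_d.+1) (y : E) => 0 < lam k y ord0 i) (nbhs x)) => i.
  exact: (continuous_lam (lt_nbhsr (lx i))).
by apply: filterS => y H; apply/hullP => // i; exact: ltW.
Qed.

Lemma lam_vert k i j : Defs.nondegenerate k -> lam k (vert k i) ord0 j = (i == j)%:R.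
Proof.
move=> nk; rewrite -(@lamP _ _ (delta_mx ord0 i))//; first by rewrite mxE eq_sym.
  rewrite (bigD1 i)//= mxE !eqxx big1 ?addr0// => i' /negbTE.
  by rewrite mxE => ->; rewrite andbF.
rewrite (bigD1 i)//= mxE !eqxx scale1r big1 ?addr0// => i' /negbTE.
by rewrite mxE => ->; rewrite andbF scale0r.
Qed.

(** A point of the simplex outside its interior has a vanishing barycentric coordinate, hence lies
    in one of [d.+1] hyperplanes. *)
Lemma ae_hull_elt k : (0 < d)%N -> Defs.nondegenerate k ->
  {ae leb d, forall x, hull k x -> elt k x}.
Proof.
move=> d0 nk.
have H : {ae leb d, forall x, forall i, lam k x ord0 i != 0}.
  apply: filter_forall => i.
  exists [set x | lam k x ord0 i = 0]; split.
  - apply: closed_measurable_rV.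
    apply: (@preimage_closed _ _ (fun x => lam k x ord0 i) [set 0]).
      by move=> x _; exact: continuous_lam.
    exact: closed_eq.
  - rewrite (_ : mkset _ = [set x | dot (lam_grad k i) x = - invmx (simplex_mx k) ord0 i]).
      apply: leb_hyperplane; apply/eqP => g0.
      (* A zero gradient would make the barycentric coordinate constant, although it is 1 at its own
         vertex and 0 at another one; [0 < d] provides the other vertex. *)
      have [j ji] : exists j : 'I_d.+1, j != i.
        have [->|i0] := eqVneq i ord0; last by exists ord0; rewrite eq_sym.
        by exists (lift ord0 (Ordinal d0)); rewrite eq_sym neq_lift.
      have := lam_vert i i nk; rewrite eqxx lam_affine g0 => e1.
      have := lam_vert j i nk; rewrite (negbTE ji) lam_affine g0 => e2.
      have dot0 y : dot (0 : E) y = 0 by rewrite /dot big1// => q _; rewrite mxE mul0r.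
      by move: e1 e2; rewrite !dot0 => -> /eqP; rewrite oner_eq0.
    apply/seteqP; split => x /=; rewrite lam_affine.
      by move=> /eqP; rewrite addr_eq0 => /eqP.
    by move=> ->; rewrite addNr.
  - by move=> x /= /negP; rewrite negbK => /eqP.
apply: filterS H => x H /(hullP _ nk) lx; apply: elt_lam => // i.
by rewrite lt_neqAle lx eq_sym H.
Qed.

End simplices.

(** * Elementwise gradients as weak gradients *)

Section pw_smooth.
Context {R : realType} {d : nat}.
Local Notation E := 'rV[R]_d.
Variables (Om : set E) (T : {fset {fset E}}).
Hypotheses (d0 : (0 < d)%N) (oOm : open Om) (bOm : bounded_set Om).
Hypothesis triT : triangulation Om T.
Implicit Types (x y : E) (f : E -> R).

Definition elts : set E := [set x | exists2 k, k \in T & elt k x].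

Lemma Om_hull x : Om x -> exists2 k, k \in T & hull k x.
Proof. by case: triT => _ cE _ Ox; have := subset_closure Ox; rewrite cE. Qed.

Lemma ae_elts : {ae leb d, forall x, Om x -> elts x}.
Proof.
case: triT => nT _ _.
have : {ae leb d, forall x, forall k : T, hull (val k) x -> elt (val k) x}.
  by apply: filter_forall => k; apply: ae_hull_elt => //; apply: nT; exact: valP.
apply: filterS => x H /Om_hull[k kT hk]; exists k => //.
exact: (H [` kT]%fset).
Qed.

Lemma open_elts : open elts.
Proof.
rewrite (_ : elts = \bigcup_(k in [set` T]) elt k).
  by apply: bigcup_open => k _; exact: open_interior.
by apply/seteqP; split => x [k kT ex]; exists k.
Qed.

Lemma pw_smooth_bounded f : pw_smooth T f ->
  exists2 M : R, 0 <= M & forall x, Om x -> `|f x| <= M.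
Proof.
move=> pf.
have H (k : T) : exists2 M : R, 0 <= M & forall x, Om x -> hull (val k) x -> `|f x| <= M.
  have [P sP fP] := pf _ (valP k); have [M M0 PM] := smooth_bounded bOm sP.
  by exists M => // x Ox /fP ->; exact: PM.
exists (\sum_k sval (cid2 (H k))).
  by apply: sumr_ge0 => k _; case: cid2.
move=> x Ox; have [k kT hk] := Om_hull Ox.
rewrite (bigD1 [` kT]%fset)//=; case: cid2 => M /= M0 HM.
rewrite (le_trans (HM x Ox hk))// lerDl; apply: sumr_ge0 => j _.
by case: cid2.
Qed.

Lemma measurable_pieces (A : {fset E} -> set E) (f : E -> R) :
  (forall k, k \in T -> measurable (A k)) ->
  (forall k, k \in T -> measurable_fun (A k) f) ->
  measurable_fun [set x | exists2 k, k \in T & A k x] f.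
Proof.
move=> mA mf; pose B n := if (n < size (enum_fset T))%N then A (nth fset0 (enum_fset T) n) else set0.
rewrite (_ : mkset _ = \bigcup_n B n).
  apply/measurable_fun_bigcup => n; rewrite /B; case: ifPn => // nT.
  - by apply: mA; exact: mem_nth.
  - by apply: mf; exact: mem_nth.
  - exact: measurable_fun_set0.
apply/seteqP; split => x.
  move=> [k kT Ak]; exists (index k (enum_fset T)) => //.
  by rewrite /B index_mem kT nth_index.
move=> [n _]; rewrite /B; case: ifPn => // nT An.
by exists (nth fset0 (enum_fset T) n) => //; exact: mem_nth.
Qed.

Lemma measurable_hull k : k \in T -> measurable (hull k).
Proof. by case: triT => nT _ _ /nT nk; apply: closed_measurable_rV; exact: closed_hull. Qed.

Lemma pw_smooth_measurable f : pw_smooth T f -> measurable_fun Om f.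
Proof.
move=> pf; have mOm := open_measurable_rV oOm.
apply: (@measurable_funS _ _ _ _ [set x | exists2 k, k \in T & hull k x]).
- case: triT => _ <- _; apply: closed_measurable_rV; exact: closed_closure.
- by move=> x; exact: Om_hull.
apply: measurable_pieces => k kT; first exact: measurable_hull.
have [P sP fP] := pf _ kT.
apply: (@eq_measurable_fun _ _ _ _ _ P); first by move=> x; rewrite inE => /fP.
by apply: measurable_funTS; apply: continuous_measurable_rV; exact: smooth_continuous.
Qed.

Lemma pw_smooth_bdf f : pw_smooth T f -> bdf Om f.
Proof.
move=> pf; have [M M0 fM] := pw_smooth_bounded pf.
by apply: (bdf_bounded _ M0) => //; exact: pw_smooth_measurable.
Qed.

Lemma pw_smooth_derive k f P x i : (forall y, hull k y -> f y = P y) -> smooth P ->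
  elt k x -> is_derive x (delta_mx ord0 i : E) f (partial i P x).
Proof.
move=> fP sP ex; apply: (near_eq_is_derive _ (smooth_is_derive i x sP)).
have : \forall y \near x, elt k y by apply: open_nbhs_nbhs; split => //; exact: open_interior.
by apply: filterS => y /interior_subset /fP.
Qed.

Lemma pw_smooth_partial k f P x i : (forall y, hull k y -> f y = P y) -> smooth P ->
  elt k x -> partial i f x = partial i P x.
Proof. by move=> fP sP ex; have [_] := pw_smooth_derive i fP sP ex. Qed.

(** Classical partial derivatives inside the open elements and zero elsewhere: on faces [partial]
    may be arbitrary, and cutting it off there secures measurability and bounds at the price of a
    null subset of [Om]. *)
Definition pw_grad f : E -> E := fun x => \row_i ((partial i f) \_ elts) x.

Lemma pw_grad_bdf f i : pw_smooth T f -> bdf Om (fun x => pw_grad f x ord0 i).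
Proof.
move=> pf; have mOm := open_measurable_rV oOm.
rewrite (_ : (fun x => _) = (partial i f) \_ elts); last by apply/funext => x; rewrite mxE.
have H (k : T) : exists2 M : R, 0 <= M & forall x, Om x -> elt (val k) x -> `|partial i f x| <= M.
  have [P sP fP] := pf _ (valP k).
  have [M M0 PM] := smooth_bounded bOm (smooth_partial i sP).
  by exists M => // x Ox ex; rewrite (pw_smooth_partial _ fP sP ex); exact: PM.
apply: (@bdf_bounded _ _ _ _ (\sum_k sval (cid2 (H k)))).
- apply: measurable_funTS; apply/(measurable_restrictT _ (open_measurable_rV open_elts)).
  apply: measurable_pieces => k kT; first by apply: open_measurable_rV; exact: open_interior.
  have [P sP fP] := pf _ kT.
  apply: (@eq_measurable_fun _ _ _ _ _ (partial i P)).
    by move=> x; rewrite inE => ex; rewrite (pw_smooth_partial _ fP sP ex).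
  by apply: measurable_funTS; apply: continuous_measurable_rV; exact/smooth_continuous/smooth_partial.
- by apply: sumr_ge0 => k _; case: cid2.
move=> x Ox; rewrite patchE; case: ifPn => [|_]; last first.
  by rewrite normr0; apply: sumr_ge0 => k _; case: cid2.
rewrite inE => -[k kT ek].
rewrite (bigD1 [` kT]%fset)//=; case: cid2 => M /= M0 HM.
rewrite (le_trans (HM x Ox ek))// lerDl; apply: sumr_ge0 => j _.
by case: cid2.
Qed.

(** A segment in [Om] is covered by finitely many closed cells, on each of which [f] is the
    restriction of a smooth function; [lip_cover] glues the bounds however the segment meets the
    faces. *)
Lemma pw_smooth_lip f i : pw_smooth T f -> exists2 L : R, 0 <= L &
  forall x (t : R), (forall s, `|s| <= `|t| -> Om (x + s *: delta_mx ord0 i)) ->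
     `|f (x + t *: delta_mx ord0 i) - f x| <= L * `|t|.
Proof.
move=> pf; set v : E := delta_mx ord0 i.
have [B [_ HB]] := bOm; pose b := `|B| + 1.
have bB : B < b by rewrite (le_lt_trans (ler_norm B))// ltrDl.
pose Q : set E := cbox (fun=> - b) (fun=> b).
have bQ : bounded_set Q by apply: compact_bounded; exact: compact_cbox.
have OQ x : Om x -> Q x.
  by move=> Ox j; rewrite -ler_norml (le_trans (rV_norm_coord x j))// (HB _ bB).
have H (k : T) : exists2 M : R, 0 <= M & exists2 P : E -> R, smooth P &
    (forall x, hull (val k) x -> f x = P x) /\ (forall x, Q x -> `|partial i P x| <= M).
  have [P sP fP] := pf _ (valP k).
  have [M M0 PM] := smooth_bounded bQ (smooth_partial i sP).
  by exists M => //; exists P.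
pose L := \sum_k sval (cid2 (H k)).
have LM k : sval (cid2 (H k)) <= L.
  by rewrite /L (bigD1 k)//= lerDl; apply: sumr_ge0 => j _; case: cid2.
have L0 : 0 <= L by apply: sumr_ge0 => k _; case: cid2.
exists L => // x t xt.
(* Parameters for which the segment is in the cell [k]. Between two of them the mean value theorem
   is applied to the smooth extension [P], whose derivative is bounded on the cube [Q], which
   contains the whole segment. *)
pose J (k : {fset E}) : set R := `[0, 1]%classic `&` (fun s => x + (s * t) *: v) @^-1` (hull k).
have cline : continuous (fun s : R => x + (s * t) *: v).
  move=> s; apply: cvgD; first exact: cvg_cst.
  apply: cvgZr_tmp; apply: cvgMl; exact: cvg_id.
have Os s : 0 <= s <= 1 -> Om (x + (s * t) *: v).
  by move=> /andP[s0 s1]; apply: xt; rewrite normrM ger0_norm// ler_piMl.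
have -> : x + t *: v = x + (1 * t) *: v by rewrite mul1r.
have {2}-> : x = x + (0 * t) *: v by rewrite mul0r scale0r addr0.
have -> : L * `|t| = (L * `|t|) * (1 - 0) by rewrite subr0 mulr1.
apply: (@lip_cover R _ (fun s => f (x + (s * t) *: v)) (L * `|t|) J (enum_fset T)) => //.
- by rewrite mulr_ge0.
- move=> k kT; apply: closedI; first exact: itv_closed.
  apply: preimage_closed; first by move=> s _; exact: cline.
  by case: triT => nT _ _; apply: closed_hull; exact: nT.
- move=> k s s' kT [/=]; rewrite in_itv/= => sc hs [/=]; rewrite in_itv/= => sc' hs'.
  have := LM [` kT]%fset; case: cid2 => M /= M0 [P sP [fP PM]] ML.
  rewrite !fP//.
  apply: (@le_trans _ _ (M * `|(s - s') * t|)); last first.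
    by rewrite normrM [X in M * X]mulrC mulrA ler_wpM2r// ler_wpM2r.
  have -> : x + (s * t) *: v = (x + (s' * t) *: v) + ((s - s') * t) *: v.
    by rewrite -addrA -scalerDl; congr (_ + _ *: _); ring.
  apply: deriv_lip2 => q q01; first exact: smooth_derivable.
  rewrite -addrA -scalerDl.
  have -> : s' * t + q * ((s - s') * t) = (s' + q * (s - s')) * t by ring.
  apply: PM; apply: OQ; apply: Os.
  move: q01 sc sc' => /andP[q0 q1] /andP[s0 s1] /andP[s'0 s'1].
  by apply/andP; split; nra.
- by move=> y /andP[y0 y1]; have [|k kT hk] := Om_hull (Os y _);
    [rewrite ltW|exists k => //; split => //=; rewrite in_itv/= ltW].
Qed.

(** The faces inside [Om] contribute nothing: the Lipschitz bound holds across them and classical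
    derivatives exist almost everywhere. *)
Lemma pw_weak_grad f : pw_smooth T f -> weak_grad Om f (pw_grad f).
Proof.
move=> pf; have [M M0 fM] := pw_smooth_bounded pf.
pose L := \sum_i sval (cid2 (pw_smooth_lip i pf)).
apply: (@weak_grad_lip _ _ _ _ _ M L) => //.
- exact: pw_smooth_measurable.
- by move=> i; exact: pw_grad_bdf.
- move=> i x t xt; rewrite /L (bigD1 i)//=; case: cid2 => Li /= Li0 HL.
  rewrite (le_trans (HL _ _ xt))// ler_wpM2r// lerDl; apply: sumr_ge0 => j _.
  by case: cid2.
- apply: filterS ae_elts => x H Ox i; have [k kT ek] := H Ox.
  rewrite mxE patchE mem_set; last by exists k.
  have [P sP fP] := pf _ kT.
  by rewrite (pw_smooth_partial _ fP sP ek); exact: (pw_smooth_derive i fP sP ek).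
Qed.

Lemma pw_wgrad f : pw_smooth T f ->
  [/\ weak_grad Om f (wgrad Om f),
      {ae leb d, forall x, Om x -> elts x /\ wgrad Om f x = grad f x} &
      forall i, bdf Om (fun x => wgrad Om f x ord0 i)].
Proof.
move=> pf; have [wg wE] := wgradP oOm (pw_weak_grad pf).
split => //.
  apply: filterS2 ae_elts wE => x He HE Ox; split; first exact: He.
  rewrite HE//; apply/rowP => i; rewrite !mxE patchE mem_set//; exact: He.
move=> i; split; first by case: wg => _ /(_ i) [].
have [_ [M M0 HM]] := pw_grad_bdf i pf; exists M => //.
by apply: filterS2 wE HM => x HE HM Ox; rewrite HE//; exact: HM.
Qed.

End pw_smooth.

(** * Lebesgue norms *)

Section Lp_theory.
Context {R : realType} {d : nat}.
Local Notation E := 'rV[R]_d.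
Implicit Types (A B : set E) (f g h : E -> R) (p q r : R).

(** The integral of a nonnegative function is a supremum over simple functions below it, hence
    monotone without measurability. Norms over an element can thus be compared with norms over a
    part of it for arbitrary functions. *)
Lemma le_integral_nonmeasurable (f g : E -> \bar R) : (forall x, 0 <= f x <= g x)%E ->
  (\int[leb d]_x f x <= \int[leb d]_x g x)%E.
Proof.
move=> fg; rewrite !ge0_integralTE//; last 2 first.
- by move=> x; have /andP[f0 /(le_trans f0)] := fg x.
- by move=> x; have /andP[] := fg x.
apply: le_ereal_sup => _ [s sf <-]; exists s => // x.
by rewrite (le_trans (sf x))//; have /andP[] := fg x.
Qed.

Lemma indic_mulE A f : (fun x => \1_A x * f x) = f \_ A.
Proof.
by apply/funext => x; rewrite patchE indicE; case: ifP => _; rewrite ?mul1r ?mul0r.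
Qed.

Lemma measurable_indic_mul A f : measurable A -> measurable_fun A f ->
  measurable_fun [set: E] (fun x => \1_A x * f x).
Proof. by move=> mA mf; rewrite indic_mulE; apply/(measurable_restrictT _ mA). Qed.

Lemma Lp_ge0 (p : \bar R) A f : (0 <= Lp p A f)%E.
Proof. exact: Lnorm_ge0. Qed.

Lemma LpE p A f : 0 < p ->
  Lp p%:E A f = ((\int[leb d]_(x in A) (`|f x| `^ p)%:E) `^ p^-1)%E.
Proof.
move=> p0; rewrite /Lp unlock /Lnorm; apply: (congr1 (fun z => z `^ p^-1)%E).
have pn0 : p != 0 by rewrite gt_eqF.
rewrite [RHS]integral_mkcond; apply: eq_integral => x _.
rewrite patchE indicE /=; case: ifPn => _; first by rewrite mul1r.
by rewrite mul0r normr0 powR0.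
Qed.

Lemma le_poweR (r : R) (x y : \bar R) : 0 <= r -> (0 <= x)%E -> (x <= y)%E ->
  (x `^ r <= y `^ r)%E.
Proof.
move=> r0 x0 xy; apply: gt0_ler_poweR => //; rewrite in_itv/= ?x0 ?leey//.
by rewrite andbT (le_trans x0 xy).
Qed.

Lemma Lp_subset p A B f : 0 < p -> A `<=` B -> (Lp p%:E A f <= Lp p%:E B f)%E.
Proof.
move=> p0 AB; rewrite !LpE//; apply: le_poweR; first by rewrite invr_ge0 ltW.
  by apply: integral_ge0 => x _; rewrite lee_fin powR_ge0.
rewrite integral_mkcond [leRHS]integral_mkcond.
apply: le_integral_nonmeasurable => x; rewrite !patchE.
case: ifPn => [|_]; first by rewrite inE => /AB Bx; rewrite mem_set// lee_fin powR_ge0 lexx.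
by rewrite lexx/=; case: ifPn => // _; rewrite lee_fin powR_ge0.
Qed.

Lemma measurable_normpow p A f : measurable_fun A f ->
  measurable_fun A (fun x => (`|f x| `^ p)%:E).
Proof.
move=> mf; apply/measurable_EFinP.
apply: (measurableT_comp (measurable_powR p)); exact: measurableT_comp.
Qed.

Lemma Lp_le p A f g : 0 < p -> measurable A -> measurable_fun A f -> measurable_fun A g ->
  {ae leb d, forall x, A x -> `|f x| <= `|g x|} -> (Lp p%:E A f <= Lp p%:E A g)%E.
Proof.
move=> p0 mA mf mg fg; rewrite !LpE//; apply: le_poweR; first by rewrite invr_ge0 ltW.
  by apply: integral_ge0 => x _; rewrite lee_fin powR_ge0.
apply: ae_ge0_le_integral => //.
- exact: measurable_normpow.
- exact: measurable_normpow.
- by apply: filterS fg => x /[apply] fg; rewrite lee_fin ge0_ler_powR ?nnegrE// ltW.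
Qed.

Lemma Lp_triangle (p : \bar R) A f g : (1 <= p)%E -> measurable A ->
  measurable_fun A f -> measurable_fun A g ->
  (Lp p A (f \+ g)%R <= Lp p A f + Lp p A g)%E.
Proof.
move=> p1 mA mf mg.
have := eminkowski (leb d) (measurable_indic_mul mA mf) (measurable_indic_mul mA mg) p1.
apply: le_trans; rewrite /Lp le_eqVlt; apply/orP; left; apply/eqP.
by apply: eq_Lnorm => x /=; rewrite mulrDr.
Qed.

Lemma LpZ p A f (c : R) : 0 < p -> measurable A -> measurable_fun A f ->
  Lp p%:E A (fun x => c * f x) = (`|c|%:E * Lp p%:E A f)%E.
Proof.
move=> p0 mA mf; rewrite !LpE//.
under eq_integral do rewrite normrM powRM// EFinM.
rewrite ge0_integralZl_EFin ?powR_ge0//; last exact: measurable_normpow.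
rewrite poweRM ?lee_fin ?powR_ge0//; last first.
  by apply: integral_ge0 => x _; rewrite lee_fin powR_ge0.
congr (_ * _)%E; rewrite poweR_EFin -powRrM divff ?powRr1// gt_eqF//.
Qed.

Lemma Lp_setU p A B f : 1 <= p -> measurable A -> measurable B ->
  measurable_fun A f -> measurable_fun B f ->
  (Lp p%:E (A `|` B) f <= Lp p%:E A f + Lp p%:E B f)%E.
Proof.
move=> p1 mA mB mfA mfB.
have p0 : 0 < p by exact: lt_le_trans ltr01 p1.
have mAB : measurable (A `|` B) by exact: measurableU.
have LpT D : Lp p%:E D f = Lp p%:E [set: E] (fun x => \1_D x * f x).
  by rewrite /Lp; apply: eq_Lnorm => x /=; rewrite indicT mul1r.
have LpTn D : Lp p%:E D f = Lp p%:E [set: E] (fun x => `|\1_D x * f x|).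
  rewrite LpT !(LpE _ _ p0); apply: (congr1 (fun z => z `^ p^-1)%E); apply: eq_integral => x _.
  by rewrite normr_id.
have mn D : measurable D -> measurable_fun D f ->
    measurable_fun [set: E] (fun x => `|\1_D x * f x|).
  by move=> mD mfD; apply: measurableT_comp => //; exact: measurable_indic_mul.
rewrite LpT [in leRHS](LpTn A) [in leRHS](LpTn B).
apply: le_trans (Lp_triangle _ measurableT (mn _ mA mfA) (mn _ mB mfB)); last first.
  by rewrite lee_fin.
apply: Lp_le => //.
- by apply: measurable_indic_mul => //; exact/measurable_funU.
- by apply: measurable_funD; exact: mn.
- apply: aeW => x _ /=; rewrite [leRHS]ger0_norm ?addr_ge0// !indicE in_setU.
  by case: (x \in A); case: (x \in B); rewrite /= ?mul1r ?mul0r ?normr0 ?addr0 ?add0r ?lerDl.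
Qed.

Lemma Lp_set0 p f : 0 < p -> Lp p%:E set0 f = 0%E.
Proof. by move=> p0; rewrite LpE// integral_set0 poweR0r// invr_neq0// gt_eqF. Qed.

(** The triangle inequality gives the plain sum of the local norms, the form in which the indicators
    are added up. *)
Lemma Lp_cover p A (I : Type) (s : seq I) (B : I -> set E) f : 1 <= p ->
  measurable A -> measurable_fun A f -> (forall i, measurable (B i)) ->
  {ae leb d, forall x, A x -> (\big[setU/set0]_(i <- s) B i) x} ->
  (Lp p%:E A f <= \sum_(i <- s) Lp p%:E (A `&` B i) f)%E.
Proof.
move=> p1 mA mf mB cov; have p0 : 0 < p by exact: lt_le_trans ltr01 p1.
have mAB C : measurable C -> measurable_fun (A `&` C) f.
  by move=> mC; exact: measurable_funS mA (@subIsetl _ _ _) mf.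
pose U := \big[setU/set0]_(i <- s) B i.
have mU (s' : seq I) : measurable (\big[setU/set0]_(i <- s') B i).
  by apply: bigsetU_measurable.
apply: (@le_trans _ _ (Lp p%:E (A `&` U) f)).
  rewrite !LpE//; apply: le_poweR; first by rewrite invr_ge0 ltW.
    by apply: integral_ge0 => x _; rewrite lee_fin powR_ge0.
  rewrite integral_mkcondr; apply: ae_ge0_le_integral => //.
  - exact: measurable_normpow.
  - by move=> x _; rewrite erestrict_ge0// => y _; rewrite lee_fin powR_ge0.
  - apply/(measurable_restrict _ (mU s) mA).
    by apply: measurable_normpow; exact: mAB.
  - by apply: filterS cov => x /[apply] Ux; rewrite patchE mem_set.
rewrite /U; elim: (s) => [|i s' IH]; first by rewrite !big_nil setI0 Lp_set0.
rewrite !big_cons setIUr; apply: le_trans (Lp_setU p1 _ _ _ _) _.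
- exact: measurableI.
- by apply: measurableI.
- exact: mAB.
- exact: mAB.
- by rewrite leeD2l.
Qed.

(** Hoelder's inequality for the p-th powers of |f| and |g|, with the conjugate exponents q / p and
    r / p. *)
Lemma Lp_mul p q r A f g : 0 < p -> 0 < q -> 0 < r -> p^-1 = q^-1 + r^-1 ->
  measurable A -> measurable_fun A f -> measurable_fun A g ->
  (Lp p%:E A (f \* g)%R <= Lp q%:E A f * Lp r%:E A g)%E.
Proof.
move=> p0 q0 r0 pqr mA mf mg.
pose F x := `|\1_A x * f x| `^ p; pose G x := `|\1_A x * g x| `^ p.
have mpow f' : measurable_fun A f' ->
    measurable_fun [set: E] (fun x => `|\1_A x * f' x| `^ p).
  move=> mf'; apply: (measurableT_comp (measurable_powR p)).
  by apply: measurableT_comp => //; exact: measurable_indic_mul.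
have h : (p / q)^-1^-1 + (p / r)^-1^-1 = 1 :> R.
  by rewrite !invrK -mulrDr -pqr divff// gt_eqF.
have H := @hoelder _ _ _ (leb d) F G _ _ (mpow _ mf) (mpow _ mg) _ _ h.
have {H} := H _ _; rewrite !invr_gt0 !divr_gt0// => /(_ isT isT) H.
have pn0 : p != 0 by rewrite gt_eqF.
have FL (s : R) (f' : E -> R) : 0 < s -> measurable_fun A f' ->
    (('N[leb d]_((p / s)^-1)%:E[EFin \o (fun x => (`|\1_A x * f' x| `^ p)%R)]) `^ p^-1)%E = Lp s%:E A f'.
  move=> s0 mf'; rewrite /Lp !unlock /Lnorm -poweRrM (_ : (p / s)^-1^-1 * p^-1 = s^-1); last first.
    by rewrite invrK; field; rewrite pn0 gt_eqF.
  apply: (congr1 (fun z => z `^ s^-1)%E).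
  apply: eq_integral => x _; rewrite /= -poweR_EFin; congr EFin.
  rewrite ger0_norm ?powR_ge0// -powRrM; congr (_ `^ _).
  by rewrite invf_div mulrC divfK.
rewrite LpE// -(FL q f)// -(FL r g)// -poweRM ?Lnorm_ge0//.
apply: le_poweR; first by rewrite invr_ge0 ltW.
  by apply: integral_ge0 => x _; rewrite lee_fin powR_ge0.
apply: le_trans H; rewrite Lnorm1 [leLHS]integral_mkcond.
apply: le_integral_nonmeasurable => x; rewrite patchE /= /F /G -powRM// !indicE.
case: ifPn => xA; last by rewrite lexx/= lee_fin normr_ge0.
by rewrite !mul1r (ger0_norm (powR_ge0 _ _)) normrM lee_fin powR_ge0 lexx.
Qed.

Lemma Lp_bdf p A f : 0 < p -> measurable A -> (leb d A < +oo)%E -> bdf A f ->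
  inLp p%:E A f.
Proof.
move=> p0 mA Afin [mf [M M0 fM]]; split => //.
apply: (@le_lt_trans _ _ (Lp p%:E A (cst M))).
  by apply: Lp_le => //; apply: filterS fM => x /[apply] fM; rewrite (ger0_norm M0).
rewrite LpE// poweR_lty// (eq_integral (cst (`|M| `^ p)%:E))//.
by rewrite integral_cst// lte_mul_pinfty// lee_fin powR_ge0.
Qed.

End Lp_theory.

Lemma Lp_oo_ae {R : realType} {d : nat} (A : set 'rV[R]_d) (f : 'rV[R]_d -> R) (M : R) :
  (Lp +oo A f <= M%:E)%E -> {ae leb d, forall x, A x -> `|f x| <= M}.
Proof.
rewrite /Lp unlock; case: ifPn => [_ fM|]; last first.
  (* If the whole space had measure zero, the sup norm would be 0 by convention, but then every
     statement holds almost everywhere. *)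
  rewrite -leNgt => lebT _; exists setT; split => //.
  by apply/eqP; rewrite eq_le lebT/= measure_ge0.
have := @ess_sup_ge _ _ _ (leb d) (abse \o (fun x => (\1_A x * f x)%:E)).
apply: filterS => x /= fx Ax; rewrite -lee_fin (le_trans _ fM)// (le_trans _ fx)//.
by rewrite indicE mem_set// mul1r.
Qed.

(* Locked, so that arithmetic tactics do not try to convert distinct norms. *)
HB.lock Definition nrm {R : realType} {d : nat} (Om : set 'rV[R]_d) (p : R)
  (f : 'rV[R]_d -> R) : R := fine (Lp p%:E Om f).

Section nrm.
Context {R : realType} {d : nat}.
Local Notation E := 'rV[R]_d.
Variable Om : set E.
Hypotheses (mOm : measurable Om) (fOm : (leb d Om < +oo)%E).
Implicit Types (f g h : E -> R) (p q r s : R).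

Local Notation nrm := (nrm Om).

Lemma nrmE p f : nrm p f = fine (Lp p%:E Om f).
Proof. by rewrite unlock. Qed.

Lemma nrm_ge0 p f : 0 <= nrm p f.
Proof. by rewrite nrmE fine_ge0// Lp_ge0. Qed.

Lemma LpnE p f : inLp p%:E Om f -> Lp p%:E Om f = (nrm p f)%:E.
Proof. by move=> [_ ffin]; rewrite nrmE fineK// ge0_fin_numE// Lp_ge0. Qed.

Lemma inLp_le p f (M : R) : measurable_fun Om f -> (Lp p%:E Om f <= M%:E)%E ->
  inLp p%:E Om f /\ nrm p f <= M.
Proof.
move=> mf fM; have If : inLp p%:E Om f by split => //; rewrite (le_lt_trans fM)// ltry.
by split => //; rewrite -lee_fin -LpnE.
Qed.

Lemma nrm_le p f g : 0 < p -> measurable_fun Om f -> inLp p%:E Om g ->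
  {ae leb d, forall x, Om x -> `|f x| <= `|g x|} ->
  inLp p%:E Om f /\ nrm p f <= nrm p g.
Proof.
move=> p0 mf Ig fg; apply: inLp_le => //; rewrite -LpnE//.
by apply: Lp_le => //; case: Ig.
Qed.

Lemma nrmD p f g : 1 <= p -> inLp p%:E Om f -> inLp p%:E Om g ->
  inLp p%:E Om (f \+ g) /\ nrm p (f \+ g) <= nrm p f + nrm p g.
Proof.
move=> p1 If Ig; have [mf _] := If; have [mg _] := Ig.
apply: inLp_le; first exact: measurable_funD.
by rewrite EFinD -!LpnE//; apply: Lp_triangle.
Qed.

Lemma nrmZ p (c : R) f : 0 < p -> inLp p%:E Om f ->
  inLp p%:E Om (fun x => c * f x) /\ nrm p (fun x => c * f x) = `|c| * nrm p f.
Proof.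
move=> p0 If; have [mf _] := If.
have E1 : Lp p%:E Om (fun x => c * f x) = (`|c| * nrm p f)%:E.
  by rewrite LpZ// LpnE.
split; last by rewrite {1}nrmE E1.
by split; [exact: measurable_funM | rewrite E1 ltry].
Qed.

Lemma nrm_bdf p f : 0 < p -> bdf Om f -> inLp p%:E Om f.
Proof. by move=> p0; exact: Lp_bdf. Qed.

Lemma nrm_mul p q r f g : 0 < p -> 0 < q -> 0 < r -> p^-1 = q^-1 + r^-1 ->
  inLp q%:E Om f -> inLp r%:E Om g ->
  inLp p%:E Om (f \* g) /\ nrm p (f \* g) <= nrm q f * nrm r g.
Proof.
move=> p0 q0 r0 pqr If Ig; have [mf _] := If; have [mg _] := Ig.
apply: inLp_le; first exact: measurable_funM.
by rewrite EFinM -!LpnE//; exact: Lp_mul.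
Qed.

Lemma inLp1 f : inLp 1%:E Om f <-> (leb d).-integrable Om (EFin \o f).
Proof.
have E1 : Lp 1%:E Om f = (\int[leb d]_(x in Om) `|(EFin \o f) x|)%E.
  rewrite LpE// invr1 poweRe1; last by apply: integral_ge0 => x _; rewrite lee_fin powR_ge0.
  by apply: eq_integral => x _; rewrite powRr1.
split; first by move=> [mf]; rewrite E1 => If; apply/integrableP; split => //; exact/measurable_EFinP.
by move=> /integrableP[/measurable_EFinP mf If]; split => //; rewrite E1.
Qed.

Lemma normr_int_nrm1 f : inLp 1%:E Om f -> `|\int[leb d]_(x in Om) f x| <= nrm 1 f.
Proof.
move=> If; rewrite (le_trans (le_normr_Rintegral _ _))//; first exact/inLp1.
rewrite nrmE LpE// invr1 poweRe1; last by apply: integral_ge0 => x _; rewrite lee_fin powR_ge0.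
rewrite /Rintegral le_eqVlt; apply/orP; left; apply/eqP; congr fine.
by apply: eq_integral => x _; rewrite powRr1.
Qed.

Lemma nrm2_sq f : inLp 2%:E Om f ->
  (leb d).-integrable Om (EFin \o (fun x => f x * f x)) /\
  \int[leb d]_(x in Om) (f x * f x) = nrm 2 f ^+ 2.
Proof.
move=> If; have [I1 _] : inLp 1%:E Om (f \* f) /\ nrm 1 (f \* f) <= nrm 2 f * nrm 2 f.
  by apply: nrm_mul => //; rewrite invr1; field.
have Iff : (leb d).-integrable Om (EFin \o (fun x => f x * f x)) by exact/inLp1.
split => //; rewrite nrmE LpE// /Rintegral.
set I := (X in fine X = _); set J := (X in (X `^ _)%E).
have IJ : I = J.
  apply: eq_integral => x _; congr EFin.
  by rewrite powR_mulrn// real_normK ?num_real// expr2.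
rewrite -IJ; have I0 : (0 <= I)%E by rewrite IJ; apply: integral_ge0 => x _; rewrite lee_fin powR_ge0.
have : I \is a fin_num by exact: integrable_fin_num.
move: I0; case: (I) => [a| |]//= a0 _; rewrite lee_fin in a0.
by rewrite -powR_mulrn ?powR_ge0// -powRrM mulVf// powRr1.
Qed.

Lemma int_le2 p q f g h : 0 < p -> 0 < q -> 1 = p^-1 + q^-1 ->
  measurable_fun Om f -> inLp p%:E Om g -> inLp q%:E Om h ->
  {ae leb d, forall x, Om x -> `|f x| <= `|g x| * `|h x|} ->
  (leb d).-integrable Om (EFin \o f) /\
  `|\int[leb d]_(x in Om) f x| <= nrm p g * nrm q h.
Proof.
move=> p0 q0 pq mf Ig Ih fgh.
have [Igh gh] : inLp 1%:E Om (g \* h) /\ nrm 1 (g \* h) <= nrm p g * nrm q h.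
  by apply: nrm_mul => //; rewrite invr1.
have [If fle] : inLp 1%:E Om f /\ nrm 1 f <= nrm 1 (g \* h).
  by apply: nrm_le => //; apply: filterS fgh => x /[apply]; rewrite /= normrM.
split; first exact/inLp1.
by rewrite (le_trans (normr_int_nrm1 If))// (le_trans fle).
Qed.

Lemma int_le3 p q r f g h k : 0 < p -> 0 < q -> 0 < r -> 1 = p^-1 + q^-1 + r^-1 ->
  measurable_fun Om f -> inLp p%:E Om g -> inLp q%:E Om h -> inLp r%:E Om k ->
  {ae leb d, forall x, Om x -> `|f x| <= `|g x| * `|h x| * `|k x|} ->
  (leb d).-integrable Om (EFin \o f) /\
  `|\int[leb d]_(x in Om) f x| <= nrm p g * nrm q h * nrm r k.
Proof.
move=> p0 q0 r0 pq mf Ig Ih Ik fgh; set s := (p^-1 + q^-1)^-1.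
have s0 : 0 < s by rewrite invr_gt0 addr_gt0 ?invr_gt0.
have [Igh gh] : inLp s%:E Om (g \* h) /\ nrm s (g \* h) <= nrm p g * nrm q h.
  by apply: nrm_mul => //; rewrite invrK.
have [If fle] : (leb d).-integrable Om (EFin \o f) /\
    `|\int[leb d]_(x in Om) f x| <= nrm s (g \* h) * nrm r k.
  apply: int_le2 => //; first by rewrite invrK.
  by apply: filterS fgh => x /[apply]; rewrite /= normrM.
by split => //; rewrite (le_trans fle)// ler_wpM2r// nrm_ge0.
Qed.

Lemma ae_le_Rintegral f g : (leb d).-integrable Om (EFin \o f) ->
  (leb d).-integrable Om (EFin \o g) ->
  {ae leb d, forall x, Om x -> f x <= g x} ->
  \int[leb d]_(x in Om) f x <= \int[leb d]_(x in Om) g x.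
Proof.
move=> If Ig fg; rewrite -subr_ge0 -RintegralB// /Rintegral.
pose h x := Num.max 0 (g x - f x).
have Igf : (leb d).-integrable Om (EFin \o (fun x => g x - f x)).
  by have := integrableB mOm Ig If; apply: eq_integrable => // x _.
have mgf : measurable_fun Om (fun x => g x - f x) by case/integrableP: Igf => /measurable_EFinP.
rewrite (ae_eq_integral (EFin \o h))//=.
- by apply: fine_ge0; apply: integral_ge0 => x _; rewrite lee_fin le_max lexx.
- exact/measurable_EFinP.
- by apply/measurable_EFinP; apply: measurable_maxr.
- by apply: filterS fg => x fg /fg {}fg; rewrite /h/= max_r// subr_ge0.
Qed.

Lemma ae_eq_Rintegral f g : measurable_fun Om f -> measurable_fun Om g ->
  {ae leb d, forall x, Om x -> f x = g x} ->
  \int[leb d]_(x in Om) f x = \int[leb d]_(x in Om) g x.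
Proof.
move=> mf mg fg; congr fine; apply: ae_eq_integral => //; try exact/measurable_EFinP.
by apply: filterS fg => x /[apply] ->.
Qed.

End nrm.

(** * Euclidean geometry and the tensor K *)

Section euclidean_theory.
Context {R : realType} {d : nat}.
Local Notation E := 'rV[R]_d.
Implicit Types (x y u v w : E).

Lemma dotC u v : dot u v = dot v u.
Proof. by apply: eq_bigr => i _; rewrite mulrC. Qed.

Lemma dotDl u v w : dot (u + v) w = dot u w + dot v w.
Proof. by rewrite /dot -big_split/=; apply: eq_bigr => i _; rewrite mxE mulrDl. Qed.

Lemma dotZl (a : R) u w : dot (a *: u) w = a * dot u w.
Proof. by rewrite /dot mulr_sumr; apply: eq_bigr => i _; rewrite mxE mulrA. Qed.

Lemma dotNl u w : dot (- u) w = - dot u w.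
Proof. by rewrite -scaleN1r dotZl mulN1r. Qed.

Lemma dotBl u v w : dot (u - v) w = dot u w - dot v w.
Proof. by rewrite dotDl dotNl. Qed.

Lemma dotDr u v w : dot w (u + v) = dot w u + dot w v.
Proof. by rewrite dotC dotDl !(dotC w). Qed.

Lemma dotZr (a : R) u w : dot w (a *: u) = a * dot w u.
Proof. by rewrite dotC dotZl dotC. Qed.

Lemma dotBr u v w : dot w (u - v) = dot w u - dot w v.
Proof. by rewrite dotC dotBl !(dotC w). Qed.

Lemma dot0l u : dot 0 u = 0.
Proof. by rewrite /dot big1// => i _; rewrite mxE mul0r. Qed.

Lemma dot_ge0 u : 0 <= dot u u.
Proof. by apply: sumr_ge0 => i _; rewrite -expr2 sqr_ge0. Qed.

Lemma dot_eq0 u : dot u u = 0 -> u = 0.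
Proof.
move=> /psumr_eq0P H; apply/rowP => i; rewrite mxE.
by apply/eqP; rewrite -sqrf_eq0 expr2; apply/eqP/H => // j _; rewrite -expr2 sqr_ge0.
Qed.

Lemma enorm_ge0 u : 0 <= enorm u.
Proof. exact: sqrtr_ge0. Qed.

Lemma sqr_enorm u : enorm u ^+ 2 = dot u u.
Proof. by rewrite sqr_sqrtr// dot_ge0. Qed.

Lemma cauchy_schwarz u v : `|dot u v| <= enorm u * enorm v.
Proof.
rewrite -(@ler_pXn2r _ 2)// ?nnegrE ?mulr_ge0 ?enorm_ge0//.
rewrite real_normK ?num_real// exprMn !sqr_enorm.
have [v0|vn0] := eqVneq (dot v v) 0.
  by rewrite (dot_eq0 v0) (dotC u) !dot0l expr0n/= mulr0.
have vp : 0 < dot v v by rewrite lt_neqAle eq_sym vn0 dot_ge0.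
have := dot_ge0 (dot v v *: u - dot u v *: v).
rewrite dotBl !dotBr !dotZl !dotZr (dotC v u) => H.
rewrite -(ler_pM2l vp) -subr_ge0; apply: le_trans H _.
by rewrite le_eqVlt; apply/orP; left; apply/eqP; ring.
Qed.

Lemma enormN u : enorm (- u) = enorm u.
Proof. by rewrite /enorm dotNl dotC dotNl opprK. Qed.

Lemma enormD u v : enorm (u + v) <= enorm u + enorm v.
Proof.
rewrite -(@ler_pXn2r _ 2)// ?nnegrE ?addr_ge0 ?enorm_ge0//.
rewrite sqrrD !sqr_enorm dotDl !dotDr (dotC v u).
have := le_trans (ler_norm _) (cauchy_schwarz u v); lra.
Qed.

Lemma enormB_ge u v : `|enorm u - enorm v| <= enorm (u - v).
Proof.
rewrite ler_norml; have := enormD (u - v) v; have := enormD (v - u) u.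
rewrite !subrK -(enormN (v - u)) opprB; lra.
Qed.

Lemma coord_enorm u i : `|u ord0 i| <= enorm u.
Proof.
rewrite -(@ler_pXn2r _ 2)// ?nnegrE ?enorm_ge0// sqr_enorm real_normK ?num_real//.
by rewrite /dot (bigD1 i)//= -expr2 lerDl; apply: sumr_ge0 => j _; rewrite -expr2 sqr_ge0.
Qed.

Lemma mxappE (A : 'M[R]_d) u i : mxapp A u ord0 i = \sum_j A i j * u ord0 j.
Proof. by rewrite /mxapp !mxE; apply: eq_bigr => j _; rewrite !mxE. Qed.

Lemma mxappB (A : 'M[R]_d) u v : mxapp A (u - v) = mxapp A u - mxapp A v.
Proof. by rewrite /mxapp linearB mulmxBr linearB. Qed.

Lemma mxappD (A : 'M[R]_d) u v : mxapp A (u + v) = mxapp A u + mxapp A v.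
Proof. by rewrite /mxapp linearD mulmxDr linearD. Qed.

Lemma mxappZ (A : 'M[R]_d) (a : R) u : mxapp A (a *: u) = a *: mxapp A u.
Proof. by rewrite /mxapp linearZ -scalemxAr linearZ. Qed.

Lemma dot_mxapp_sym (A : 'M[R]_d) u v : A^T = A -> dot (mxapp A u) v = dot (mxapp A v) u.
Proof.
move=> AT; rewrite /dot; under eq_bigr => i _ do rewrite mxappE mulr_suml.
under [RHS]eq_bigr => i _ do rewrite mxappE mulr_suml.
rewrite exchange_big/=; apply: eq_bigr => i _; apply: eq_bigr => j _.
by rewrite -{1}AT mxE; ring.
Qed.

Lemma smooth_dot (f g : E -> E) : (forall i, smooth (fun x => f x ord0 i)) ->
  (forall i, smooth (fun x => g x ord0 i)) -> smooth (fun x => dot (f x) (g x)).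
Proof. by move=> sf sg; apply: smooth_sum => i; exact: smoothM. Qed.

(* The minimum of the quadratic form on the unit sphere is an eigenvalue. *)
Lemma eigenvalue_coercive (A : 'M[R]_d) (m : R) : A^T = A ->
  (forall a, eigenvalue A a -> m <= a) -> forall x, m * dot x x <= dot (mxapp A x) x.
Proof.
move=> AT Am x; have [x0|xn0] := eqVneq (dot x x) 0.
  by rewrite (dot_eq0 x0) dotC !dot0l mulr0.
pose S : set E := [set y | dot y y = 1].
have cq : continuous (fun y : E => dot (mxapp A y) y).
  apply/smooth_continuous/smooth_dot => i; last exact: smooth_coord.
  under eq_fun do rewrite mxappE; apply: smooth_sum => j.
  by apply: smoothM; [exact: smooth_cst|exact: smooth_coord].
have nrmS (y : E) : dot y y != 0 -> S ((enorm y)^-1 *: y).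
  move=> y0; rewrite /S/= dotZl dotZr -sqr_enorm; field.
  by rewrite -sqrf_eq0 sqr_enorm.
have cS : compact S.
  apply: bounded_closed_compact.
    exists 1; split => // M M1 y Sy; rewrite /= (le_trans _ (ltW M1))//.
    have : enorm y <= 1 by rewrite /enorm Sy sqrtr1.
    apply: le_trans; rewrite [leLHS]/Num.norm/= mx_normrE.
    by apply: bigmax_le => [|[i j] _ /=]; [exact: enorm_ge0|rewrite ord1 coord_enorm].
  apply: (@closed_comp _ _ (fun y : E => dot y y) [set 1]).
    by move=> y _; apply: (smooth_continuous (smooth_dot _ _)) => i; exact: smooth_coord.
  exact: closed_eq.
have [z Sz minz] : exists2 z, z \in S & forall t, t \in S ->
    dot (mxapp A z) z <= dot (mxapp A t) t.
  apply: compact_EVT_min => //; last exact: continuous_subspaceT.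
  by exists ((enorm x)^-1 *: x); exact: nrmS.
set l := dot (mxapp A z) z in minz; move: Sz; rewrite inE /S/= => zz.
have Q y : 0 <= dot (mxapp A y) y - l * dot y y.
  have [y0|y0] := eqVneq (dot y y) 0.
    by rewrite (dot_eq0 y0) dotC !dot0l mulr0 subr0.
  have /minz : (enorm y)^-1 *: y \in S by rewrite inE; exact: nrmS.
  rewrite mxappZ dotZl dotZr => H; rewrite subr_ge0 -sqr_enorm.
  have e0 : 0 < enorm y by rewrite lt_neqAle enorm_ge0 andbT eq_sym -sqrf_eq0 sqr_enorm.
  move: H; rewrite mulrA -invfM -expr2 ler_pdivlMl ?exprn_gt0//; lra.
have B y : dot (mxapp A z) y - l * dot z y = 0.
  set b := _ - _; have [//|bn0] := eqVneq b 0.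
  pose q := dot (mxapp A y) y - l * dot y y.
  have q0 : 0 <= q := Q y.
  (* With this step the quadratic form at [z + t *: y], diminished by [l] times the squared length,
     equals - b^2 (q + 2) / (q + 1)^2, which is negative unless [b = 0]. The shift by 1 covers the
     case [q = 0]. *)
  pose t := - b / (q + 1); have := Q (z + t *: y).
  rewrite mxappD mxappZ !dotDl !dotDr !dotZl !dotZr (dot_mxapp_sym y z AT) (dotC y z) zz -/l.
  rewrite (_ : _ - _ = 2 * t * b + t ^+ 2 * q); last by rewrite /b /q; ring.
  have q1 : q + 1 != 0 by rewrite gt_eqF// ltr_wpDl.
  rewrite (_ : _ + _ = - (b ^+ 2) * (q + 2) / (q + 1) ^+ 2); last by rewrite /t; field.
  rewrite leNgt => /negP[]; rewrite mulNr mulNr oppr_lt0 divr_gt0//.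
    by rewrite mulr_gt0 ?ltr_wpDl// lt_neqAle sqr_ge0 andbT eq_sym sqrf_eq0.
  by rewrite exprn_gt0// ltr_wpDl.
have lm : m <= l.
  apply: Am; apply/eigenvalueP; exists z; last first.
    by apply/eqP => z0; move: zz; rewrite z0 dot0l => /eqP; rewrite eq_sym oner_eq0.
  have -> : z *m A = mxapp A z by rewrite /mxapp trmx_mul trmxK AT.
  apply/eqP; rewrite -subr_eq0; apply/eqP/dot_eq0.
  by rewrite dotBl dotZl B.
have := Q x; rewrite subr_ge0; apply: le_trans.
by rewrite ler_wpM2r// dot_ge0.
Qed.

(** Coercivity makes [A] injective, hence invertible; for y = A^-1 x it then gives k |y|^2 <= x . y
    <= |x| |y|. *)
Lemma mxapp_inv_bound (A : 'M[R]_d) (k : R) x : 0 < k -> A^T = A ->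
  (forall y, k * dot y y <= dot (mxapp A y) y) ->
  k * enorm (mxapp (invmx A) x) <= enorm x.
Proof.
move=> k0 AT kA; have uA : A \in unitmx.
  rewrite -row_free_unit; apply/inj_row_free => v vA; apply: dot_eq0.
  have := kA v; rewrite (_ : mxapp A v = 0); last first.
    by rewrite /mxapp -{1}AT -trmx_mul trmxK.
  rewrite dot0l => H; apply/eqP; rewrite eq_le dot_ge0 andbT.
  by move: H; rewrite pmulr_rle0.
set y := mxapp _ _; have Ay : mxapp A y = x by rewrite /y /mxapp trmxK mulKVmx// trmxK.
have := kA y; rewrite Ay => /le_trans/(_ (le_trans (ler_norm _) (cauchy_schwarz _ _))).
have [->|y0] := eqVneq (enorm y) 0; first by move=> _; rewrite mulr0 enorm_ge0.
rewrite -sqr_enorm expr2 mulrA ler_pM2r//.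
by rewrite lt_neqAle eq_sym y0 enorm_ge0.
Qed.

End euclidean_theory.

(** * Measurability and boundedness of scalar, vector and matrix fields *)

Section bounded_functions.
Context {R : realType} {d : nat}.
Local Notation E := 'rV[R]_d.
Variable A : set E.
Implicit Types (f g : E -> R) (u v : E -> E).

Lemma bdf_cst (c : R) : bdf A (fun=> c).
Proof. by split; [exact: measurable_cst | exists `|c| => //; exact: aeW]. Qed.

Lemma bdfD f g : bdf A f -> bdf A g -> bdf A (fun x => f x + g x).
Proof.
move=> [mf [M M0 fM]] [mg [N N0 gN]]; split; first exact: measurable_funD.
exists (M + N); first exact: addr_ge0.
apply: filterS2 fM gN => x fM gN Ax.
by rewrite (le_trans (ler_normD _ _))// lerD// ?fM ?gN.
Qed.

Lemma bdfM f g : bdf A f -> bdf A g -> bdf A (fun x => f x * g x).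
Proof.
move=> [mf [M M0 fM]] [mg [N N0 gN]]; split; first exact: measurable_funM.
exists (M * N); first exact: mulr_ge0.
by apply: filterS2 fM gN => x fM gN Ax; rewrite normrM ler_pM// ?fM ?gN.
Qed.

Lemma bdfN f : bdf A f -> bdf A (fun x => - f x).
Proof.
move=> bf; rewrite (_ : (fun _ => _) = (fun x => -1 * f x)).
  by apply: bdfM => //; exact: bdf_cst.
by apply/funext => x; rewrite mulN1r.
Qed.

Lemma bdfB f g : bdf A f -> bdf A g -> bdf A (fun x => f x - g x).
Proof. by move=> bf bg; apply: bdfD => //; exact: bdfN. Qed.

Lemma bdf_sum n (F : 'I_n -> E -> R) : (forall i, bdf A (F i)) ->
  bdf A (fun x => \sum_i F i x).
Proof.
elim: n F => [|n IH] F bF.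
  by under eq_fun do rewrite big_ord0; exact: bdf_cst.
under eq_fun do rewrite big_ord_recl.
by apply: bdfD => //; exact: (IH (fun i => F (lift ord0 i))).
Qed.

Definition vmeas v := forall i, measurable_fun A (fun x => v x ord0 i).
Definition vbdf v := forall i, bdf A (fun x => v x ord0 i).

Lemma measurable_fun_vmeas v : measurable_fun A v -> vmeas v.
Proof.
move=> mv i.
exact: (measurableT_comp (measurable_coord i) mv).
Qed.

Lemma vmeas_measurable_fun v : measurable A -> vmeas v -> measurable_fun A v.
Proof.
move=> mA mv; have mw : measurable_fun A (fun x => \1_A x *: v x).
  apply: measurable_funTS; apply: measurable_fun_rV => i.
  under eq_fun do rewrite mxE; exact: measurable_indic_mul.
apply: eq_measurable_fun mw => x xA.
by rewrite indicE xA scale1r.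
Qed.

Lemma vbdf_vmeas v : vbdf v -> vmeas v.
Proof. by move=> bv i; case: (bv i). Qed.

Lemma vbdfB u v : vbdf u -> vbdf v -> vbdf (fun x => u x - v x).
Proof.
move=> bu bv i; rewrite (_ : (fun _ => _) = (fun x => u x ord0 i - v x ord0 i)).
  exact: bdfB.
by apply/funext => x; rewrite !mxE.
Qed.

Lemma vmeasB u v : vmeas u -> vmeas v -> vmeas (fun x => u x - v x).
Proof.
move=> bu bv i; rewrite (_ : (fun _ => _) = (fun x => u x ord0 i - v x ord0 i)).
  exact: measurable_funB.
by apply/funext => x; rewrite !mxE.
Qed.

Lemma vmeasD u v : vmeas u -> vmeas v -> vmeas (fun x => u x + v x).
Proof.
move=> bu bv i; rewrite (_ : (fun _ => _) = (fun x => u x ord0 i + v x ord0 i)).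
  exact: measurable_funD.
by apply/funext => x; rewrite !mxE.
Qed.

Lemma measurable_dot u v : vmeas u -> vmeas v ->
  measurable_fun A (fun x => dot (u x) (v x)).
Proof. by move=> mu mv; apply: measurable_sum => i; exact: measurable_funM. Qed.

Lemma measurable_enorm u : vmeas u -> measurable_fun A (fun x => enorm (u x)).
Proof.
move=> mu; rewrite (_ : (fun _ => _) = (fun x => dot (u x) (u x) `^ 2^-1)).
  by apply: (measurableT_comp (measurable_powR _)); exact: measurable_dot.
by apply/funext => x; rewrite powR12_sqrt// dot_ge0.
Qed.

Lemma bdf_dot u v : vbdf u -> vbdf v -> bdf A (fun x => dot (u x) (v x)).
Proof. by move=> bu bv; apply: bdf_sum => i; exact: bdfM. Qed.

Lemma bdf_enorm u : vbdf u -> bdf A (fun x => enorm (u x)).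
Proof.
move=> bu; split; first by apply: measurable_enorm; exact: vbdf_vmeas.
have [m [M M0 HM]] := bdf_dot bu bu; exists (Num.sqrt M); first exact: sqrtr_ge0.
apply: filterS HM => x /[apply]; rewrite ger0_norm ?dot_ge0// ger0_norm ?enorm_ge0// => H.
by rewrite ler_sqrt// (le_trans (dot_ge0 _) H).
Qed.

Lemma bdf_le f g : measurable_fun A f -> bdf A g ->
  {ae leb d, forall x, A x -> `|f x| <= `|g x|} -> bdf A f.
Proof.
move=> mf [_ [M M0 gM]] fg; split => //; exists M => //.
by apply: filterS2 fg gM => x fg gM Ax; rewrite (le_trans (fg Ax))// gM.
Qed.

Lemma enorm_vbdf u : vmeas u -> bdf A (fun x => enorm (u x)) -> vbdf u.
Proof.
move=> mu bu i; apply: bdf_le bu _ => //; apply: aeW => x _.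
by rewrite [leRHS]ger0_norm ?enorm_ge0// coord_enorm.
Qed.

Lemma measurable_det n (M : E -> 'M[R]_n) :
  (forall i j, measurable_fun A (fun x => M x i j)) ->
  measurable_fun A (fun x => \det (M x)).
Proof.
move=> mM; apply: measurable_sum => s; apply: measurable_funM => //.
by apply: measurable_prod => i _.
Qed.

(** The reciprocal is f times the power -1 of f^2, so measurability of [powR] applies; at the zeros
    of f both expressions vanish. *)
Lemma measurable_invr f : measurable_fun A f -> measurable_fun A (fun x => (f x)^-1).
Proof.
move=> mf; rewrite (_ : (fun _ => _) = (fun x => f x * (f x ^+ 2) `^ (-1))).
  apply: measurable_funM => //; apply: (measurableT_comp (measurable_powR _)).
  exact: measurable_funX.
apply/funext => x; rewrite powR_inv1 ?sqr_ge0//.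
by have [->|f0] := eqVneq (f x) 0; [rewrite invr0 mul0r | field].
Qed.

Lemma measurable_invmx n (M : E -> 'M[R]_n) : measurable A ->
  (forall i j, measurable_fun A (fun x => M x i j)) ->
  forall i j, measurable_fun A (fun x => invmx (M x) i j).
Proof.
move=> mA mM i j.
have md := measurable_det mM.
(* [invmx] is given by cofactors on invertible matrices and, by convention, is the matrix itself on
   singular ones. *)
rewrite (_ : (fun _ => _) = (fun x => if \det (M x) == 0 then M x i j else
    (\det (M x))^-1 * ((-1) ^+ (j + i) * \det (row' j (col' i (M x)))))); last first.
  apply/funext => x; rewrite /invmx unitmxE unitfE.
  by have [//|d0] := eqVneq (\det (M x)) 0; rewrite !mxE.
apply: measurable_fun_if => //.
- by apply: measurable_fun_eqr => //; exact: measurable_cst.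
- by apply: measurable_funS mA _ (mM i j); exact: subIsetl.
- apply: (measurable_funS mA); first exact: subIsetl.
  apply: measurable_funM; first exact: measurable_invr.
  apply: measurable_funM => //; apply: measurable_det => i' j'.
  by under eq_fun do rewrite !mxE; exact: mM.
Qed.

End bounded_functions.

Ltac bdf_tac := repeat first
  [ assumption | exact: bdf_cst | apply: bdfD | apply: bdfB | apply: bdfM | apply: bdfN
  | apply: bdf_dot | apply: bdf_enorm | apply: vbdfB ].

(** * Coercivity and boundedness of the inverse tensor *)

Section Kinv.
Context {R : realType} {d : nat}.
Local Notation E := 'rV[R]_d.
Variables (D : data R d) (Om : set E) (Km KM : R).
Hypotheses (mOm : measurable Om) (hK : tensor_assumptions D Om Km KM).

Lemma vmeas_Kinv u : vmeas Om u -> vmeas Om (Kinv D u).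
Proof.
move=> mu i; rewrite /Kinv; under eq_fun do rewrite mxappE.
apply: measurable_sum => j; apply: measurable_funM => //.
by apply: measurable_invmx => // i' j'; case: hK.
Qed.

(** The inverse of a symmetric matrix is symmetric, so the lower bound [Km] of its eigenvalues is
    one of its quadratic form. *)
Lemma Kinv_coercive : {ae leb d, forall x, Om x ->
  forall u, Km * dot (u x) (u x) <= dot (Kinv D u x) (u x)}.
Proof.
case: hK => _ symK _ _ [_ _ _ eK].
apply: filterS2 symK eK => x symK eK Ox u; rewrite /Kinv.
apply: eigenvalue_coercive; last exact: eK.
by rewrite trmx_inv symK.
Qed.

(** Uniform positivity of [K] gives the bound |K^-1 x| <= |x| / k0. *)
Lemma vbdf_Kinv u : vbdf Om u -> vbdf Om (Kinv D u).
Proof.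
move=> bu; case: hK => _ symK [k0 k00 posK] _ _.
apply: enorm_vbdf; first by apply: vmeas_Kinv; exact: vbdf_vmeas.
apply: (@bdf_le _ _ _ _ (fun x => k0^-1 * enorm (u x))).
- by apply: measurable_enorm; apply: vmeas_Kinv; exact: vbdf_vmeas.
- by bdf_tac.
- apply: filterS2 symK posK => x symK posK Ox.
  rewrite !ger0_norm ?mulr_ge0 ?enorm_ge0 ?invr_ge0 ?(ltW k00)//.
  by rewrite ler_pdivlMl//; apply: mxapp_inv_bound; [|exact: symK|exact: posK].
Qed.

Lemma Km_gt0_KM : 0 < Km <= KM.
Proof. by case: hK => _ _ _ _ [-> /le_trans H /H]; rewrite lee_fin. Qed.

End Kinv.

(** * Sobolev functions and the convection form *)

Lemma Rintegral_sum {R : realType} {d : nat} (A : set 'rV[R]_d) n (F : 'I_n -> 'rV[R]_d -> R) :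
  measurable A -> (forall i, (leb d).-integrable A (EFin \o F i)) ->
  (leb d).-integrable A (EFin \o (fun x => \sum_i F i x)) /\
  \int[leb d]_(x in A) (\sum_i F i x) = \sum_i \int[leb d]_(x in A) F i x.
Proof.
move=> mA; elim: n F => [|n IH] F iF.
  under eq_fun do rewrite big_ord0; rewrite big_ord0; split; first exact: integrable0.
  by rewrite /Rintegral integral0.
have [I1 E1] := IH _ (fun i => iF (lift ord0 i)).
under eq_fun do rewrite big_ord_recl; rewrite big_ord_recl; split.
  by have := integrableD mA (iF ord0) I1; apply: eq_integrable.
by rewrite RintegralD// E1.
Qed.

Definition gnorm {R : realType} {d : nat} (Om : set 'rV[R]_d) (f : 'rV[R]_d -> R)
  (x : 'rV[R]_d) : R := enorm (wgrad Om f x).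

HB.lock Definition semi {R : realType} {d : nat} (Om : set 'rV[R]_d)
  (f : 'rV[R]_d -> R) : R := nrm Om 2 (gnorm Om f).

(* With b = div w / 2 this is the skew-symmetrized convection term of the discrete
   problem, with b = 0 that of the continuous one. *)
HB.lock Definition bform {R : realType} {d : nat} (Om : set 'rV[R]_d)
  (b : 'rV[R]_d -> R) (w : 'rV[R]_d -> 'rV[R]_d) (c s : 'rV[R]_d -> R) : R :=
  \int[leb d]_(x in Om) (b x * c x * s x + dot (w x) (wgrad Om c x) * s x).

Lemma bform_def {R : realType} {d : nat} (Om : set 'rV[R]_d) b w (c s : 'rV[R]_d -> R) :
  bform Om b w c s =
  \int[leb d]_(x in Om) (b x * c x * s x + dot (w x) (wgrad Om c x) * s x).
Proof. by rewrite unlock. Qed.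

Section H10_theory.
Context {R : realType} {d : nat}.
Local Notation E := 'rV[R]_d.
Variable Om : set E.
Hypotheses (oOm : open Om) (bOm : bounded_set Om).
Implicit Types (f g c s phi psi : E -> R) (v w : E -> E).
Local Notation nrm := (nrm Om).
Local Notation "'int' f" := (Rintegral (leb d) Om f) (at level 10, f at level 9).

Let le12 : 1 <= 2 :> R. Proof. by rewrite ler1n. Qed.

Let mOm : measurable Om. Proof. exact: open_measurable_rV. Qed.
Let fOm : (leb d Om < +oo)%E. Proof. exact: leb_bounded_fin. Qed.

Local Notation gnorm := (gnorm Om).
Local Notation semi := (semi Om).

Lemma semiE f : semi f = nrm 2 (gnorm f).
Proof. by rewrite unlock. Qed.

(** Membership in [W1 2] with the existential gradient replaced by the representative [wgrad], so
    that no witness has to be carried along. *)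
Definition H1 f := [/\ inLp 2%:E Om f, weak_grad Om f (wgrad Om f) & inLp 2%:E Om (gnorm f)].

Lemma vmeas_wgrad f G : weak_grad Om f G -> vmeas Om G.
Proof. by case=> _ H _ i; case: (H i). Qed.

Lemma W1_gnorm p f : 0 < p -> W1 p%:E Om f ->
  [/\ inLp p%:E Om f, weak_grad Om f (wgrad Om f) & inLp p%:E Om (gnorm f)].
Proof.
move=> p0 [If [G wG [mG Gfin]]]; have [wg wE] := wgradP oOm wG; split => //.
have mw : measurable_fun Om (gnorm f) by apply: measurable_enorm; exact: vmeas_wgrad wg.
split => //; apply: le_lt_trans Gfin; apply: Lp_le => //.
  by apply: measurable_enorm; exact: vmeas_wgrad wG.
by apply: filterS wE => x /[apply] xE; rewrite /gnorm xE.
Qed.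

Lemma W1_H1 f : W1 2%:E Om f -> H1 f.
Proof. by move=> /W1_gnorm[]. Qed.

Lemma W1seminormE f : H1 f -> W1seminorm 2%:E Om f = (semi f)%:E.
Proof. by case=> _ _ ?; rewrite semiE /W1seminorm /vLp LpnE. Qed.

Lemma semi_ge0 f : 0 <= semi f.
Proof. by rewrite semiE nrm_ge0. Qed.

Lemma H1_bdf f : bdf Om f -> weak_grad Om f (wgrad Om f) -> vbdf Om (wgrad Om f) -> H1 f.
Proof.
move=> bf wf bw; split => //; apply: nrm_bdf => //.
exact: bdf_enorm.
Qed.

(** The difference is a variable tied to [f \- g] by an equation, which keeps its norms atomic in
    later arithmetic. The bound holds for every exponent in which both gradients are integrable. *)
Lemma H1B f g h : h = f \- g -> H1 f -> H1 g -> H1 h /\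
  (forall p, 1 <= p -> inLp p%:E Om (gnorm f) -> inLp p%:E Om (gnorm g) ->
     inLp p%:E Om (gnorm h) /\ nrm p (gnorm h) <= nrm p (gnorm f) + nrm p (gnorm g)).
Proof.
move=> hE [If wf Gf] [Ig wg Gg].
have wE := wgradB oOm wf wg; rewrite -hE in wE.
have [wB _] := wgradP oOm (weak_gradB oOm wf wg); rewrite -hE in wB.
have hx x : h x = f x - g x by rewrite hE.
clear hE.
have H p : 1 <= p -> inLp p%:E Om (gnorm f) -> inLp p%:E Om (gnorm g) ->
     inLp p%:E Om (gnorm h) /\ nrm p (gnorm h) <= nrm p (gnorm f) + nrm p (gnorm g).
  move=> p1 pf pg; have p0 : 0 < p by exact: lt_le_trans ltr01 p1.
  have [ID nD] := nrmD mOm p1 pf pg.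
  have [IB nB] : inLp p%:E Om (gnorm h) /\ nrm p (gnorm h) <= nrm p (gnorm f \+ gnorm g).
    apply: nrm_le => //; first by apply: measurable_enorm; exact: vmeas_wgrad wB.
    apply: filterS wE => x /[apply] xE /=.
    rewrite !ger0_norm ?addr_ge0 ?enorm_ge0// /gnorm xE.
    by rewrite (le_trans (enormD _ _))// enormN.
  by split => //; exact: le_trans nD.
split; last exact: H.
split; [|exact: wB|exact: (H 2 le12 Gf Gg).1].
have [IgN _] := nrmZ mOm (-1) (ltr0n _ 2) Ig.
have [] := nrmD mOm le12 If IgN.
rewrite (_ : f \+ _ = h)//; apply/funext => x /=; by rewrite mulN1r hx.
Qed.

Lemma nrm2B f g h : h = f \- g -> inLp 2%:E Om f -> inLp 2%:E Om g ->
  inLp 2%:E Om h /\ nrm 2 h <= nrm 2 f + nrm 2 g.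
Proof.
move=> hE If Ig; have [IgN nN] := nrmZ mOm (-1) (ltr0n _ 2) Ig.
have [] := nrmD mOm le12 If IgN.
rewrite nN normrN1 mul1r (_ : f \+ _ = h)//.
by rewrite hE; apply/funext => x /=; rewrite mulN1r.
Qed.

Lemma H1normE f : H1 f -> H1norm Om f = (Num.sqrt (nrm 2 f ^+ 2 + semi f ^+ 2))%:E.
Proof.
move=> hf; have [If wf Gf] := hf; rewrite /H1norm W1seminormE// LpnE//.
by rewrite -!EFin_expe -EFinD poweR_EFin powR12_sqrt// addr_ge0 ?sqr_ge0.
Qed.

Lemma H1norm_le f : H1 f -> (H1norm Om f <= (nrm 2 f + semi f)%:E)%E.
Proof.
move=> hf; rewrite H1normE// lee_fin -(@ler_pXn2r _ 2)// ?nnegrE ?sqrtr_ge0 ?addr_ge0 ?nrm_ge0 ?semi_ge0//.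
rewrite sqr_sqrtr ?addr_ge0 ?sqr_ge0// sqrrD.
have := mulr_ge0 (nrm_ge0 Om 2 f) (semi_ge0 f); lra.
Qed.

Lemma H1norm_ge f (e : R) : H1 f -> (H1norm Om f <= e%:E)%E -> nrm 2 f <= e /\ semi f <= e.
Proof.
move=> hf; rewrite H1normE// lee_fin => H; split; apply: le_trans H.
- by rewrite -{1}(ger0_norm (nrm_ge0 Om 2 f)) -sqrtr_sqr ler_wsqrtr// lerDl sqr_ge0.
- rewrite -{1}(ger0_norm (semi_ge0 f)) -sqrtr_sqr ler_wsqrtr// lerDr sqr_ge0//.
Qed.

Lemma smooth_bdf f : smooth f -> bdf Om f.
Proof.
move=> sf; have [M M0 fM] := smooth_bounded bOm sf.
apply: (bdf_bounded _ M0) => //; apply: measurable_funTS.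
by apply: continuous_measurable_rV; exact: smooth_continuous.
Qed.

Lemma smooth_wgrad f : smooth f -> [/\ weak_grad Om f (wgrad Om f),
  {ae leb d, forall x, Om x -> wgrad Om f x = grad f x} & vbdf Om (wgrad Om f)].
Proof.
move=> sf; have [wf wE] := wgradP oOm (weak_grad_smooth oOm bOm sf); split => //.
move=> i; apply: (@bdf_le _ _ _ _ (partial i f)); first exact: vmeas_wgrad wf _.
  by apply: smooth_bdf; exact: smooth_partial.
by apply: filterS wE => x /[apply] ->; rewrite mxE.
Qed.

Lemma smooth_H1 f : smooth f -> H1 f.
Proof.
move=> sf; have [wf _ bw] := smooth_wgrad sf.
by apply: H1_bdf => //; exact: smooth_bdf.
Qed.

Lemma H10_approx c : H10 Om c -> H1 c /\ forall e : R, 0 < e ->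
  exists2 phi, test_function Om phi & exists dl, [/\ dl = c \- phi, H1 dl, nrm 2 dl <= e & semi dl <= e].
Proof.
move=> [/W1_H1 hc H]; split => // e e0; have [phi tphi le] := H _ e0.
exists phi; first exact: tphi.
have [dl dlE] : {dl | dl = c \- phi} by exists (c \- phi).
rewrite -dlE in le; exists dl.
have sphi : smooth phi by case: tphi.
have hd : H1 dl by exact: (H1B dlE hc (smooth_H1 sphi)).1.
by have [n1 n2] := H1norm_ge hd le.
Qed.

Lemma testB phi psi : test_function Om phi -> test_function Om psi ->
  test_function Om (phi \- psi).
Proof.
move=> [s1 c1 O1] [s2 c2 O2].
have sub : closure [set x | (phi \- psi) x != 0] `<=`
    closure [set x | phi x != 0] `|` closure [set x | psi x != 0].
  rewrite -closureU; apply: closureS => x /=; have [->|] := eqVneq (phi x) 0; last by left.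
  by rewrite sub0r oppr_eq0; right.
split.
- rewrite (_ : phi \- psi = phi \+ (cst (-1) \* psi))%R; last first.
    by apply/funext => x /=; rewrite mulN1r.
  by apply: smoothD => //; apply: smoothM => //; exact: smooth_cst.
- by apply: (subclosed_compact _ _ sub); [exact: closed_closure|exact: compactU].
- by move=> x /sub[/O1|/O2].
Qed.

Lemma H10B f g h : h = f \- g -> H10 Om f -> H10 Om g -> H10 Om h.
Proof.
move=> hE hf hg; have [Hf af] := H10_approx hf; have [Hg ag] := H10_approx hg.
have [Hh nh] := H1B hE Hf Hg.
split.
  have [I1 w1 G1] := Hh; split; [exact: I1 | exists (wgrad Om h); first exact: w1].
  split; last by case: G1.
  by apply: vmeas_measurable_fun; [exact: mOm | exact: vmeas_wgrad w1].
(* Two approximations, each counted in the L^2 norm and in the seminorm, make four contributions of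
   at most e / 4. *)
move=> e e0; have e4 : 0 < e / 4 by rewrite divr_gt0.
have [phi tphi [d1 [d1E H1d1 n1 s1]]] := af _ e4.
have [psi tpsi [d2 [d2E H1d2 n2 s2]]] := ag _ e4.
exists (phi \- psi); first exact: testB.
have [dd ddE] : {dd | dd = d1 \- d2} by exists (d1 \- d2).
rewrite (_ : _ \- _ = dd)%R; last first.
  by rewrite ddE d1E d2E hE; apply/funext => x /=; ring.
have [HB nB] := H1B ddE H1d1 H1d2; apply: le_trans (H1norm_le HB) _.
have [I1 _ G1] := H1d1; have [I2 _ G2] := H1d2.
have [_ l1] := nrm2B ddE I1 I2; have [_ l2] := nB 2 le12 G1 G2.
rewrite lee_fin; rewrite -!semiE in l2; lra.
Qed.

Lemma int_le2M (f g h : E -> R) (M : R) : 0 <= M -> measurable_fun Om f ->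
  inLp 2%:E Om g -> inLp 2%:E Om h ->
  {ae leb d, forall x, Om x -> `|f x| <= M * (`|g x| * `|h x|)} ->
  (leb d).-integrable Om (EFin \o f) /\ `|int f| <= M * (nrm 2 g * nrm 2 h).
Proof.
move=> M0 mf Ig Ih fM; have [IMg nMg] := nrmZ mOm M (ltr0n _ 2) Ig.
rewrite mulrA -(ger0_norm M0) -nMg; apply: int_le2 => //; first by field.
by apply: filterS fM => x /[apply]; rewrite normrM (ger0_norm M0) mulrA.
Qed.

Section bform.
Variables (b : E -> R) (w : E -> E).
Hypotheses (bb : bdf Om b) (bw : vbdf Om w).

Local Notation bform := (bform Om b w).

Lemma bform_bound : exists2 M : R, 0 <= M & forall c s, H1 c -> inLp 2%:E Om s ->
  [/\ (leb d).-integrable Om (EFin \o (fun x => b x * c x * s x)),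
      (leb d).-integrable Om (EFin \o (fun x => dot (w x) (wgrad Om c x) * s x)) &
      `|bform c s| <= M * (nrm 2 c + semi c) * nrm 2 s].
Proof.
have [mb [M M0 bM]] := bb; have [mew [N N0 wN]] := bdf_enorm bw.
exists (M + N); first exact: addr_ge0.
move=> c s [Ic wc Gc] Is.
have mc : measurable_fun Om c by case: Ic.
have ms : measurable_fun Om s by case: Is.
have [I1 n1] : (leb d).-integrable Om (EFin \o (fun x => b x * c x * s x)) /\
    `|int (fun x => b x * c x * s x)| <= M * (nrm 2 c * nrm 2 s).
  apply: int_le2M => //; first by apply: measurable_funM => //; exact: measurable_funM.
  apply: filterS bM => x /[apply] H; rewrite !normrM -mulrA ler_wpM2r//.
have [I2 n2] : (leb d).-integrable Om (EFin \o (fun x => dot (w x) (wgrad Om c x) * s x)) /\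
    `|int (fun x => dot (w x) (wgrad Om c x) * s x)| <= N * (semi c * nrm 2 s).
  rewrite semiE.
  apply: int_le2M => //.
    by apply: measurable_funM => //; apply: measurable_dot; [exact: vbdf_vmeas|exact: vmeas_wgrad wc].
  apply: filterS wN => x /[apply] H; rewrite normrM mulrA ler_wpM2r//.
  rewrite (le_trans (cauchy_schwarz _ _))// /gnorm (ger0_norm (enorm_ge0 (wgrad _ _ _))).
  by rewrite ler_wpM2r ?enorm_ge0// (le_trans _ H)// ler_norm.
split => //; rewrite !bform_def RintegralD// (le_trans (ler_normD _ _))//.
rewrite (le_trans (lerD n1 n2))//.
have h1 := mulr_ge0 N0 (mulr_ge0 (nrm_ge0 Om 2 c) (nrm_ge0 Om 2 s)).
have h2 := mulr_ge0 M0 (mulr_ge0 (semi_ge0 c) (nrm_ge0 Om 2 s)).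
lra.
Qed.

Lemma bformE c s : H1 c -> inLp 2%:E Om s ->
  bform c s = int (fun x => b x * c x * s x) + int (fun x => dot (w x) (wgrad Om c x) * s x).
Proof.
by move=> hc Is; have [M _ H] := bform_bound; have [? ? _] := H _ _ hc Is; rewrite bform_def RintegralD.
Qed.

Lemma bform_integrable c s : H1 c -> inLp 2%:E Om s -> (leb d).-integrable Om
  (EFin \o (fun x => b x * c x * s x + dot (w x) (wgrad Om c x) * s x)).
Proof.
move=> hc Is; have [M _ H] := bform_bound; have [i1 i2 _] := H _ _ hc Is.
by have := integrableD mOm i1 i2; apply: eq_integrable.
Qed.

Lemma bformBr c s t h : h = s \- t -> H1 c -> inLp 2%:E Om s -> inLp 2%:E Om t ->
  bform c h = bform c s - bform c t.
Proof.
move=> hE hc Is It.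
have i1 := bform_integrable hc Is; have i2 := bform_integrable hc It.
rewrite !bform_def -(RintegralB mOm i1 i2) hE.
by apply: eq_Rintegral => x _ /=; ring.
Qed.

Lemma bformBl c s t h : h = c \- s -> H1 c -> H1 s -> inLp 2%:E Om t ->
  bform h t = bform c t - bform s t.
Proof.
move=> hE hc hs It; have [hB _] := H1B hE hc hs.
have i1 := bform_integrable hc It; have i2 := bform_integrable hs It.
rewrite !bform_def -(RintegralB mOm i1 i2).
have /integrableP[/measurable_EFinP m1 _] := bform_integrable hB It.
have /integrableP[/measurable_EFinP m2 _] := i1.
have /integrableP[/measurable_EFinP m3 _] := i2.
have [_ wc _] := hc; have [_ ws _] := hs.
apply: ae_eq_Rintegral; [exact: mOm | exact: m1 | exact: measurable_funB |].
have := wgradB oOm wc ws; rewrite -hE; apply: filterS => x /[apply] ->.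
by rewrite dotBr hE /=; ring.
Qed.

(** Density of test functions and continuity of the form: with c = phi + dl, the value at (c, c) is
    B(dl, c) + B(phi, dl), because B(phi, phi) = 0. *)
Lemma bform_H10_eq0 c : (forall phi, test_function Om phi -> bform phi phi = 0) ->
  H10 Om c -> bform c c = 0.
Proof.
move=> H0 /H10_approx[hc ac]; have [M M0 HM] := bform_bound.
have [Ic _ _] := hc.
apply/eqP; rewrite -normr_eq0 eq_le normr_ge0 andbT.
(* Bounds the coefficient of [a] in |B(dl, c)| + |B(phi, dl)|; there the norms of [phi] exceed those
   of [c] by at most 2 in total because [a <= 1]. *)
set K := M * (4 + 3 * nrm 2 c + 2 * semi c).
have K0 : 0 <= K.
  by rewrite mulr_ge0// addr_ge0 ?mulr_ge0 ?nrm_ge0 ?semi_ge0// addr_ge0// mulr_ge0// nrm_ge0.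
apply/ler_addgt0Pr => e e0; rewrite add0r.
pose a := Num.min 1 (e / (K + 1)).
have K1 : 0 < K + 1 by rewrite ltr_wpDl.
have a0 : 0 < a by rewrite lt_min ltr01 divr_gt0.
have a1 : a <= 1 by rewrite ge_min lexx.
have aK : a * (K + 1) <= e by rewrite -ler_pdivlMr// ge_min lexx orbT.
have [phi tphi [dl [dlE hB n1 n2]]] := ac _ a0.
have hp : H1 phi by apply: smooth_H1; case: tphi.
have [Ip _ _] := hp; have [IB _ _] := hB.
have e1 : bform c c = bform dl c + bform phi dl.
  by rewrite (bformBl dlE hc hp Ic) (bformBr dlE hp Ic Ip) (H0 _ tphi); ring.
have [_ _ l1] := HM _ _ hB Ic; have [_ _ l2] := HM _ _ hp IB.
have pE : phi = c \- dl by rewrite dlE; apply/funext => x /=; ring.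
have np : nrm 2 phi + semi phi <= nrm 2 c + semi c + 2.
  have [_ k1] := nrm2B pE Ic IB; have [_ _ Gc] := hc; have [_ _ GB] := hB.
  have [_ k2] := (H1B pE hc hB).2 2 le12 Gc GB.
  rewrite -!semiE in k2; lra.
rewrite e1 (le_trans (ler_normD _ _))// (le_trans (lerD l1 l2))//.
apply: le_trans aK.
have q1 : M * (nrm 2 dl + semi dl) * nrm 2 c <= M * (2 * a) * nrm 2 c.
  by rewrite ler_wpM2r ?nrm_ge0// ler_wpM2l//; lra.
have q2 : M * (nrm 2 phi + semi phi) * nrm 2 dl <= M * (nrm 2 c + semi c + 2) * a.
  apply: ler_pM; rewrite ?nrm_ge0//; first by rewrite mulr_ge0// addr_ge0 ?nrm_ge0 ?semi_ge0.
  by rewrite ler_wpM2l.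
have q3 := mulr_ge0 (mulr_ge0 (ltW a0) M0) (nrm_ge0 Om 2 c).
have q4 := mulr_ge0 (mulr_ge0 (ltW a0) M0) (semi_ge0 c).
have q5 := mulr_ge0 (ltW a0) M0.
rewrite /K; lra.
Qed.

(** Polarization: the form vanishes on the diagonal at c, at s and at c - s. *)
Lemma bform_antisym c s : (forall phi, test_function Om phi -> bform phi phi = 0) ->
  H10 Om c -> H10 Om s -> bform c s = - bform s c.
Proof.
move=> H0 hc hs; have [h hE] : {h | h = c \- s} by exists (c \- s).
have z := bform_H10_eq0 H0 (H10B hE hc hs).
have [Hc _] := H10_approx hc; have [Hs _] := H10_approx hs.
have [Ic _ _] := Hc; have [Is _ _] := Hs.
have [HB _] := H1B hE Hc Hs; have [IB _ _] := HB.
rewrite (bformBl hE Hc Hs IB) (bformBr hE Hc Ic Is) (bformBr hE Hs Ic Is) in z.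
rewrite (bform_H10_eq0 H0 hc) (bform_H10_eq0 H0 hs) in z; lra.
Qed.

End bform.

(** The integrand is half of div(w phi^2), and its integral is zero by testing the weak gradient of
    each component of w with phi^2. *)
Lemma bform_div_test (w : E -> E) phi : vbdf Om w ->
  (forall i, weak_grad Om (fun x => w x ord0 i) (wgrad Om (fun x => w x ord0 i))) ->
  bdf Om (wdiv Om w) -> test_function Om phi ->
  bform Om (fun x => 2^-1 * wdiv Om w x) w phi phi = 0.
Proof.
move=> bw ww bd tphi; have [sphi _ _] := tphi.
have tpp := testM tphi sphi.
have [_ wE _] := smooth_wgrad sphi.
have hphi := smooth_H1 sphi; have [Iphi _ _] := hphi.
have bb : bdf Om (fun x => 2^-1 * wdiv Om w x) by bdf_tac.
pose F i x := w x ord0 i * partial i (phi \* phi)%R x +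
  wgrad Om (fun x => w x ord0 i) x ord0 i * (phi x * phi x).
have iF i : (leb d).-integrable Om (EFin \o F i) /\ int (F i) = 0.
  have [l1 /(_ i) l2 /(_ _ tpp i) l3] := ww i.
  have i1 := loc_test_integrable oOm l1 (test_partial i tpp).
  have i2 := loc_test_integrable oOm l2 tpp.
  split; first by have := integrableD mOm i1 i2; apply: eq_integrable.
  by rewrite RintegralD//= l3 addNr.
have [iS ES] := Rintegral_sum mOm (fun i => (iF i).1).
have : int (fun x => 2^-1 * \sum_i F i x) = 0.
  by rewrite RintegralZl// ES big1 ?mulr0// => i _; exact: (iF i).2.
rewrite bform_def; apply: etrans.
have /integrableP[/measurable_EFinP m1 _] := bform_integrable bb bw hphi Iphi.
have /integrableP[/measurable_EFinP m2 _] := iS.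
apply: ae_eq_Rintegral => //; first exact: measurable_funM.
apply: filterS wE => x /[apply] ->.
rewrite /dot mulr_suml /wdiv mulr_sumr !mulr_suml -big_split/= mulr_sumr.
apply: eq_bigr => i _; rewrite /F.
have -> : partial i (phi \* phi)%R x = phi x * partial i phi x + phi x * partial i phi x.
  have Dp := smooth_is_derive i x sphi.
  have [_ E1] := is_deriveM Dp Dp; rewrite /partial; apply: etrans E1 _.
  by [].
rewrite /grad mxE; by field.
Qed.

End H10_theory.

(** * Discrete functions and residuals *)

Lemma partial_affine {R : realType} {d : nat} (l : 'rV[R]_d -> R) a b i x :
  (forall x, l x = dot a x + b) -> partial i l x = a ord0 i.
Proof.
move=> lE; rewrite /partial /derive; apply/cvg_lim => //.
apply: (@cvg_trans _ (cst (a ord0 i) @ 0^')); last exact: cvg_cst.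
apply: near_eq_cvg; near=> t.
have t0 : t != 0 by near: t; exact: nbhs_dnbhs_neq.
rewrite /= !lE dotDr dotZr opprD addrACA subrr addr0 addrK.
rewrite (_ : dot a (delta_mx ord0 i) = a ord0 i); last first.
  rewrite /dot (bigD1 i)//= big1 ?addr0; first by rewrite mxE !eqxx mulr1.
  by move=> j ji; rewrite mxE (negbTE ji) andbF mulr0.
by rewrite [RHS]mulrA mulVf// mul1r.
Unshelve. all: end_near. Qed.

Section discrete.
Context {R : realType} {d : nat}.
Local Notation E := 'rV[R]_d.
Variables (Om : set E) (T : {fset {fset E}}).
Hypotheses (d0 : (0 < d)%N) (oOm : open Om) (bOm : bounded_set Om).
Hypothesis triT : triangulation Om T.
Implicit Types (x y : E) (q c : E -> R) (v : E -> E).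

Let mOm : measurable Om. Proof. exact: open_measurable_rV. Qed.

Lemma Xh_smooth v i : Xh Om T v -> pw_smooth T (fun x => v x ord0 i).
Proof. by case=> _ Pv; apply: P_on_smooth => k /Pv. Qed.

Lemma CP1_smooth q : CP1 Om T q -> pw_smooth T q.
Proof. by case=> _; exact: P1_on_smooth. Qed.

Lemma Xh_facts v : Xh Om T v -> [/\ vbdf Om v,
  forall i, weak_grad Om (fun x => v x ord0 i) (wgrad Om (fun x => v x ord0 i)),
  bdf Om (wdiv Om v) &
  {ae leb d, forall x, Om x -> wdiv Om v x = div v x}].
Proof.
move=> Xv; have pv i := Xh_smooth i Xv.
have H i := pw_wgrad d0 oOm bOm triT (pv i).
split.
- by move=> i; exact: (pw_smooth_bdf oOm bOm triT (pv i)).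
- by move=> i; case: (H i).
- by apply: bdf_sum => i; case: (H i).
- have : {ae leb d, forall x, forall i : 'I_d, Om x ->
      wgrad Om (fun x => v x ord0 i) x = grad (fun x => v x ord0 i) x}.
    by apply: filter_forall => i; case: (H i) => _ + _; apply: filterS => x /[apply] -[].
  by apply: filterS => x Hx Ox; apply: eq_bigr => i _; rewrite (Hx i Ox) mxE.
Qed.

Lemma CP1_facts q : CP1 Om T q -> [/\ bdf Om q, weak_grad Om q (wgrad Om q),
  vbdf Om (wgrad Om q) & {ae leb d, forall x, Om x -> wgrad Om q x = grad q x}].
Proof.
move=> /CP1_smooth pq; have [wq gq bq] := pw_wgrad d0 oOm bOm triT pq; split => //.
- exact: (pw_smooth_bdf oOm bOm triT pq).
- by apply: filterS gq => x /[apply] -[].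
Qed.

Lemma affineB (l1 l2 : E -> R) : affine l1 -> affine l2 -> affine (l1 \- l2).
Proof.
move=> [a1 [b1 E1]] [a2 [b2 E2]]; exists (a1 - a2), (b1 - b2) => x /=.
by rewrite E1 E2 dotBl; ring.
Qed.

Lemma CP1B c q h : h = c \- q -> CP1 Om T c -> CP1 Om T q -> CP1 Om T h.
Proof.
move=> -> [c1 P1] [c2 P2]; split.
  by move=> x; apply: cvgB; [exact: c1|exact: c2].
move=> k kT; have [l1 a1 E1] := P1 k kT; have [l2 a2 E2] := P2 k kT.
by exists (l1 \- l2); [exact: affineB | move=> x hx /=; rewrite E1// E2].
Qed.

Lemma YhB c q h : h = c \- q -> Yh Om T c -> Yh Om T q -> Yh Om T h.
Proof.
move=> hE [c1 h1] [c2 h2]; split; first exact: CP1B hE c1 c2.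
exact: H10B hE h1 h2.
Qed.

Lemma XhB u v : Xh Om T u -> Xh Om T v -> Xh Om T (fun x => u x - v x).
Proof.
move=> [c1 P1] [c2 P2]; split.
  by move=> x; apply: cvgB; [exact: c1|exact: c2].
move=> k kT i; have [l1 a1 [b1 E1]] := P1 k kT i; have [l2 a2 [b2 E2]] := P2 k kT i.
exists (l1 \- l2); first exact: affineB.
by exists (b1 - b2) => x hx; rewrite !mxE E1// E2//=; ring.
Qed.

Lemma Lp_elts p f : 1 <= p -> measurable_fun Om f ->
  (Lp p%:E Om f <= \sum_(k <- T) Lp p%:E (Om `&` elt k) f)%E.
Proof.
move=> p1 mf; apply: Lp_cover => //.
  by move=> k; apply: open_measurable_rV; exact: open_interior.
apply: filterS (ae_elts d0 triT) => x /[apply] -[k kT ek].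
by rewrite -bigcup_seq; exists k.
Qed.

Lemma smooth_elt_measurable k (f P : E -> R) : smooth P -> (forall x, elt k x -> f x = P x) ->
  measurable_fun (elt k) f.
Proof.
move=> sP fP; apply: (@eq_measurable_fun _ _ _ _ _ P).
  by move=> x; rewrite inE => /fP.
by apply: measurable_funTS; apply: continuous_measurable_rV; exact: smooth_continuous.
Qed.

Lemma div_measurable k v : k \in T -> Xh Om T v -> measurable_fun (elt k) (div v).
Proof.
move=> kT Xv; apply: measurable_sum => i; have [P sP vP] := Xh_smooth i Xv kT.
apply: (smooth_elt_measurable (smooth_partial i sP)) => x ex.
exact: (pw_smooth_partial i vP sP ex).
Qed.

Lemma CP1_grad_elt k c : k \in T -> CP1 Om T c ->
  (exists a : E, forall x, elt k x -> grad c x = a) /\ (forall x, elt k x -> lap c x = 0).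
Proof.
move=> kT [_ /(_ k kT)[l al cl]]; have sl := smooth_affine al; have [a [b lE]] := al.
have pE i x : elt k x -> partial i c x = a ord0 i.
  by move=> ex; rewrite (pw_smooth_partial i cl sl ex) (partial_affine i x lE).
split; first by exists a => x ex; apply/rowP => i; rewrite mxE pE.
move=> x ex; rewrite /lap big1// => i _.
have H : is_derive x (delta_mx ord0 i : E) (partial i c) 0.
  apply: (near_eq_is_derive _ (is_derive_cst (a ord0 i) x (delta_mx ord0 i : E))).
  have : \forall y \near x, elt k y by apply: open_nbhs_nbhs; split => //; exact: open_interior.
  by apply: filterS => y ey; rewrite pE.
by case: H.
Qed.

Section residual.
Variables (D : data R d) (gh : E -> R) (u : E -> E) (c : E -> R) (b : R).
Hypotheses (Xu : Xh Om T u) (cc : CP1 Om T c) (mg : measurable_fun Om (g D)).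
Hypothesis pgh : piecewise_constant T gh.
Hypotheses (b0 : 0 <= b) (hb : forall k, k \in T -> b <= diam (hull k)).

(** The volume residual of the concentration equation inside the elements, where the Laplacian of a
    piecewise affine [c] vanishes; it contains [g] itself and not its approximation. *)
Definition residual x := g D x - dot (u x) (wgrad Om c x)
  - 2^-1 * wdiv Om u x * c x - r0 D * c x.

Lemma measurable_residual : measurable_fun Om residual.
Proof.
have [bu _ bd _] := Xh_facts Xu; have [bc _ bg _] := CP1_facts cc.
have m2 : bdf Om (fun x => dot (u x) (wgrad Om c x)) by exact: bdf_dot.
have m3 : bdf Om (fun x => 2^-1 * wdiv Om u x * c x) by bdf_tac.
have m4 : bdf Om (fun x => r0 D * c x) by bdf_tac.
by do 3 ?[apply: measurable_funB => //]; first [exact: m2.1|exact: m3.1|exact: m4.1].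
Qed.

(** [b] is a common lower bound of the diameters, later [beta0 * h]. The nonnegative jump terms of
    [etaD1] are dropped, and exchanging [gh] for [g] costs the oscillation term. *)
Lemma residual_le : (b%:E * Lp 2%:E Om residual <=
  \sum_(k <- T) (etaD1 D Om k gh u c + (diam (hull k))%:E * Lp 2%:E (elt k) (g D \- gh)%R))%E.
Proof.
have [bu _ bd dE] := Xh_facts Xu; have [bc _ bg gE] := CP1_facts cc.
have p0 : (0 : R) < 2 by [].
apply: (@le_trans _ _ (b%:E * \sum_(k <- T) Lp 2%:E (Om `&` elt k) residual)%E).
  apply: lee_wpmul2l; first by rewrite lee_fin.
  by apply: Lp_elts; [rewrite ler1n|exact: measurable_residual].
rewrite ge0_sume_distrr; last by move=> k _; exact: Lp_ge0.
rewrite big_seq [leRHS]big_seq; apply: lee_sum => k kT.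
have [[a aE] lap0] := CP1_grad_elt kT cc; have [gk gkE] := pgh kT.
have mk : measurable (Om `&` elt k).
  by apply: measurableI => //; apply: open_measurable_rV; exact: open_interior.
have sk : Om `&` elt k `<=` elt k by move=> x [].
have sO : Om `&` elt k `<=` Om by move=> x [].
set r1 := (fun x => alpha D * lap c x - dot (u x) (grad c x) - 2^-1 * div u x * c x
     - r0 D * c x + gh x).
have mdiv : measurable_fun (Om `&` elt k) (div u).
  by apply: measurable_funS (div_measurable kT Xu) => //; apply: open_measurable_rV; exact: open_interior.
have mc : measurable_fun (Om `&` elt k) c by apply: measurable_funS bc.1.
have mgh : measurable_fun (Om `&` elt k) gh.
  by apply: (@eq_measurable_fun _ _ _ _ _ (cst gk)) => // x; rewrite inE => -[_ /gkE].
have mr1 : measurable_fun (Om `&` elt k) r1.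
  apply: measurable_funD => //; apply: measurable_funB; last first.
    by apply: measurable_funM.
  apply: measurable_funB; last by apply: measurable_funM => //; exact: measurable_funM.
  apply: (@eq_measurable_fun _ _ _ _ _ (fun x => - dot (u x) a)).
    by move=> x; rewrite inE => -[_ ex]; rewrite lap0// aE// mulr0 sub0r.
  apply: measurableT_comp => //; apply: measurable_sum => i; apply: measurable_funM => //.
  by apply: measurable_funS (bu i).1.
have mgg : measurable_fun (Om `&` elt k) (g D \- gh).
  by apply: measurable_funB => //; apply: measurable_funS mg.
have H1 : (Lp 2%:E (Om `&` elt k) residual <= Lp 2%:E (elt k) r1 + Lp 2%:E (elt k) (g D \- gh)%R)%E.
  apply: (@le_trans _ _ (Lp 2%:E (Om `&` elt k) (r1 \+ (g D \- gh))%R)).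
    apply: Lp_le => //.
    - by apply: measurable_funS measurable_residual.
    - exact: measurable_funD.
    - apply: filterS2 dE gE => x dE gE [Ox ex].
      rewrite /residual (dE Ox) (gE Ox) /r1 /= (lap0 _ ex).
      rewrite le_eqVlt; apply/orP; left; apply/eqP; congr (Num.norm _); ring.
  apply: le_trans (Lp_triangle _ mk mr1 mgg) _; first by rewrite lee_fin ler1n.
  by apply: leeD; exact: Lp_subset.
have dk0 : 0 <= diam (hull k) by rewrite (le_trans b0)// hb.
apply: (@le_trans _ _ ((diam (hull k))%:E * (Lp 2%:E (elt k) r1 + Lp 2%:E (elt k) (g D \- gh)%R))%E).
  apply: (@le_trans _ _ ((diam (hull k))%:E * Lp 2%:E (Om `&` elt k) residual)%E).
    by apply: lee_wpmul2r; [exact: Lp_ge0|rewrite lee_fin hb].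
  by apply: lee_wpmul2l.
rewrite ge0_muleDr ?Lp_ge0//; apply: leeD => //.
rewrite /etaD1 leeDl//; apply: mule_ge0 => //; apply: sume_ge0 => e0 _.
by apply: mule_ge0; [rewrite lee_fin powR_ge0|exact: poweR_ge0].
Qed.

(** Only the volume part of [etaD3] is kept, the face terms being nonnegative. *)
Lemma divergence_le : (b%:E * Lp 3%:E Om (wdiv Om u) <= \sum_(k <- T) etaD3 Om k u)%E.
Proof.
have [bu _ bd dE] := Xh_facts Xu.
apply: (@le_trans _ _ (b%:E * \sum_(k <- T) Lp 3%:E (Om `&` elt k) (wdiv Om u))%E).
  apply: lee_wpmul2l; first by rewrite lee_fin.
  by apply: Lp_elts; [rewrite ler1n|exact: bd.1].
rewrite ge0_sume_distrr; last by move=> k _; exact: Lp_ge0.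
rewrite big_seq [leRHS]big_seq; apply: lee_sum => k kT.
have mk : measurable (Om `&` elt k).
  by apply: measurableI => //; apply: open_measurable_rV; exact: open_interior.
have H1 : (Lp 3%:E (Om `&` elt k) (wdiv Om u) <= Lp 3%:E (elt k) (div u))%E.
  apply: (@le_trans _ _ (Lp 3%:E (Om `&` elt k) (div u))).
    apply: Lp_le => //.
    - by apply: measurable_funS bd.1 => // x [].
    - apply: measurable_funS (div_measurable kT Xu); last by move=> x [].
      by apply: open_measurable_rV; exact: open_interior.
    - by apply: filterS dE => x dE [Ox _]; rewrite dE.
  by apply: Lp_subset => // x [].
have dk0 : 0 <= diam (hull k) by rewrite (le_trans b0)// hb.
apply: (@le_trans _ _ ((diam (hull k))%:E * Lp 3%:E (elt k) (div u))%E).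
  by apply: lee_pmul; [rewrite lee_fin|exact: Lp_ge0|rewrite lee_fin hb|].
rewrite /etaD3 leeDl//; apply: sume_ge0 => e0 _.
by apply: mule_ge0; [rewrite lee_fin powR_ge0|exact: poweR_ge0].
Qed.

End residual.

End discrete.

(** * Discrete concentrations *)

HB.lock Definition ip {R : realType} {d : nat} (Om : set 'rV[R]_d)
  (u v : 'rV[R]_d -> 'rV[R]_d) : R := \int[leb d]_(x in Om) dot (u x) (v x).

HB.lock Definition ip1 {R : realType} {d : nat} (Om : set 'rV[R]_d)
  (f g : 'rV[R]_d -> R) : R := \int[leb d]_(x in Om) (f x * g x).

HB.lock Definition vnrm {R : realType} {d : nat} (Om : set 'rV[R]_d) (p : R)
  (v : 'rV[R]_d -> 'rV[R]_d) : R := nrm Om p (fun x => enorm (v x)).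

HB.lock Definition tform {R : realType} {d : nat} (Om : set 'rV[R]_d)
  (w : 'rV[R]_d -> 'rV[R]_d) (c s : 'rV[R]_d -> R) : R :=
  \int[leb d]_(x in Om) (dot (w x) (wgrad Om c x) * s x).

HB.lock Definition cform {R : realType} {d : nat} (Om : set 'rV[R]_d)
  (w : 'rV[R]_d -> 'rV[R]_d) (c s : 'rV[R]_d -> R) : R :=
  bform Om (fun x => 2^-1 * wdiv Om w x) w c s.

Section inner_products.
Context {R : realType} {d : nat}.
Local Notation E := 'rV[R]_d.
Variable Om : set E.
Hypotheses (mOm : measurable Om) (fOm : (leb d Om < +oo)%E).
Implicit Types (f g h : E -> R) (u v w : E -> E).
Local Notation nrm := (nrm Om).
Local Notation vnrm := (vnrm Om).
Local Notation ip := (ip Om).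
Local Notation ip1 := (ip1 Om).
Local Notation "'int' f" := (Rintegral (leb d) Om f) (at level 10, f at level 9).

Lemma vnrmE p v : vnrm p v = nrm p (fun x => enorm (v x)).
Proof. by rewrite unlock. Qed.

Lemma ipE u v : ip u v = int (fun x => dot (u x) (v x)).
Proof. by rewrite ip.unlock. Qed.

Lemma ip1E f g : ip1 f g = int (fun x => f x * g x).
Proof. by rewrite unlock. Qed.

Lemma vnrm_ge0 p v : 0 <= vnrm p v.
Proof. by rewrite vnrmE nrm_ge0. Qed.

Definition vL2 u := vmeas Om u /\ inLp 2%:E Om (fun x => enorm (u x)).

Lemma vbdf_vL2 u : vbdf Om u -> vL2 u.
Proof.
move=> bu; split; first exact: vbdf_vmeas.
by apply: nrm_bdf => //; exact: bdf_enorm.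
Qed.

Lemma vLpE p u : inLp p%:E Om (fun x => enorm (u x)) -> vLp p%:E Om u = (vnrm p u)%:E.
Proof. by move=> Iu; rewrite vnrmE -LpnE. Qed.

Lemma vnrm_le (f : E -> R) u : vmeas Om u -> inLp 2%:E Om f ->
  {ae leb d, forall x, Om x -> enorm (u x) <= `|f x|} -> vL2 u /\ vnrm 2 u <= nrm 2 f.
Proof.
move=> mu If uf; rewrite vnrmE.
have [|I1 n1] := nrm_le mOm (ltr0n _ 2) (measurable_enorm mu) If.
  by apply: filterS uf => x uf /uf {}uf; rewrite ger0_norm ?enorm_ge0.
by split.
Qed.

Lemma vL2D u v : vL2 u -> vL2 v ->
  vL2 (fun x => u x + v x) /\ vnrm 2 (fun x => u x + v x) <= vnrm 2 u + vnrm 2 v.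
Proof.
move=> [mu Iu] [mv Iv]; have [I1 n1] := nrmD mOm (ler1n R 2) Iu Iv.
have [L n2] : vL2 (fun x => u x + v x) /\
    vnrm 2 (fun x => u x + v x) <= nrm 2 ((fun x => enorm (u x)) \+ (fun x => enorm (v x))).
  apply: vnrm_le; [exact: vmeasD|exact: I1|].
  by apply: aeW => x _ /=; rewrite ger0_norm ?addr_ge0 ?enorm_ge0// enormD.
by split => //; rewrite !vnrmE in n2 *; exact: le_trans n1.
Qed.

Lemma vL2B u v : vL2 u -> vL2 v ->
  vL2 (fun x => u x - v x) /\ vnrm 2 (fun x => u x - v x) <= vnrm 2 u + vnrm 2 v.
Proof.
move=> [mu Iu] [mv Iv]; have [I1 n1] := nrmD mOm (ler1n R 2) Iu Iv.
have [L n2] : vL2 (fun x => u x - v x) /\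
    vnrm 2 (fun x => u x - v x) <= nrm 2 ((fun x => enorm (u x)) \+ (fun x => enorm (v x))).
  apply: vnrm_le; [exact: vmeasB|exact: I1|].
  apply: aeW => x _ /=; rewrite ger0_norm ?addr_ge0 ?enorm_ge0//.
  by rewrite (le_trans (enormD _ _))// enormN.
by split => //; rewrite !vnrmE in n2 *; exact: le_trans n1.
Qed.

Lemma ip_le u v : vL2 u -> vL2 v ->
  (leb d).-integrable Om (EFin \o (fun x => dot (u x) (v x))) /\
  `|ip u v| <= vnrm 2 u * vnrm 2 v.
Proof.
move=> [mu Iu] [mv Iv]; rewrite ipE !vnrmE; apply: int_le2 => //; first by field.
  exact: measurable_dot.
by apply: aeW => x _; rewrite !(ger0_norm (enorm_ge0 _)) cauchy_schwarz.
Qed.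

Lemma ip_sq u : vL2 u -> ip u u = vnrm 2 u ^+ 2.
Proof.
move=> [_ Iu]; rewrite vnrmE -(nrm2_sq mOm Iu).2 ipE; apply: eq_Rintegral => x _.
by rewrite -sqr_enorm expr2.
Qed.

Lemma ipBl u v w : vL2 u -> vL2 v -> vL2 w ->
  ip (fun x => u x - v x) w = ip u w - ip v w.
Proof.
move=> Lu Lv Lw; have [i1 _] := ip_le Lu Lw; have [i2 _] := ip_le Lv Lw.
by rewrite !ipE -RintegralB//; apply: eq_Rintegral => x _; rewrite dotBl.
Qed.

Lemma ipBr u v w : vL2 u -> vL2 v -> vL2 w ->
  ip w (fun x => u x - v x) = ip w u - ip w v.
Proof.
move=> Lu Lv Lw; have [i1 _] := ip_le Lw Lu; have [i2 _] := ip_le Lw Lv.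
by rewrite !ipE -RintegralB//; apply: eq_Rintegral => x _; rewrite dotBr.
Qed.

Lemma ip1_le f g : inLp 2%:E Om f -> inLp 2%:E Om g ->
  (leb d).-integrable Om (EFin \o (fun x => f x * g x)) /\
  `|ip1 f g| <= nrm 2 f * nrm 2 g.
Proof.
move=> If Ig; rewrite ip1E; apply: int_le2 => //; first by field.
  by apply: measurable_funM; [case: If|case: Ig].
by apply: aeW => x _; rewrite normrM.
Qed.

Lemma ip1_sq f : inLp 2%:E Om f -> ip1 f f = nrm 2 f ^+ 2.
Proof. by move=> If; rewrite ip1E (nrm2_sq mOm If).2. Qed.

Lemma ip1Bl f g h k : k = f \- g -> inLp 2%:E Om f -> inLp 2%:E Om g -> inLp 2%:E Om h ->
  ip1 k h = ip1 f h - ip1 g h.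
Proof.
move=> -> If Ig Ih; have [i1 _] := ip1_le If Ih; have [i2 _] := ip1_le Ig Ih.
by rewrite !ip1E -RintegralB//; apply: eq_Rintegral => x _; rewrite mulrBl.
Qed.

End inner_products.

(** * Energy and error estimates for discrete concentrations *)

Section concentration.
Context {R : realType} {d : nat}.
Local Notation E := 'rV[R]_d.
Variables (Om : set E) (T : {fset {fset E}}) (D : data R d).
Hypotheses (d0 : (0 < d)%N) (oOm : open Om) (bOm : bounded_set Om).
Hypothesis triT : triangulation Om T.
Hypotheses (alpha0 : 0 < alpha D) (r00 : 0 < r0 D) (Ig : inLp 2%:E Om (g D)).
Variables (S2 S6 : R).
Hypotheses (S20 : 0 < S2) (S60 : 0 < S6).
Hypothesis hS2 : forall v, H10 Om v -> nrm Om 2 v <= S2 * semi Om v.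
Hypothesis hS6 : forall v, H10 Om v -> inLp 6%:E Om v /\ nrm Om 6 v <= S6 * semi Om v.
Implicit Types (f c s : E -> R) (u v w : E -> E).
Local Notation nrm := (nrm Om).
Local Notation vnrm := (vnrm Om).
Local Notation ip := (ip Om).
Local Notation ip1 := (ip1 Om).
Local Notation semi := (semi Om).
Local Notation "'int' f" := (Rintegral (leb d) Om f) (at level 10, f at level 9).

Let mOm : measurable Om. Proof. exact: open_measurable_rV. Qed.
Let fOm : (leb d Om < +oo)%E. Proof. exact: leb_bounded_fin. Qed.

Local Notation tform := (tform Om).
Local Notation cform := (cform Om).

Lemma tformE w c s : tform w c s = int (fun x => dot (w x) (wgrad Om c x) * s x).
Proof. by rewrite tform.unlock. Qed.

Lemma cformE u c s : cform u c s = bform Om (fun x => 2^-1 * wdiv Om u x) u c s.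
Proof. by rewrite cform.unlock. Qed.

Lemma Yh_H1 c : Yh Om T c -> H1 Om c /\ H10 Om c.
Proof. by case=> _ hc; split => //; exact: (H10_approx oOm bOm hc).1. Qed.

Lemma H1_vL2 c : H1 Om c -> vL2 Om (wgrad Om c) /\ vnrm 2 (wgrad Om c) = semi c.
Proof.
by move=> [_ wc Gc]; split; [split => //; exact: vmeas_wgrad wc|rewrite vnrmE semiE].
Qed.

Lemma half_wdiv_bdf u : Xh Om T u -> bdf Om (fun x => 2^-1 * wdiv Om u x).
Proof. by move=> /(Xh_facts d0 oOm bOm triT)[_ _ bd _]; bdf_tac. Qed.

Lemma cform_antisym u c s : Xh Om T u -> H10 Om c -> H10 Om s -> cform u c s = - cform u s c.
Proof.
move=> Xu hc hs; have [bu wu bd _] := Xh_facts d0 oOm bOm triT Xu.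
rewrite !cformE; apply: (bform_antisym oOm bOm (half_wdiv_bdf Xu) bu _ hc hs).
by move=> phi tphi; exact: bform_div_test.
Qed.

Lemma cform_diag u c : Xh Om T u -> H10 Om c -> cform u c c = 0.
Proof. by move=> Xu hc; have := cform_antisym Xu hc hc; lra. Qed.

Lemma discrete_concentrationE u c s : Xh Om T u -> discrete_concentration D Om T u c ->
  Yh Om T c -> Yh Om T s ->
  alpha D * ip (wgrad Om c) (wgrad Om s) + cform u c s + r0 D * ip1 c s = ip1 (g D) s.
Proof.
move=> Xu eqn /Yh_H1[hc _] Ys; have [hs _] := Yh_H1 Ys; have := eqn _ Ys.
have [bu _ bd _] := Xh_facts d0 oOm bOm triT Xu.
have [Is _ _] := hs.
have [M _ /(_ _ _ hc Is)[i1 i2 _]] := bform_bound oOm bd bu.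
rewrite !cformE (bformE oOm (half_wdiv_bdf Xu) bu hc Is) ipE !ip1E => <-.
rewrite -(RintegralZl _ mOm i1).
rewrite (_ : (fun x => 2^-1 * wdiv Om u x * c x * s x) =
  (fun x => 2^-1 * (wdiv Om u x * c x * s x))); last by apply/funext => x; rewrite !mulrA.
by rewrite -!addrA; congr (_ + _); rewrite !addrA; congr (_ + _); rewrite addrC.
Qed.

(** Tested with [c] itself, the equation loses its convection term, and the reaction term has a
    sign. *)
Lemma concentration_energy u c : Xh Om T u -> discrete_concentration D Om T u c ->
  Yh Om T c -> semi c <= S2 / alpha D * nrm 2 (g D).
Proof.
move=> Xu eqn Yc; have [hc h0c] := Yh_H1 Yc; have [Ic _ _] := hc.
have := discrete_concentrationE Xu eqn Yc Yc.
have [Lc Ec] := H1_vL2 hc.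
rewrite (cform_diag Xu h0c) addr0 (ip_sq mOm Lc) Ec (ip1_sq mOm Ic) => eq0.
have [_ n1] := ip1_le mOm Ig Ic; have n2 := le_trans (ler_norm _) n1.
have n3 := hS2 h0c; have g0 := nrm_ge0 Om 2 (g D); have c0 := semi_ge0 Om c.
have [->|cn0] := eqVneq (semi c) 0; first by rewrite mulr_ge0// divr_ge0// ltW.
have cp : 0 < semi c by rewrite lt_neqAle eq_sym cn0.
rewrite mulrAC ler_pdivlMr// -(ler_pM2r cp).
have n4 : nrm 2 (g D) * nrm 2 c <= nrm 2 (g D) * (S2 * semi c) by rewrite ler_wpM2l.
have n5 : 0 <= r0 D * nrm 2 c ^+ 2 by rewrite mulr_ge0 ?sqr_ge0// ltW.
nra.
Qed.

Lemma wdivB u v : Xh Om T u -> Xh Om T v ->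
  {ae leb d, forall x, Om x -> wdiv Om (fun x => u x - v x) x = wdiv Om u x - wdiv Om v x}.
Proof.
move=> Xu Xv; have [_ wu _ _] := Xh_facts d0 oOm bOm triT Xu.
have [_ wv _ _] := Xh_facts d0 oOm bOm triT Xv.
have : {ae leb d, forall x, forall i : 'I_d, Om x ->
    wgrad Om (fun y => (u y - v y) ord0 i) x =
    wgrad Om (fun y => u y ord0 i) x - wgrad Om (fun y => v y ord0 i) x}.
  apply: filter_forall => i; have := wgradB oOm (wu i) (wv i).
  rewrite (_ : _ \- _ = (fun y => (u y - v y) ord0 i))//.
  by apply/funext => y; rewrite /= !mxE.
apply: filterS => x H Ox; rewrite /wdiv -sumrB; apply: eq_bigr => i _.
by rewrite (H i Ox) !mxE.
Qed.

Lemma cformB u v c s : Xh Om T u -> Xh Om T v -> H1 Om c -> inLp 2%:E Om s ->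
  cform (fun x => u x - v x) c s = cform u c s - cform v c s.
Proof.
move=> Xu Xv hc Is; have [bu _ _ _] := Xh_facts d0 oOm bOm triT Xu.
have [bv _ _ _] := Xh_facts d0 oOm bOm triT Xv.
have Xw := XhB Xu Xv; have [bw _ _ _] := Xh_facts d0 oOm bOm triT Xw.
have i1 := bform_integrable oOm (half_wdiv_bdf Xu) bu hc Is.
have i2 := bform_integrable oOm (half_wdiv_bdf Xv) bv hc Is.
have i3 := bform_integrable oOm (half_wdiv_bdf Xw) bw hc Is.
rewrite !cformE !bform_def -(RintegralB mOm i1 i2).
have /integrableP[/measurable_EFinP m1 _] := i1.
have /integrableP[/measurable_EFinP m2 _] := i2.
have /integrableP[/measurable_EFinP m3 _] := i3.
apply: ae_eq_Rintegral; [exact: mOm | exact: m3 | exact: measurable_funB |].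
by apply: filterS (wdivB Xu Xv) => x /[apply] ->; rewrite dotBl; ring.
Qed.

(** Subtracting the form with exchanged arguments cancels the divergence term, so that the estimates
    below need norms of [w] alone and none of its derivatives. *)
Lemma cform_skew w c s : Xh Om T w -> H10 Om c -> H10 Om s ->
  2 * cform w c s = tform w c s - tform w s c.
Proof.
move=> Xw h0c h0s; have [hc _] := H10_approx oOm bOm h0c; have [hs _] := H10_approx oOm bOm h0s.
have [Ic _ _] := hc; have [Is _ _] := hs.
have [bw _ _ _] := Xh_facts d0 oOm bOm triT Xw.
have := cform_antisym Xw h0c h0s.
rewrite !cformE (bformE oOm (half_wdiv_bdf Xw) bw hc Is).
rewrite (bformE oOm (half_wdiv_bdf Xw) bw hs Ic).
rewrite (_ : (fun x => 2^-1 * wdiv Om w x * s x * c x) =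
  (fun x => 2^-1 * wdiv Om w x * c x * s x)); last by apply/funext => x; rewrite mulrAC.
rewrite -!tformE; move: (tform _ _ _) (tform _ _ _) (Rintegral _ _ _) => x y z; lra.
Qed.

Lemma transport_le p q w c s (N : R) : 0 < p -> 0 < q -> 1 = p^-1 + q^-1 + 6^-1 ->
  vbdf Om w -> H1 Om c -> inLp q%:E Om (gnorm Om c) -> H10 Om s ->
  vnrm p w <= N -> 
  `|tform w c s| <= N * nrm q (gnorm Om c) * (S6 * semi s).
Proof.
rewrite tformE.
move=> p0 q0 pq bw [_ wc _] Gc h0s wN; have [I6 n6] := hS6 h0s.
have Iw : inLp p%:E Om (fun x => enorm (w x)) by apply: nrm_bdf => //; exact: bdf_enorm.
have [_ le3] : (leb d).-integrable Om (EFin \o (fun x => dot (w x) (wgrad Om c x) * s x)) /\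
    `|int (fun x => dot (w x) (wgrad Om c x) * s x)| <=
       nrm p (fun x => enorm (w x)) * nrm q (gnorm Om c) * nrm 6 s.
  apply: int_le3 => //.
    apply: measurable_funM; last by case: I6.
    by apply: measurable_dot; [exact: vbdf_vmeas|exact: vmeas_wgrad wc].
  apply: aeW => x _; rewrite normrM ler_wpM2r//.
  by rewrite !(ger0_norm (enorm_ge0 _)) cauchy_schwarz.
rewrite (le_trans le3)// -vnrmE.
have := vnrm_ge0 Om p w; have := nrm_ge0 Om q (gnorm Om c); have := nrm_ge0 Om 6 s => a1 a2 a3.
by apply: ler_pM => //; [exact: mulr_ge0|exact: ler_pM].
Qed.

Lemma transport_oo_le w c s (B : R) : vbdf Om w -> H1 Om s -> measurable_fun Om c -> 0 <= B ->
  {ae leb d, forall x, Om x -> `|c x| <= B} ->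
  `|tform w s c| <= B * (vnrm 2 w * semi s).
Proof.
rewrite tformE.
move=> bw hs mc B0 cB; have [[ms Is] Es] := H1_vL2 hs; rewrite -Es !vnrmE.
have [mw Iw] := vbdf_vL2 mOm fOm bw.
apply: (int_le2M oOm B0 _ Iw Is _).2.
  by apply: measurable_funM => //; exact: measurable_dot.
apply: filterS cB => x /[apply] cB; rewrite normrM mulrC.
rewrite ler_pM// !(ger0_norm (enorm_ge0 _)); exact: cauchy_schwarz.
Qed.

(** With e = c - q and w = u - v the equations give alpha |e|^2 + r0 ||e||^2 = - B_w(q, e), and q is
    split as C - (C - q). The part with C is bounded by N/2 ||w|| |e|, through its W^{1,3} and sup
    norms; the part with C - q satisfies the same bound, by the L^3 norm of w and the smallness of
    |C - q|. *)
Lemma concentration_error u v c q C (A B N l : R) :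
  Xh Om T u -> Xh Om T v -> Yh Om T c -> Yh Om T q ->
  discrete_concentration D Om T u c -> discrete_concentration D Om T v q ->
  H10 Om C -> inLp 3%:E Om (gnorm Om C) -> nrm 3 (gnorm Om C) <= A -> 0 <= B ->
  {ae leb d, forall x, Om x -> `|C x| <= B} ->
  N = S6 * A + B ->
  vnrm 3 (fun x => u x - v x) <= l * vnrm 2 (fun x => u x - v x) ->
  l * S6 * semi (C \- q) <= N / 2 ->
  alpha D * semi (c \- q) <= N * vnrm 2 (fun x => u x - v x).
Proof.
move=> Xu Xv Yc Yq equ eqv h0C GC nA B0 CB NE lV lN.
have [e eE] : {e | e = c \- q} by exists (c \- q).
have [dl dlE] : {dl | dl = C \- q} by exists (C \- q).
rewrite -eE; rewrite -dlE in lN.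
have Ye := YhB oOm bOm eE Yc Yq; have [he h0e] := Yh_H1 Ye.
have [hc h0c] := Yh_H1 Yc; have [hq h0q] := Yh_H1 Yq.
have [hC _] := H10_approx oOm bOm h0C.
have h0d := H10B oOm bOm dlE h0C h0q; have [hd _] := H10_approx oOm bOm h0d.
have [Ie _ _] := he; have [Ic _ _] := hc; have [Iq _ _] := hq.
have [IC _ _] := hC; have [Id _ Gd] := hd.
have e1 := discrete_concentrationE Xu equ Yc Ye.
have e2 := discrete_concentrationE Xv eqv Yq Ye.
have [w wE] : {w | w = fun x => u x - v x} by exists (fun x => u x - v x).
rewrite -wE in lV *.
have Xw : Xh Om T w by rewrite wE; exact: XhB.
have [bu _ _ _] := Xh_facts d0 oOm bOm triT Xu.
have [bw _ _ _] := Xh_facts d0 oOm bOm triT Xw.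
(* The form with velocity [u] vanishes at (e, e), so [c] may be replaced by [q]; the two convection
   terms then differ only in their velocities. *)
have c1 : cform u c e = cform u q e.
  have := cform_diag Xu h0e.
  rewrite {1}cformE (bformBl oOm (half_wdiv_bdf Xu) bu eE hc hq Ie) -!cformE; lra.
have c2 : cform w q e = cform u q e - cform v q e by rewrite wE cformB.
have c3 : cform w dl e = cform w C e - cform w q e.
  by rewrite !cformE (bformBl oOm (half_wdiv_bdf Xw) bw dlE hC hq Ie).
have [Lc _] := H1_vL2 hc; have [Lq _] := H1_vL2 hq; have [Le Ee] := H1_vL2 he.
have g1 : ip (wgrad Om c) (wgrad Om e) - ip (wgrad Om q) (wgrad Om e) = semi e ^+ 2.
  rewrite -Ee -(ip_sq mOm Le) -(ipBl mOm Lc Lq Le) !ipE.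
  have [_ wc _] := hc; have [_ wq _] := hq.
  apply: ae_eq_Rintegral => //.
  - by apply: measurable_dot; [apply: vmeasB; [case: Lc|case: Lq]|case: Le].
  - by apply: measurable_dot; case: Le.
  - by have := wgradB oOm wc wq; rewrite -eE; apply: filterS => x /[apply] ->.
have r1 : ip1 c e - ip1 q e = nrm 2 e ^+ 2 by rewrite -(ip1Bl mOm eE Ic Iq Ie) (ip1_sq mOm Ie).
have s1 := cform_skew Xw h0C h0e; have s2 := cform_skew Xw h0d h0e.
have p1 : (1 : R) = 2^-1 + 3^-1 + 6^-1 by field.
have p2 : (1 : R) = 3^-1 + 2^-1 + 6^-1 by field.
have [_ _ Ge] := he.
have t1 := transport_le (ltr0n _ 2) (ltr0n _ 3) p1 bw hC GC h0e (lexx _).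
have t2 := transport_oo_le bw he IC.1 B0 CB.
have t3 := transport_le (ltr0n _ 3) (ltr0n _ 2) p2 bw hd Gd h0e lV.
have t4 := transport_le (ltr0n _ 3) (ltr0n _ 2) p2 bw he Ge h0d lV.
rewrite -semiE in t3; rewrite -semiE in t4.
have V0 := vnrm_ge0 Om 2 w; have se0 := semi_ge0 Om e.
have key : alpha D * semi e ^+ 2 <= N * vnrm 2 w * semi e.
  have n0 : 0 <= r0 D * nrm 2 e ^+ 2 by rewrite mulr_ge0 ?sqr_ge0// ltW.
  have b1 : `|2 * cform w C e| <= N * vnrm 2 w * semi e.
    rewrite s1 (le_trans (ler_normB _ _))// (le_trans (lerD t1 t2))//.
    rewrite NE; have : 0 <= (A - nrm 3 (gnorm Om C)) * (vnrm 2 w * (S6 * semi e)).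
      by rewrite !mulr_ge0 ?subr_ge0// ltW.
    lra.
  have b2 : `|2 * cform w dl e| <= N * vnrm 2 w * semi e.
    rewrite s2 (le_trans (ler_normB _ _))// (le_trans (lerD t3 t4))//.
    have : 0 <= (N / 2 - l * S6 * semi dl) * (vnrm 2 w * semi e).
      by rewrite mulr_ge0 ?subr_ge0// mulr_ge0.
    lra.
  move: b1 b2; rewrite !ler_norml => /andP[b1 _] /andP[_ b2].
  have gg : alpha D * semi e ^+ 2 = alpha D * ip (wgrad Om c) (wgrad Om e)
      - alpha D * ip (wgrad Om q) (wgrad Om e) by rewrite -g1; ring.
  have rr : r0 D * nrm 2 e ^+ 2 = r0 D * ip1 c e - r0 D * ip1 q e by rewrite -r1; ring.
  lra.
have [->|en0] := eqVneq (semi e) 0.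
  rewrite mulr0 NE mulr_ge0// addr_ge0// mulr_ge0//; first exact: ltW.
  exact: le_trans (nrm_ge0 _ _ _) nA.
have ep : 0 < semi e by rewrite lt_neqAle eq_sym en0.
by rewrite -(ler_pM2r ep) -mulrA -expr2.
Qed.

End concentration.

(** * Discrete velocities *)

HB.lock Definition conv {R : realType} {d : nat} (Om : set 'rV[R]_d)
  (u v w : 'rV[R]_d -> 'rV[R]_d) : R :=
  \int[leb d]_(x in Om) (enorm (u x) * dot (v x) (w x)).

Section velocity.
Context {R : realType} {d : nat}.
Local Notation E := 'rV[R]_d.
Variables (Om : set E) (T : {fset {fset E}}) (D : data R d) (Km KM cf1 : R).
Hypotheses (d0 : (0 < d)%N) (oOm : open Om) (bOm : bounded_set Om).
Hypothesis triT : triangulation Om T.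
Hypotheses (mu0 : 0 < mu D) (rho0 : 0 < rho D) (beta0 : 0 < beta D).
Hypothesis hK : tensor_assumptions D Om Km KM.
Hypotheses (Lf0 : vL2 Om (f0 D)) (cf10 : 0 < cf1).
Hypothesis f1_lip : forall a b, enorm (f1 D a - f1 D b) <= cf1 * `|a - b|.
Hypothesis f1_0 : f1 D 0 = 0.
Implicit Types (f c s q : E -> R) (u v w : E -> E).
Local Notation nrm := (nrm Om).
Local Notation vnrm := (vnrm Om).
Local Notation ip := (ip Om).
Local Notation conv := (conv Om).

Let mOm : measurable Om. Proof. exact: open_measurable_rV. Qed.
Let fOm : (leb d Om < +oo)%E. Proof. exact: leb_bounded_fin. Qed.

Lemma convE u v w : conv u v w = \int[leb d]_(x in Om) (enorm (u x) * dot (v x) (w x)).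
Proof. by rewrite conv.unlock. Qed.

Lemma measurable_f1 c i : measurable_fun Om c -> measurable_fun Om (fun x => f1 D (c x) ord0 i).
Proof.
move=> mc; have cf : continuous (fun t => f1 D t ord0 i : R).
  move=> t; apply/cvgrPdist_lt => e e0; near=> s.
  have st : `|t - s| < e / cf1.
    by near: s; apply: cvgr_dist_lt => //; exact: divr_gt0.
  rewrite (@le_lt_trans _ _ (cf1 * `|t - s|))//; last by rewrite mulrC -ltr_pdivlMr.
  rewrite (le_trans _ (f1_lip t s))//.
  by have := coord_enorm (f1 D t - f1 D s) i; rewrite !mxE.
exact: (measurableT_comp (continuous_measurable_fun cf) mc).
Unshelve. all: end_near. Qed.

Lemma rhs_vL2 c : inLp 2%:E Om c ->
  vL2 Om (rhs D c) /\ vnrm 2 (rhs D c) <= vnrm 2 (f0 D) + cf1 * nrm 2 c.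
Proof.
move=> Ic; have [Icc nc] := nrmZ mOm cf1 (ltr0n _ 2) Ic.
have [L n] : vL2 Om (fun x => f1 D (c x)) /\
    vnrm 2 (fun x => f1 D (c x)) <= nrm 2 (fun x => cf1 * c x).
  apply: vnrm_le => //; first by move=> i; apply: measurable_f1; case: Ic.
  apply: aeW => x _; have := f1_lip (c x) 0; rewrite f1_0 !subr0 => H.
  by rewrite normrM (gtr0_norm cf10).
have [L2 n2] := vL2D mOm Lf0 L; split => //.
by rewrite (le_trans n2)// lerD2l (le_trans n)// nc gtr0_norm.
Qed.

Lemma rhsB c q h : h = c \- q -> inLp 2%:E Om c -> inLp 2%:E Om q -> inLp 2%:E Om h ->
  vnrm 2 (fun x => rhs D c x - rhs D q x) <= cf1 * nrm 2 h.
Proof.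
move=> hE Ic Iq Ih; have [Icc nc] := nrmZ mOm cf1 (ltr0n _ 2) Ih.
rewrite -{1}(gtr0_norm cf10) -nc; apply: (vnrm_le mOm _ Icc _).2.
  by apply: vmeasB; [case: (rhs_vL2 Ic) => -[]|case: (rhs_vL2 Iq) => -[]].
apply: aeW => x _; rewrite normrM (gtr0_norm cf10) hE /rhs /=.
by rewrite opprD addrACA subrr add0r.
Qed.

Lemma Xh_vL2 u : Xh Om T u -> vL2 Om u.
Proof. by move=> /(Xh_facts d0 oOm bOm triT)[bu _ _ _]; exact: vbdf_vL2. Qed.

Lemma Kinv_ip u v : Xh Om T u -> Xh Om T v ->
  Km * vnrm 2 (fun x => u x - v x) ^+ 2 <=
  ip (Kinv D u) (fun x => u x - v x) - ip (Kinv D v) (fun x => u x - v x).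
Proof.
move=> Xu Xv; have Xw := XhB Xu Xv.
have [bu _ _ _] := Xh_facts d0 oOm bOm triT Xu; have [bv _ _ _] := Xh_facts d0 oOm bOm triT Xv.
have [bw _ _ _] := Xh_facts d0 oOm bOm triT Xw.
have LK z : vbdf Om z -> vL2 Om (Kinv D z) by move=> bz; apply: vbdf_vL2 => //; exact: vbdf_Kinv hK _ bz.
rewrite -(ip_sq mOm (Xh_vL2 Xw)) -(ipBl mOm (LK _ bu) (LK _ bv) (Xh_vL2 Xw)) !ipE.
have [i1 _] := ip_le mOm (Xh_vL2 Xw) (Xh_vL2 Xw); rewrite -(RintegralZl _ mOm i1).
apply: ae_le_Rintegral => //.
- by have := integrableZl mOm Km i1; apply: eq_integrable.
- by have [] := ip_le mOm (vL2B mOm (LK _ bu) (LK _ bv)).1 (Xh_vL2 Xw).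
- apply: filterS (Kinv_coercive hK) => x H Ox.
  by have := H Ox (fun x => u x - v x); rewrite /Kinv mxappB.
Qed.

Lemma Kinv_ip1 u : Xh Om T u -> Km * vnrm 2 u ^+ 2 <= ip (Kinv D u) u.
Proof.
move=> Xu; have [bu _ _ _] := Xh_facts d0 oOm bOm triT Xu.
have LK : vL2 Om (Kinv D u) by apply: vbdf_vL2 => //; exact: vbdf_Kinv hK _ bu.
rewrite -(ip_sq mOm (Xh_vL2 Xu)) !ipE.
have [i1 _] := ip_le mOm (Xh_vL2 Xu) (Xh_vL2 Xu); rewrite -(RintegralZl _ mOm i1).
apply: ae_le_Rintegral => //.
- by have := integrableZl mOm Km i1; apply: eq_integrable.
- by have [] := ip_le mOm LK (Xh_vL2 Xu).
- by apply: filterS (Kinv_coercive hK) => x H Ox; exact: H.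
Qed.

Lemma conv_ge0 u v : 0 <= conv u v v.
Proof. by rewrite convE; apply: Rintegral_ge0 => x _; rewrite mulr_ge0 ?enorm_ge0 ?dot_ge0. Qed.

(* |u|u' - |v|v = (|u| - |u'|)u' + (|u'|u' - |v|v), whose last term is monotone. *)
Lemma conv_monotone (a b c : E) :
  - (enorm (b - a) * enorm b * enorm (b - c)) <=
  enorm a * dot b (b - c) - enorm c * dot c (b - c).
Proof.
have h1 : - (enorm (b - a) * enorm b * enorm (b - c)) <= (enorm a - enorm b) * dot b (b - c).
  have : `|(enorm a - enorm b) * dot b (b - c)| <= enorm (b - a) * enorm b * enorm (b - c).
    rewrite normrM -mulrA; apply: ler_pM => //; last exact: cauchy_schwarz.
    by rewrite distrC; exact: enormB_ge.
  by rewrite ler_norml => /andP[].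
have h2 : 0 <= enorm b * dot b (b - c) - enorm c * dot c (b - c).
  have cs := le_trans (ler_norm _) (cauchy_schwarz b c).
  have b0 := enorm_ge0 b; have c0 := enorm_ge0 c.
  rewrite !dotBr -!sqr_enorm (dotC c b).
  have -> : enorm b * (enorm b ^+ 2 - dot b c) - enorm c * (dot b c - enorm c ^+ 2) =
    (enorm b + enorm c) * (enorm b * enorm c - dot b c)
    + (enorm b + enorm c) * (enorm b - enorm c) ^+ 2 by ring.
  by apply: addr_ge0; apply: mulr_ge0; rewrite ?sqr_ge0 ?subr_ge0 ?addr_ge0.
lra.
Qed.

(** Integrates [conv_monotone], the product of three lengths being bounded by Hoelder's inequality
    in L^3. *)
Lemma conv_diff u v w : Xh Om T u -> Xh Om T v -> Xh Om T w ->
  - (vnrm 3 (fun x => v x - u x) * vnrm 3 v * vnrm 3 (fun x => v x - w x)) <=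
  conv u v (fun x => v x - w x) - conv w w (fun x => v x - w x).
Proof.
move=> Xu Xv Xw; have B z : Xh Om T z -> vbdf Om z.
  by move=> /(Xh_facts d0 oOm bOm triT)[].
have bu := B _ Xu; have bv := B _ Xv; have bw := B _ Xw.
have bvu := B _ (XhB Xv Xu); have bvw := B _ (XhB Xv Xw).
have I3 z : vbdf Om z -> inLp 3%:E Om (fun x => enorm (z x)).
  by move=> bz; apply: nrm_bdf => //; exact: bdf_enorm.
have bF : bdf Om (fun x => enorm (v x - u x) * enorm (v x) * enorm (v x - w x)).
  by apply: bdfM; [apply: bdfM|]; exact: bdf_enorm.
have [iF le3] : (leb d).-integrable Om
     (EFin \o (fun x => enorm (v x - u x) * enorm (v x) * enorm (v x - w x))) /\
   `|\int[leb d]_(x in Om) (enorm (v x - u x) * enorm (v x) * enorm (v x - w x))| <=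
     nrm 3 (fun x => enorm (v x - u x)) * nrm 3 (fun x => enorm (v x))
     * nrm 3 (fun x => enorm (v x - w x)).
  apply: int_le3 => //; [by field|exact: bF.1|exact: I3|exact: I3|exact: I3|].
  by apply: aeW => x _; rewrite !normrM.
have b1 : bdf Om (fun x => enorm (u x) * dot (v x) (v x - w x)).
  by apply: bdfM; [exact: bdf_enorm|exact: bdf_dot].
have b2 : bdf Om (fun x => enorm (w x) * dot (w x) (v x - w x)).
  by apply: bdfM; [exact: bdf_enorm|exact: bdf_dot].
have i1 := bdf_integrable mOm fOm b1; have i2 := bdf_integrable mOm fOm b2.
rewrite !convE -(RintegralB mOm i1 i2) !vnrmE.
apply: (@le_trans _ _ (\int[leb d]_(x in Om)
    (-1 * (enorm (v x - u x) * enorm (v x) * enorm (v x - w x))))).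
  rewrite (RintegralZl _ mOm iF) mulN1r lerN2.
  exact: le_trans (ler_norm _) le3.
apply: ae_le_Rintegral => //.
- by have := integrableZl mOm (-1) iF; apply: eq_integrable.
- by have := integrableB mOm i1 i2; apply: eq_integrable.
- by apply: aeW => x _; rewrite mulN1r; exact: conv_monotone.
Qed.

Lemma Vahi_eq (gamma : R) u c u' p' c' v : Vahi D Om T gamma u c u' p' c' -> Xh Om T v ->
  gamma * ip (fun x => u' x - u x) v + mu D / rho D * ip (Kinv D u') v
  + beta D / rho D * conv u u' v + ip (wgrad Om p') v = ip (rhs D c) v.
Proof. by move=> [_ _ _ [eq1 _ _]] Xv; have := eq1 _ Xv; rewrite !ipE convE. Qed.

Lemma Vahi_div (gamma : R) u c u' p' c' q : Vahi D Om T gamma u c u' p' c' -> Mh Om T q ->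
  ip (wgrad Om q) u' = 0.
Proof. by move=> [_ _ _ [_ eq2 _]] Mq; have := eq2 _ Mq; rewrite !ipE. Qed.

Lemma Vah_eq u p c v : Vah D Om T u p c -> Xh Om T v ->
  mu D / rho D * ip (Kinv D u) v
  + beta D / rho D * conv u u v + ip (wgrad Om p) v = ip (rhs D c) v.
Proof. by move=> [_ _ _ [eq1 _ _]] Xv; have := eq1 _ Xv; rewrite !ipE convE. Qed.

Lemma Vah_div u p c q : Vah D Om T u p c -> Mh Om T q -> ip (wgrad Om q) u = 0.
Proof. by move=> [_ _ _ [_ eq2 _]] Mq; have := eq2 _ Mq; rewrite !ipE. Qed.

(** The equation is tested with the new velocity: the pressure drops by the discrete divergence
    constraint, and the nonlinear term is nonnegative. *)
Lemma velocity_bound (gamma : R) u c u' p' c' : 0 < gamma -> Xh Om T u -> inLp 2%:E Om c ->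
  Vahi D Om T gamma u c u' p' c' ->
  (gamma + mu D * Km / rho D) * vnrm 2 u' <=
    gamma * vnrm 2 u + (vnrm 2 (f0 D) + cf1 * nrm 2 c).
Proof.
move=> gamma0 Xu Ic H; have [Xu' Mp' _ _] := H.
have Lu := Xh_vL2 Xu; have Lu' := Xh_vL2 Xu'.
have := Vahi_eq H Xu'; rewrite (Vahi_div H Mp') addr0 (ipBl mOm Lu' Lu Lu') (ip_sq mOm Lu').
have K1 := Kinv_ip1 Xu'; have c0 := conv_ge0 u u'.
have [Lr nr] := rhs_vL2 Ic; have [_ r1] := ip_le mOm Lr Lu'.
have [_ r2] := ip_le mOm Lu Lu'.
have V0 := vnrm_ge0 Om 2 u'; have U0 := vnrm_ge0 Om 2 u; have n0 := nrm_ge0 Om 2 c.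
have F0 := vnrm_ge0 Om 2 (f0 D).
have r3 := le_trans (ler_norm _) r1; have r4 := le_trans (ler_norm _) r2.
have r5 : vnrm 2 (rhs D c) * vnrm 2 u' <= (vnrm 2 (f0 D) + cf1 * nrm 2 c) * vnrm 2 u'.
  by rewrite ler_wpM2r.
have k1 : mu D * Km / rho D * vnrm 2 u' ^+ 2 <= mu D / rho D * ip (Kinv D u') u'.
  rewrite (_ : mu D * Km / rho D * _ = mu D / rho D * (Km * vnrm 2 u' ^+ 2)); last by ring.
  by rewrite ler_wpM2l// divr_ge0// ltW.
have k2 : 0 <= beta D / rho D * conv u u' u' by rewrite mulr_ge0// divr_ge0// ltW.
have k3 : gamma * ip u u' <= gamma * (vnrm 2 u * vnrm 2 u') by rewrite ler_pM2l.
have [->|V1] := eqVneq (vnrm 2 u') 0.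
  by move=> _; rewrite mulr0 addr_ge0 ?addr_ge0 ?mulr_ge0// ltW.
have Vp : 0 < vnrm 2 u' by rewrite lt_neqAle eq_sym V1.
move=> eq0; rewrite -(ler_pM2r Vp).
move: k1 k2 eq0; set m := mu D * Km / rho D; set bb := _ * conv _ _ _; set kk := _ * ip _ _ => k1 k2 eq0.
lra.
Qed.

(** The scheme and the limit equation are subtracted and tested with the new error; both pressures
    drop. The factor [l ^+ 3] stems from the inverse inequality applied to each of the three L^3
    norms in [conv_diff]. *)
Lemma velocity_step (gamma l : R) u c u' p' c' v p q dl : 0 < gamma ->
  Xh Om T u -> Yh Om T c -> Vahi D Om T gamma u c u' p' c' -> Vah D Om T v p q ->
  dl = c \- q -> 0 <= l ->
  (forall z, Xh Om T z -> vnrm 3 z <= l * vnrm 2 z) ->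
  gamma / 2 * (vnrm 2 (fun x => u' x - v x) ^+ 2 - vnrm 2 (fun x => u x - v x) ^+ 2
     + vnrm 2 (fun x => u' x - u x) ^+ 2)
  + mu D * Km / rho D * vnrm 2 (fun x => u' x - v x) ^+ 2 <=
  beta D / rho D * l ^+ 3 * vnrm 2 (fun x => u' x - u x) * vnrm 2 u'
    * vnrm 2 (fun x => u' x - v x) + cf1 * nrm 2 dl * vnrm 2 (fun x => u' x - v x).
Proof.
move=> gamma0 Xu Yc H Hv dlE l0 inv; have [Xu' Mp' _ _] := H; have [Xv Mp Yq _] := Hv.
have Xw := XhB Xu Xv; have Xw' := XhB Xu' Xv; have Xd := XhB Xu' Xu.
have L := Xh_vL2.
have := Vahi_eq H Xw'; have := Vah_eq Hv Xw'.
have pB z : Mh Om T z -> ip (wgrad Om z) (fun x => u' x - v x) = 0.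
  move=> Mz; have Lz : vL2 Om (wgrad Om z).
    by case: Mz => /(CP1_facts d0 oOm bOm triT)[_ _ bz _] _; exact: vbdf_vL2.
  by rewrite (ipBr mOm (L _ Xu') (L _ Xv) Lz) (Vahi_div H Mz) (Vah_div Hv Mz) subrr.
rewrite (pB _ Mp) (pB _ Mp') !addr0.
have cd := conv_diff Xu Xu' Xv.
have kd := Kinv_ip Xu' Xv.
have Ic : inLp 2%:E Om c by case: Yc => /(CP1_facts d0 oOm bOm triT)[bc _ _ _] _; exact: nrm_bdf.
have Iq : inLp 2%:E Om q by case: Yq => /(CP1_facts d0 oOm bOm triT)[bc _ _ _] _; exact: nrm_bdf.
have [Idl _] := nrm2B oOm dlE Ic Iq.
have Lr1 := (rhs_vL2 Ic).1; have Lr2 := (rhs_vL2 Iq).1.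
have rd := ipBl mOm Lr1 Lr2 (L _ Xw').
have [_ re] := ip_le mOm (vL2B mOm Lr1 Lr2).1 (L _ Xw').
have rn := rhsB dlE Ic Iq Idl.
have [w wE] : {w | w = fun x => u x - v x} by exists (fun x => u x - v x).
have [w' w'E] : {w' | w' = fun x => u' x - v x} by exists (fun x => u' x - v x).
have [dd ddE] : {dd | dd = fun x => u' x - u x} by exists (fun x => u' x - u x).
rewrite -?wE -?w'E -?ddE in Xw Xw' Xd cd kd rd re *.
have ddw : dd = fun x => w' x - w x.
  by rewrite ddE wE w'E; apply/funext => x; rewrite opprB addrA subrK.
(* The identity 2 (w' - w) . w' = |w'|^2 - |w|^2 + |w' - w|^2; the last square is what will absorb
   the nonlinear increment. *)
have e1 : ip dd w' = (vnrm 2 w' ^+ 2 - vnrm 2 w ^+ 2 + vnrm 2 dd ^+ 2) / 2.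
  have a1 : ip dd w' = ip w' w' - ip w w' by rewrite ddw (ipBl mOm (L _ Xw') (L _ Xw) (L _ Xw')).
  have a2 : ip dd w = ip w' w - ip w w by rewrite ddw (ipBl mOm (L _ Xw') (L _ Xw) (L _ Xw)).
  have a3 : ip dd dd = ip dd w' - ip dd w by rewrite {2}ddw (ipBr mOm (L _ Xw') (L _ Xw) (L _ Xd)).
  have a4 : ip w w' = ip w' w by rewrite !ipE; apply: eq_Rintegral => x _; rewrite dotC.
  rewrite -(ip_sq mOm (L _ Xw)) -(ip_sq mOm (L _ Xw')) -(ip_sq mOm (L _ Xd)); lra.
have V1 := vnrm_ge0 Om 2 dd; have V2 := vnrm_ge0 Om 2 u'; have V3 := vnrm_ge0 Om 2 w'.
have W1 := vnrm_ge0 Om 3 dd; have W2 := vnrm_ge0 Om 3 u'; have W3 := vnrm_ge0 Om 3 w'.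
have c3 : vnrm 3 dd * vnrm 3 u' * vnrm 3 w' <= l ^+ 3 * vnrm 2 dd * vnrm 2 u' * vnrm 2 w'.
  rewrite (_ : l ^+ 3 * _ * _ * _ = (l * vnrm 2 dd) * (l * vnrm 2 u') * (l * vnrm 2 w')); last by ring.
  by apply: ler_pM; rewrite ?mulr_ge0 ?inv//; apply: ler_pM; rewrite ?inv.
have c4 : ip (rhs D c) w' - ip (rhs D q) w' <= cf1 * nrm 2 dl * vnrm 2 w'.
  rewrite -rd (le_trans (ler_norm _))// (le_trans re)// ler_wpM2r//.
have mr : 0 <= mu D / rho D by rewrite divr_ge0// ltW.
have br : 0 <= beta D / rho D by rewrite divr_ge0// ltW.
have c5 := ler_wpM2l mr kd; have c6 := ler_wpM2l br cd; have c7 := ler_wpM2l br c3.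
rewrite e1 => eqv eqi.
have -> : mu D * Km / rho D * vnrm 2 w' ^+ 2 = mu D / rho D * (Km * vnrm 2 w' ^+ 2) by ring.
move: c5 c6 c7 eqv eqi; set a := mu D / rho D; set b := beta D / rho D; lra.
Qed.

End velocity.

(** * Convergence of the iterates *)

(** Measured from the fixed point b / (1 - q), the excess decays geometrically. *)
Lemma contraction_eventually {R : realType} (a : nat -> R) (q b e : R) :
  0 <= q < 1 -> (forall n, a n.+1 <= q * a n + b) -> 0 < e ->
  exists n0, forall n, (n0 <= n)%N -> a n <= b / (1 - q) + e.
Proof.
move=> /andP[q0 q1] ha e0; set L := b / (1 - q).
have q1' : 1 - q != 0 by rewrite gt_eqF// subr_gt0.
have H n : a n <= L + q ^+ n * (`|a 0%N - L| + 1).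
  elim: n => [|n IH].
    by rewrite expr0 mul1r; have := ler_norm (a 0%N - L); lra.
  have bL : b = L * (1 - q) by rewrite /L divfK.
  have := ler_wpM2l q0 IH; have := ha n; rewrite exprS bL; lra.
have A0 : 0 < `|a 0%N - L| + 1 by rewrite ltr_wpDl.
have cq : (fun n => q ^+ n) @ \oo --> (0 : R) by apply: cvg_expr; rewrite ger0_norm.
have := cvgr_lt _ cq _ (divr_gt0 e0 A0) => -[n0 _ Hn0]; exists n0 => n /Hn0 /= qn.
rewrite (le_trans (H n))// lerD2l -ler_pdivlMr// ltW//.
Qed.

(* U stands for the norms of the velocities, W for their errors, dl for their
   increments and r for the perturbation due to the concentration. *)
Lemma perturbed_contraction {R : realType} (U W dl r : nat -> R) (c m F B e : R) :
  0 < c -> 0 < m -> 0 <= F -> 0 <= B -> 0 < e ->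
  (forall n, 0 <= U n) -> (forall n, 0 <= W n) -> (forall n, 0 <= dl n) ->
  (forall n, (c + m) * U n.+1 <= c * U n + F) ->
  (forall n, c / 2 * (W n.+1 ^+ 2 - W n ^+ 2 + dl n ^+ 2) + m * W n.+1 ^+ 2 <=
     B * dl n * U n.+1 * W n.+1 + r n * W n.+1) ->
  (forall n, r n <= 3 / 8 * m * W n) ->
  B ^+ 2 * (F / m) ^+ 2 < c * m ->
  exists n0, forall n, (n0 <= n)%N -> W n <= e.
Proof.
move=> c0 m0 F0 B0 e0 U0 W0 d0 hU hW hr hB.
have cm : 0 < c + m by exact: addr_gt0.
(* Critical factor in Young's inequality: s x y <= c/2 x^2 + m/2 y^2 for s^2 = c m. *)
pose s : R := Num.sqrt (c * m).
have s2 : s ^+ 2 = c * m by rewrite sqr_sqrtr// ltW// mulr_gt0.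
have s0 : 0 <= s by exact: sqrtr_ge0.
have Fm : 0 <= F / m by rewrite divr_ge0// ltW.
have BLs : B * (F / m) < s.
  rewrite ltNge; apply/negP => sB; move: hB; rewrite -exprMn -s2 ltNge.
  by rewrite lerXn2r// nnegrE// mulr_ge0.
(* The slack left below [s] by the limit bound [F / m] of the velocities, so that [B * U n <= s] for
   large n. The denominator is [B + 1] because [B] may be zero. *)
pose e1 := (s - B * (F / m)) / (B + 1).
have B1 : 0 < B + 1 by rewrite ltr_wpDl.
have e10 : 0 < e1 by rewrite divr_gt0// subr_gt0.
have Be1 : B * e1 <= s - B * (F / m).
  have : e1 * (B + 1) = s - B * (F / m) by rewrite /e1 divfK// gt_eqF.
  lra.
have [n0 Hn0] : exists n0, forall n, (n0 <= n)%N -> U n <= F / m + e1.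
  have [||n0 Hn0] := @contraction_eventually _ U (c / (c + m)) (F / (c + m)) e1 _ _ e10.
  - by rewrite divr_ge0 ?ltW//= ltr_pdivrMr// mul1r ltrDl.
  - move=> n; have := hU n; rewrite mulrC -ler_pdivlMr// => /le_trans; apply.
    by rewrite mulrDl mulrAC.
  exists n0 => n /Hn0; rewrite (_ : F / (c + m) / _ = F / m)//.
  by field; rewrite gt_eqF//= gt_eqF// addrAC subrr add0r.
(* Half of the coercivity [m] absorbs the increment term and 3/16 of it the perturbation; 1 - 1/2 -
   3/16 = 5/16 stays on the left against 3/16 on the right, hence a strict contraction. *)
have key n : (n0 <= n)%N ->
    (c / 2 + 5 / 16 * m) * W n.+1 ^+ 2 <= (c / 2 + 3 / 16 * m) * W n ^+ 2.
  move=> nn; have Un := Hn0 n.+1 (leqW nn).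
  have BU : B * U n.+1 <= s.
    have := ler_wpM2l B0 Un; rewrite mulrDr; lra.
  have t1 : B * dl n * U n.+1 * W n.+1 <= s * (dl n * W n.+1).
    by rewrite (_ : B * _ * _ * _ = B * U n.+1 * (dl n * W n.+1)); [rewrite ler_wpM2r// mulr_ge0|ring].
  have t2 : s * (dl n * W n.+1) <= c / 2 * dl n ^+ 2 + m / 2 * W n.+1 ^+ 2.
    rewrite -(ler_pM2l c0) -subr_ge0.
    rewrite (_ : _ - _ = (c * dl n - s * W n.+1) ^+ 2 / 2); first by rewrite divr_ge0// sqr_ge0.
    have -> : (c * dl n - s * W n.+1) ^+ 2 = c ^+ 2 * dl n ^+ 2 - 2 * c * s * dl n * W n.+1
      + s ^+ 2 * W n.+1 ^+ 2 by ring.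
    by rewrite s2; field.
  have t3 : r n * W n.+1 <= 3 / 8 * m * W n * W n.+1 by rewrite ler_wpM2r.
  have t4 : 3 / 8 * m * W n * W n.+1 <= 3 / 16 * m * (W n ^+ 2 + W n.+1 ^+ 2).
    have : 0 <= 3 / 16 * m * (W n - W n.+1) ^+ 2 by rewrite mulr_ge0 ?sqr_ge0// mulr_ge0// ltW.
    rewrite sqrrB; lra.
  have := hW n; lra.
have p5 : 0 < c / 2 + 5 / 16 * m by rewrite addr_gt0 ?mulr_gt0// divr_gt0.
have [||n1 Hn1] := @contraction_eventually _ (fun n => W (n + n0)%N ^+ 2)
    ((c / 2 + 3 / 16 * m) / (c / 2 + 5 / 16 * m)) 0 (e ^+ 2) _ _ (exprn_gt0 2 e0).
- rewrite divr_ge0 ?(ltW p5)//=; last by rewrite addr_ge0 ?mulr_ge0 ?divr_ge0// ltW.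
  rewrite ltr_pdivrMr// mul1r; lra.
- move=> n; rewrite addr0 addSn mulrAC ler_pdivlMr// mulrC.
  exact: key (leq_addl _ _).
exists (n1 + n0)%N => n nn; have := Hn1 (n - n0)%N.
rewrite subnK; last by rewrite (leq_trans _ nn)// leq_addl.
have le1 : (n1 <= n - n0)%N by rewrite leq_subRL 1?addnC// (leq_trans _ nn)// leq_addl.
by move=> /(_ le1); rewrite mul0r add0r ler_pXn2r// nnegrE// ltW.
Qed.

(** * Bounding the datum g by the residuals *)

Section data.
Context {R : realType} {d : nat}.
Local Notation E := 'rV[R]_d.
Variables (Om : set E) (T : {fset {fset E}}) (D : data R d).
Hypotheses (d0 : (0 < d)%N) (oOm : open Om) (bOm : bounded_set Om).
Hypotheses (alpha0 : 0 < alpha D) (r00 : 0 < r0 D) (Ig : inLp 2%:E Om (g D)).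
Implicit Types (f c s q : E -> R) (u v w : E -> E).
Local Notation nrm := (nrm Om).
Local Notation vnrm := (vnrm Om).
Local Notation ip := (ip Om).
Local Notation ip1 := (ip1 Om).
Local Notation semi := (semi Om).

Let mOm : measurable Om. Proof. exact: open_measurable_rV. Qed.
Let fOm : (leb d Om < +oo)%E. Proof. exact: leb_bounded_fin. Qed.

Lemma nrm1_le2 f : inLp 2%:E Om f ->
  inLp 1%:E Om f /\ nrm 1 f <= nrm 2 (cst 1) * nrm 2 f.
Proof.
move=> If; have I1 : inLp 2%:E Om (cst 1 : E -> R) by apply: nrm_bdf => //; exact: bdf_cst.
have [I n] : inLp 1%:E Om (cst 1 \* f) /\ nrm 1 (cst 1 \* f) <= nrm 2 (cst 1) * nrm 2 f.
  by apply: nrm_mul => //; rewrite invr1; field.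
by rewrite (_ : cst 1 \* f = f) in I n; [|apply/funext => x /=; rewrite mul1r].
Qed.

Lemma nrm_eq0_ae p f : 0 < p -> inLp p%:E Om f -> nrm p f = 0 ->
  {ae leb d, forall x, Om x -> f x = 0}.
Proof.
move=> p0 If n0; have := LpnE If; rewrite n0 => L0; have [mf _] := If.
have := @Lnorm_eq0_eq0 _ _ _ (leb d) (fun x => (\1_Om x * f x)%:E) p%:E _ _ L0.
have -> // : (0 < p%:E)%E by rewrite lte_fin.
move=> H; have {H} := H _ isT; rewrite /ae_eq => H.
have {}H : {ae leb d, forall x, True -> (\1_Om x * f x)%:E = 0%E}.
  by apply: H; apply/measurable_EFinP; exact: measurable_indic_mul.
by apply: filterS H => x /(_ I) /= [] + Ox; rewrite indicE mem_set// mul1r.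
Qed.

Lemma ae0_nrm p f : 0 < p -> measurable_fun Om f ->
  {ae leb d, forall x, Om x -> f x = 0} -> nrm p f = 0.
Proof.
move=> p0 mf f0; have I0 : inLp p%:E Om (cst 0 : E -> R) by apply: nrm_bdf => //; exact: bdf_cst.
have n0 : nrm p (cst 0 : E -> R) = 0.
  have [_] := nrmZ mOm 0 p0 I0; rewrite normr0 mul0r => n0; rewrite -[RHS]n0.
  by congr nrm; apply/funext => x /=; rewrite mulr0.
apply/eqP; rewrite eq_le nrm_ge0 andbT -n0; apply: (nrm_le mOm p0 mf I0 _).2.
by apply: filterS f0 => x /[apply] ->.
Qed.

Section lower_bound.
Variables (S2 S3 : R).
Hypotheses (S20 : 0 < S2) (S30 : 0 < S3).
Hypothesis hS2 : forall v : E -> R, H10 Om v -> nrm 2 v <= S2 * semi v.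
Hypothesis hS3 : forall v : E -> R, H10 Om v -> inLp (3 / 2)%:E Om v /\ nrm (3 / 2) v <= S3 * semi v.
Hypothesis triT : triangulation Om T.

(* Solved for g, the discrete equation bounds the datum by the residual: this
   forces the indicators to be at least of order h. *)
Lemma data_le u c (X U : R) : Xh Om T u -> Yh Om T c -> discrete_concentration D Om T u c ->
  0 <= X -> nrm 2 (residual Om D u c) <= X -> nrm 3 (wdiv Om u) <= X -> vnrm 2 u <= U ->
  nrm 1 (g D) <= X * (nrm 2 (cst 1) + U * (S2 / alpha D)
    + 2^-1 * (S3 * (S2 / alpha D * nrm 2 (g D)))
    + r0 D * (nrm 2 (cst 1) * (S2 * (S2 / alpha D)))).
Proof.
move=> Xu Yc eqn X0 nX dX uU.
have [bu _ bd _] := Xh_facts d0 oOm bOm triT Xu.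
have [hc h0c] := Yh_H1 oOm bOm Yc; have [Ic wc Gc] := hc.
have [bc _ bg _] : [/\ bdf Om c, weak_grad Om c (wgrad Om c), vbdf Om (wgrad Om c) & True].
  by case: Yc => /(CP1_facts d0 oOm bOm triT)[].
have mr := measurable_residual d0 oOm bOm triT Xu Yc.1 Ig.1.
have [Lc Ec] := H1_vL2 hc; have Lu := vbdf_vL2 mOm fOm bu.
have bdot : bdf Om (fun x => dot (u x) (wgrad Om c x)) by exact: bdf_dot.
have bdiv : bdf Om (fun x => 2^-1 * wdiv Om u x * c x) by bdf_tac.
have brc : bdf Om (fun x => r0 D * c x) by bdf_tac.
have b3 : bdf Om (fun x => dot (u x) (wgrad Om c x) + 2^-1 * wdiv Om u x * c x + r0 D * c x).
  by bdf_tac.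
have I2 f : bdf Om f -> inLp 2%:E Om f by exact: nrm_bdf.
have Ires : inLp 2%:E Om (residual Om D u c).
  have [I _] := nrm2B oOm (erefl _) Ig (I2 _ b3).
  rewrite (_ : residual Om D u c = (g D \- (fun x => dot (u x) (wgrad Om c x) +
    2^-1 * wdiv Om u x * c x + r0 D * c x)))//.
  by apply/funext => x; rewrite /residual /=; ring.
have en := concentration_energy d0 oOm bOm triT alpha0 r00 Ig S20 hS2 Xu eqn Yc.
have s0 := semi_ge0 Om c; have nc := hS2 h0c.
have a0 : 0 <= S2 / alpha D by rewrite divr_ge0// ltW.
(* In the equation tested with [c], the datum may be replaced by the residual plus the reaction
   term, since the skew form vanishes at (c, c). Hence the seminorm of [c] is itself linear in
   [X]. *)
have sX : semi c <= S2 / alpha D * X.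
  have := discrete_concentrationE d0 oOm bOm triT Xu eqn Yc Yc.
  rewrite (cform_diag d0 oOm bOm triT Xu h0c) addr0 (ip_sq mOm Lc) Ec => eq0.
  have [ir nr] := ip1_le mOm Ires Ic.
  have [ic _] := ip1_le mOm Ic Ic.
  have ib := bform_integrable oOm (half_wdiv_bdf d0 oOm bOm triT Xu) bu hc Ic.
  have z := cform_diag d0 oOm bOm triT Xu h0c.
  have e1 : ip1 (g D) c = ip1 (residual Om D u c) c + r0 D * ip1 c c.
    rewrite -[RHS]addr0 -z cformE bform_def !ip1E -(RintegralZl _ mOm ic).
    have i2 : (leb d).-integrable Om (EFin \o (fun x => r0 D * (c x * c x))).
      by have := integrableZl mOm (r0 D) ic; apply: eq_integrable.
    have i3 : (leb d).-integrable Om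
        (EFin \o (fun x => residual Om D u c x * c x + r0 D * (c x * c x))).
      by have := integrableD mOm ir i2; apply: eq_integrable.
    rewrite -(RintegralD mOm ir i2) -(RintegralD mOm i3 ib).
    by apply: eq_Rintegral => x _; rewrite /residual; ring.
  have e2 : alpha D * semi c ^+ 2 <= X * (S2 * semi c).
    have -> : alpha D * semi c ^+ 2 = ip1 (residual Om D u c) c by lra.
    rewrite (le_trans (ler_norm _))// (le_trans nr)//.
    by apply: ler_pM => //; exact: nrm_ge0.
  have [->|cn0] := eqVneq (semi c) 0; first by rewrite mulr_ge0.
  have cp : 0 < semi c by rewrite lt_neqAle eq_sym cn0.
  rewrite mulrAC ler_pdivlMr// -(ler_pM2r cp); lra.
have k0 := nrm_ge0 Om 2 (cst 1); have U0 := vnrm_ge0 Om 2 u.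
have [J1 j1] : inLp 1%:E Om (residual Om D u c) /\
    nrm 1 (residual Om D u c) <= nrm 2 (cst 1) * X.
  have [J j] := nrm1_le2 Ires; split => //.
  by rewrite (le_trans j)// ler_wpM2l.
have [J2 j2] : inLp 1%:E Om (fun x => dot (u x) (wgrad Om c x)) /\
    nrm 1 (fun x => dot (u x) (wgrad Om c x)) <= U * (S2 / alpha D * X).
  have [Lu1 Iu2] := Lu; have [Lc1 Ic2] := Lc.
  have [J j] : inLp 1%:E Om ((fun x => enorm (u x)) \* gnorm Om c) /\
      nrm 1 ((fun x => enorm (u x)) \* gnorm Om c) <= nrm 2 (fun x => enorm (u x)) * nrm 2 (gnorm Om c).
    by apply: nrm_mul => //; rewrite invr1; field.
  have [J' j'] : inLp 1%:E Om (fun x => dot (u x) (wgrad Om c x)) /\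
      nrm 1 (fun x => dot (u x) (wgrad Om c x)) <= nrm 1 ((fun x => enorm (u x)) \* gnorm Om c).
    apply: (nrm_le mOm ltr01 bdot.1 J); apply: aeW => x _ /=.
    by rewrite normrM !(ger0_norm (enorm_ge0 _)) cauchy_schwarz.
  rewrite -vnrmE -semiE in j; split => //.
  by rewrite (le_trans j')// (le_trans j)// ler_pM.
(* Here the factor [X] comes from the divergence in L^3, and [c] in L^{3/2} is bounded by the datum;
   using [X] for both would make the estimate quadratic. *)
have [J3 j3] : inLp 1%:E Om (fun x => 2^-1 * (wdiv Om u x * c x)) /\
    nrm 1 (fun x => 2^-1 * (wdiv Om u x * c x)) <=
      2^-1 * (X * (S3 * (S2 / alpha D * nrm 2 (g D)))).
  have [I32 n32] := hS3 h0c.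
  have Id : inLp 3%:E Om (wdiv Om u) by exact: nrm_bdf.
  have [J j] : inLp 1%:E Om (wdiv Om u \* c) /\
      nrm 1 (wdiv Om u \* c) <= nrm 3 (wdiv Om u) * nrm (3 / 2) c.
    by apply: nrm_mul => //; rewrite invr1; field.
  have [J' ->] := nrmZ mOm 2^-1 ltr01 J; split => //.
  rewrite ger0_norm// ler_wpM2l// (le_trans j)// ler_pM ?nrm_ge0//.
  by rewrite (le_trans n32)// ler_pM2l.
have [J4 j4] : inLp 1%:E Om (fun x => r0 D * c x) /\
    nrm 1 (fun x => r0 D * c x) <= r0 D * (nrm 2 (cst 1) * (S2 * (S2 / alpha D * X))).
  have [J j] := nrm1_le2 Ic; have [J' ->] := nrmZ mOm (r0 D) ltr01 J; split => //.
  rewrite gtr0_norm// ler_pM2l// (le_trans j)// ler_wpM2l// (le_trans nc)//.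
  by rewrite ler_pM2l.
have [J12 j12] := nrmD mOm (lexx _) J1 J2.
have [J123 j123] := nrmD mOm (lexx _) J12 J3.
have [_ j1234] := nrmD mOm (lexx _) J123 J4.
have gE : g D = ((residual Om D u c \+ (fun x => dot (u x) (wgrad Om c x)))
    \+ (fun x => 2^-1 * (wdiv Om u x * c x))) \+ (fun x => r0 D * c x).
  by apply/funext => x; rewrite /residual /=; ring.
rewrite -gE in j1234.
move: j1 j2 j3 j4 j12 j123 j1234; lra.
Qed.

End lower_bound.

End data.

Lemma Lp_oo_le {R : realType} {d : nat} (A : set 'rV[R]_d) (f : 'rV[R]_d -> R) (M : R) :
  0 <= M -> {ae leb d, forall x, A x -> `|f x| <= M} -> (Lp +oo A f <= M%:E)%E.
Proof.
move=> M0 fM; rewrite /Lp unlock; case: ifPn => [_|_]; last by rewrite lee_fin.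
apply/ess_supP; apply: filterS fM => x fM /=; rewrite lee_fin indicE.
by case: (boolP (x \in A)) => [/set_mem /fM|_]; rewrite ?mul1r// mul0r normr0.
Qed.

(** * The exact concentration for a vanishing datum *)

Section zero_data.
Context {R : realType} {d : nat}.
Local Notation E := 'rV[R]_d.
Variables (Om : set E) (D : data R d) (u : E -> E) (p C : E -> R) (S2 : R).
Hypotheses (oOm : open Om) (bOm : bounded_set Om).
Hypotheses (alpha0 : 0 < alpha D) (r00 : 0 < r0 D) (Ig : inLp 2%:E Om (g D)).
Hypothesis hS2 : forall v, H10 Om v -> nrm Om 2 v <= S2 * semi Om v.
Hypotheses (hVa : Va D Om u p C) (bu : vbdf Om u).
Implicit Types (phi : E -> R).

Let mOm : measurable Om. Proof. exact: open_measurable_rV. Qed.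
Let fOm : (leb d Om < +oo)%E. Proof. exact: leb_bounded_fin. Qed.

(* The admissible multiplier is (phi^2 - mean(phi^2)) / 2. *)
Lemma divergence_free_test phi : test_function Om phi ->
  \int[leb d]_(x in Om) (dot (u x) (wgrad Om phi x) * phi x) = 0.
Proof.
move=> [sphi _ _]; set mean := (\int[leb d]_(x in Om) (2^-1 * (phi x * phi x))) / fine (leb d Om).
pose q := (cst 2^-1 \* (phi \* phi) \+ cst (- mean))%R : E -> R.
have sq : smooth q.
  by apply: smoothD; [apply: smoothM; [exact: smooth_cst|exact: smoothM]|exact: smooth_cst].
have [wq qE bq] := smooth_wgrad oOm bOm sq.
have [wphi phiE bphi] := smooth_wgrad oOm bOm sphi.
have bdq := smooth_bdf bOm sq; have bdphi := smooth_bdf bOm sphi.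
have b2 : bdf Om (fun x => 2^-1 * (phi x * phi x)) by bdf_tac.
have Mq : spaceM Om q.
  split; [split|split].
  - by apply: nrm_bdf => //; exact: bdq.
  - exists (wgrad Om q) => //; split; first by apply: vmeas_measurable_fun => //; exact: vbdf_vmeas.
    have [] // : inLp (3 / 2)%:E Om (fun x => enorm (wgrad Om q x)).
    by apply: nrm_bdf => //; exact: bdf_enorm.
  - exact: nrm_bdf.
  - rewrite /q (RintegralD mOm (bdf_integrable mOm fOm b2)) ?Rintegral_cst//; last first.
      by apply: bdf_integrable => //; exact: bdf_cst.
    have [m0|m0] := eqVneq (fine (leb d Om)) 0; last by rewrite /mean; field.
    rewrite m0 mulr0 addr0.
    have l0 : leb d Om = 0%E by rewrite -[LHS]fineK ?m0// ge0_fin_numE.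
    have /integrableP[m _] := bdf_integrable mOm fOm b2.
    by rewrite /Rintegral (null_set_integral _ m).
case: hVa => _ _ _ [_ /(_ _ Mq) <- _].
apply: ae_eq_Rintegral => //.
- by apply: (bdfM (bdf_dot bu bphi) bdphi).1.
- by apply: (bdf_dot bq bu).1.
- apply: filterS2 qE phiE => x qE phiE Ox; rewrite qE// phiE// dotC.
  rewrite /dot mulr_suml; apply: eq_bigr => i _; rewrite !mxE.
  have Dp := smooth_is_derive i x sphi.
  have D2 := is_deriveM Dp Dp.
  have D3 := is_deriveM (is_derive_cst (2^-1 : R) x (delta_mx ord0 i : E)) D2.
  have [_ E1] := is_deriveD D3 (is_derive_cst (- mean) x (delta_mx ord0 i : E)).
  have -> : partial i q x = phi x * partial i phi x.
    rewrite /partial; apply: etrans E1 _.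
    rewrite addr0 scaler0 addr0 /cst/=.
    change (2^-1 * (phi x * partial i phi x + phi x * partial i phi x) = phi x * partial i phi x).
    by field.
  by ring.
Qed.

(** The exact equation is tested with [C]. Its convection form vanishes on test functions because u
    is divergence free, and by density at [C] because u is bounded; the two remaining terms have a
    sign. *)
Lemma zero_data : nrm Om 1 (g D) = 0 -> semi Om C = 0 /\ nrm Om 2 C = 0.
Proof.
move=> g0; case: (hVa) => _ _ YC [_ _ /(_ _ YC) eqC].
have [hC _] := H10_approx oOm bOm YC; have [IC _ _] := hC.
have [Ig1 _] := nrm1_le2 oOm bOm Ig.
have gae := nrm_eq0_ae oOm ltr01 Ig1 g0.
have g2 : nrm Om 2 (g D) = 0 by apply: (ae0_nrm oOm bOm) => //; exact: Ig.1.
have b0 : bdf Om (fun=> 0 : R) by exact: bdf_cst.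
have z : bform Om (fun=> 0) u C C = 0.
  apply: (bform_H10_eq0 oOm bOm b0 bu _ YC) => phi tphi.
  rewrite bform_def; apply: etrans (divergence_free_test tphi).
  by apply: eq_Rintegral => x _; rewrite !mul0r add0r.
have z2 : \int[leb d]_(x in Om) (dot (u x) (wgrad Om C x) * C x) = 0.
  apply: etrans z; rewrite bform_def.
  by apply: eq_Rintegral => x _; rewrite !mul0r add0r.
have [LC EC] := H1_vL2 hC.
move: eqC; rewrite z2 addr0 -!ip1E -ipE (ip_sq mOm LC) EC (ip1_sq mOm IC) => eqC.
have [_ n1] := ip1_le mOm Ig IC; have n2 := le_trans (ler_norm _) n1.
rewrite g2 mul0r in n2.
have s0 := semi_ge0 Om C.
have a1 : 0 <= alpha D * semi Om C ^+ 2 by rewrite mulr_ge0 ?sqr_ge0// ltW.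
have a2 : 0 <= r0 D * nrm Om 2 C ^+ 2 by rewrite mulr_ge0 ?sqr_ge0// ltW.
split.
  have : alpha D * semi Om C ^+ 2 = 0 by lra.
  by move=> /eqP; rewrite mulf_eq0 gt_eqF//= sqrf_eq0 => /eqP.
have : r0 D * nrm Om 2 C ^+ 2 = 0 by lra.
by move=> /eqP; rewrite mulf_eq0 gt_eqF//= sqrf_eq0 => /eqP.
Qed.

End zero_data.

(** * Convergence of the scheme for a fixed mesh *)

Section convergence.
Context {R : realType} {d : nat}.
Local Notation E := 'rV[R]_d.
Variables (Om : set E) (T : {fset {fset E}}) (D : data R d) (Km KM cf1 : R).
Hypotheses (d0 : (0 < d)%N) (oOm : open Om) (bOm : bounded_set Om).
Hypothesis triT : triangulation Om T.
Hypothesis hD : data_assumptions D Om Km KM cf1.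
Hypothesis hf0 : vinLp 2%:E Om (f0 D).
Variables (S2 S6 : R).
Hypotheses (S20 : 0 < S2) (S60 : 0 < S6).
Hypothesis hS2 : forall v, H10 Om v -> nrm Om 2 v <= S2 * semi Om v.
Hypothesis hS6 : forall v, H10 Om v -> inLp 6%:E Om v /\ nrm Om 6 v <= S6 * semi Om v.
Variables (C : E -> R) (A B N : R).
Hypotheses (h0C : H10 Om C) (GC : inLp 3%:E Om (gnorm Om C)).
Hypotheses (nA : nrm Om 3 (gnorm Om C) <= A) (B0 : 0 <= B).
Hypothesis CB : {ae leb d, forall x, Om x -> `|C x| <= B}.
Hypotheses (NE : N = S6 * A + B).
Hypothesis hN : N <= alpha D * mu D * Km / (2 * Num.sqrt 2 * rho D * cf1 * S2).
Variables (gamma h cI c1 : R).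
Hypotheses (gamma0 : 0 < gamma) (h0 : 0 < h) (cI0 : 0 < cI).
Hypothesis inv : forall z, Xh Om T z ->
  vnrm Om 3 z <= cI * h `^ (d%:R / 3 - d%:R / 2) * vnrm Om 2 z.
Hypothesis hgamma : gamma_star D Om Km KM cf1 S2 cI h < gamma.
Variables (v : E -> E) (p q : E -> R).
Hypothesis hVah : Vah D Om T v p q.
Hypothesis hq : cI * h `^ (d%:R / 3 - d%:R / 2) * S6 * semi Om (C \- q) <= N / 2.
Variables (u : nat -> E -> E) (pr c : nat -> E -> R).
Hypothesis hit : iterates D Om T gamma u pr c.
Local Notation nrm := (nrm Om).
Local Notation vnrm := (vnrm Om).
Local Notation semi := (semi Om).

Let mOm : measurable Om. Proof. exact: open_measurable_rV. Qed.
Let fOm : (leb d Om < +oo)%E. Proof. exact: leb_bounded_fin. Qed.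

Lemma iterate_error n : alpha D * semi (c n.+1 \- q) <= N * vnrm 2 (fun x => u n.+1 x - v x).
Proof.
have [_ _ hV] := hit; have [Xu _ Yc [_ _ dc]] := hV n.
have [Xv _ Yq [_ _ dq]] := hVah.
have [[mu0 rho0 beta0 alpha0 r00] hK _ _ Ig] := hD.
apply: (concentration_error d0 oOm bOm triT r00 S60 hS6 Xu Xv Yc Yq dc dq
  h0C GC nA B0 CB NE _ hq).
by apply: inv; exact: XhB.
Qed.

Lemma iterates_converge e : 0 < e -> exists n0, forall n, (n0 <= n)%N ->
  vnrm 2 (fun x => u n.+1 x - v x) <= e.
Proof.
move=> e0; have [Xu0 Yc0 hV] := hit.
have [[mu0 rho0 beta0 alpha0 r00] hK _ [cf10 f1l f10] Ig] := hD.
have [Xv _ Yq _] := hVah.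
have /andP[Km0 KmM] := Km_gt0_KM hK.
have Xu n : Xh Om T (u n) by case: n => [|n]; [exact: Xu0|case: (hV n)].
have Yc n : Yh Om T (c n) by case: n => [|n]; [exact: Yc0|case: (hV n)].
have Lf0 : vL2 Om (f0 D).
  case: hf0 => mf ff; have vf := measurable_fun_vmeas mf; split => //.
  by split => //; exact: measurable_enorm.
have Ic n : inLp 2%:E Om (c n) by have [[]] := Yh_H1 oOm bOm (Yc n).
have inv' := inv; set y := h `^ (d%:R / 3 - d%:R / 2) in inv'.
have y0 : 0 <= y by exact: powR_ge0.
have l0 : 0 <= cI * y by rewrite mulr_ge0// ltW.
pose F := vnrm 2 (f0 D) + cf1 * (S2 ^+ 2 / alpha D) * nrm 2 (g D).
have Fe : Fconst D Om cf1 S2 = F.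
  by rewrite /Fconst /F /vLp vnrmE !nrmE.
have F0 : 0 <= F.
  by rewrite addr_ge0 ?vnrm_ge0// mulr_ge0 ?nrm_ge0// mulr_ge0 ?divr_ge0 ?sqr_ge0// ltW.
have m0 : 0 < mu D * Km / rho D by rewrite divr_gt0// mulr_gt0.
have BB0 : 0 <= beta D / rho D * (cI * y) ^+ 3 by rewrite mulr_ge0 ?exprn_ge0// divr_ge0// ltW.
(* All sequences start at index 1: the initial concentration is arbitrary in the discrete space and
   satisfies no equation, so neither its energy nor its error is controlled. *)
apply: (@perturbed_contraction _ (fun n => vnrm 2 (u n.+1))
  (fun n => vnrm 2 (fun x => u n.+1 x - v x)) (fun n => vnrm 2 (fun x => u n.+2 x - u n.+1 x))
  (fun n => cf1 * nrm 2 (c n.+1 \- q)) gamma (mu D * Km / rho D) F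
  (beta D / rho D * (cI * y) ^+ 3)) => //; try by move=> n; exact: vnrm_ge0.
- move=> n; apply: le_trans (velocity_bound d0 oOm bOm triT mu0 rho0 beta0 hK Lf0 cf10 f1l f10
    gamma0 (Xu n.+1) (Ic n.+1) (hV n.+1)) _.
  rewrite lerD2l lerD2l -mulrA ler_pM2l//.
  have [Xn _ Yn [_ _ dn]] := hV n.
  have := concentration_energy d0 oOm bOm triT alpha0 r00 Ig S20 hS2 Xn dn Yn.
  have := hS2 (Yh_H1 oOm bOm Yn).2 => n1 n2; rewrite (le_trans n1)//.
  rewrite (_ : S2 ^+ 2 / alpha D * _ = S2 * (S2 / alpha D * nrm 2 (g D))); last by ring.
  by rewrite ler_pM2l.
- move=> n; exact: (velocity_step d0 oOm bOm triT mu0 rho0 beta0 hK Lf0 cf10 f1l f10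
    gamma0 (Xu n.+1) (Yc n.+1) (hV n.+1) hVah (erefl _) l0 inv').
- move=> n; have [en enE] : {en | en = c n.+1 \- q} by exists (c n.+1 \- q).
  have ie := iterate_error n; rewrite -enE in ie *.
  have h0e := (Yh_H1 oOm bOm (YhB oOm bOm enE (Yc n.+1) Yq)).2.
  have n1 := hS2 h0e; set W := vnrm 2 _ in ie *.
  have W0 : 0 <= W by exact: vnrm_ge0.
  have q0 : 0 < Num.sqrt 2 :> R by rewrite sqrtr_gt0.
  have q2 : Num.sqrt 2 ^+ 2 = 2 :> R by rewrite sqr_sqrtr.
  (* Equivalent to 1 / (2 sqrt 2) <= 3/8, the share of the coercivity granted to the concentration
     in [perturbed_contraction]. *)
  have q43 : 4 / 3 <= Num.sqrt 2 :> R.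
    by rewrite -(@ler_pXn2r _ 2)// ?nnegrE ?q2 ?ltW//; lra.
  apply: (@le_trans _ _ (cf1 * S2 * (N / alpha D) * W)).
    rewrite -!mulrA ler_pM2l// (le_trans n1)// ler_pM2l//.
    by rewrite mulrCA mulrC ler_pdivlMr// mulrC.
  rewrite ler_wpM2r//.
  have : cf1 * S2 * (N / alpha D) <= cf1 * S2 * (alpha D * mu D * Km /
      (2 * Num.sqrt 2 * rho D * cf1 * S2) / alpha D).
    by rewrite ler_pM2l ?mulr_gt0// ler_pM2r ?invr_gt0.
  move/le_trans; apply.
  rewrite (_ : _ * _ = mu D * Km / rho D * (2 * Num.sqrt 2)^-1); last first.
    by field; rewrite !gt_eqF.
  rewrite [leRHS]mulrC ler_pM2l// -[leRHS]invrK lef_pV2 ?posrE ?mulr_gt0//; lra.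
- have K0 : 0 <= KM by rewrite (le_trans (ltW Km0)).
  (* The exponent of [y] is d/3 - d/2 = - d/6. *)
  have y6 : h `^ (- d%:R) = y ^+ 6.
    rewrite /y -powR_mulrn ?powR_ge0// -powRrM; congr (_ `^ _).
    by field.
  have t1 : 32 * beta D ^+ 2 * rho D / (27 * mu D ^+ 3 * Km ^+ 3)
    * cI ^+ 6 * y ^+ 6 * F ^+ 2 < gamma.
    apply: le_lt_trans hgamma; rewrite /gamma_star Fe y6 lerDr.
    rewrite mulr_ge0// mulr_ge0//.
      rewrite mulr_ge0 ?powR_ge0// mulr_ge0 ?exprn_ge0 ?(ltW cI0)//.
      by rewrite divr_ge0 ?mulr_ge0 ?(ltW beta0) ?(ltW rho0).
    by rewrite addr_ge0// divr_ge0 ?mulr_ge0 ?exprn_ge0 ?(ltW rho0) ?(ltW mu0) ?(ltW Km0).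
  (* Multiplied by the coercivity mu Km / rho, the second summand of [gamma_star] is 32/27 times the
     square that has to stay below gamma times that coercivity. *)
  have t2 : (beta D / rho D * (cI * y) ^+ 3) ^+ 2 * (F / (mu D * Km / rho D)) ^+ 2 <=
    32 * beta D ^+ 2 * rho D / (27 * mu D ^+ 3 * Km ^+ 3)
    * cI ^+ 6 * y ^+ 6 * F ^+ 2 * (mu D * Km / rho D).
    set w := (beta D * cI ^+ 3 * y ^+ 3 * F / (mu D * Km)) ^+ 2.
    have -> : (beta D / rho D * (cI * y) ^+ 3) ^+ 2 * (F / (mu D * Km / rho D)) ^+ 2 = w.
      by rewrite /w; field; rewrite !gt_eqF.
    have -> : 32 * beta D ^+ 2 * rho D / (27 * mu D ^+ 3 * Km ^+ 3)
      * cI ^+ 6 * y ^+ 6 * F ^+ 2 * (mu D * Km / rho D) = 32 / 27 * w.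
      by rewrite /w; field; rewrite !gt_eqF.
    have : 0 <= w by exact: sqr_ge0.
    lra.
  by apply: le_lt_trans t2 _; rewrite ltr_pM2r.
Qed.

End convergence.

Lemma le_sum7 {R : realType} (x1 x2 x3 x4 x5 x6 x7 : \bar R) :
  (0 <= x1 -> 0 <= x2 -> 0 <= x3 -> 0 <= x4 -> 0 <= x5 -> 0 <= x6 -> 0 <= x7 ->
  x1 + x6 <= x1 + x2 + x3 + x4 + x5 + x6 + x7 /\
  x3 <= x1 + x2 + x3 + x4 + x5 + x6 + x7)%E.
Proof.
move=> h1 h2 h3 h4 h5 h6 h7; split.
  apply: (@le_trans _ _ (x1 + x2 + x3 + x4 + x5 + x6)%E); last by rewrite leeDl.
  by apply: leeD => //; rewrite -!addeA leeDl// !adde_ge0.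
rewrite -!addeA; apply: (@le_trans _ _ (x3 + (x4 + (x5 + (x6 + x7))))%E).
  by rewrite leeDl// !adde_ge0.
by rewrite [leRHS]addeA leeDr// adde_ge0.
Qed.

(** * Nonnegativity of the indicators and final assembly *)

Section indicators.
Context {R : realType} {d : nat}.
Local Notation E := 'rV[R]_d.
Implicit Types (k : {fset E}) (u : E -> E).

Lemma diam_ge0 (A : set E) : 0 <= diam A.
Proof.
rewrite /diam; set S := [set r | _].
have [[[r Sr] hub]|/sup_out ->] := pselect (has_sup S); last exact: lexx.
apply: (@le_trans _ _ r); last by apply: sup_upper_bound => //; split => //; exists r.
by case: Sr => x [y [_ _ ->]]; exact: enorm_ge0.
Qed.

Lemma etaD1_ge0 (D : data R d) Om k gh u c : (0 <= etaD1 D Om k gh u c)%E.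
Proof.
apply: adde_ge0; first by apply: mule_ge0; [rewrite lee_fin diam_ge0|exact: Lp_ge0].
apply: mule_ge0; first by rewrite lee_fin.
by apply: sume_ge0 => e _; apply: mule_ge0; [rewrite lee_fin powR_ge0|exact: poweR_ge0].
Qed.

Lemma etaD3_ge0 Om k u : (0 <= etaD3 Om k u)%E.
Proof.
apply: adde_ge0; first by apply: mule_ge0; [rewrite lee_fin diam_ge0|exact: Lp_ge0].
by apply: sume_ge0 => e _; apply: mule_ge0; [rewrite lee_fin powR_ge0|exact: poweR_ge0].
Qed.

End indicators.

Theorem theorem4p3 (R : realType) (d : nat) (hd : d = 2%N \/ d = 3%N)
  (Om : set 'rV[R]_d) (hOm : domain Om)
  (D : data R d) (Km KM cf1 : R) (hD : data_assumptions D Om Km KM cf1)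
  (* Sobolev constants *)
  (S0 : R -> R)
  (hS0 : forall p : R, 1 <= p <= 6 -> 0 < S0 p /\
     forall v, H10 Om v ->
       (Lp p%:E Om v <= (S0 p)%:E * W1seminorm 2%:E Om v)%E)
  (* regular and uniformly regular family of triangulations, indexed by h *)
  (H : set R) (T : R -> {fset {fset 'rV[R]_d}}) (sigma beta0 : R)
  (hT : forall h, H h ->
     [/\ 0 < h, triangulation Om (T h) & meshsize (T h) = h])
  (hsigma : forall h, H h -> forall k, k \in T h ->
     diam (hull k) / indiam (hull k) <= sigma)
  (hbeta0 : 0 < beta0 /\ forall h, H h -> forall k, k \in T h ->
     beta0 * h <= diam (hull k))
  (* inverse inequality *)
  (cI : R) (hcI0 : 0 < cI)
  (hcI : forall h, H h -> forall p : R, p = 3 \/ p = 6 ->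
     (forall v, Xh Om (T h) v ->
        (vLp p%:E Om v
           <= (cI * h `^ (d%:R / p - d%:R / 2))%:E * vLp 2%:E Om v)%E) /\
     (forall q, CP1 Om (T h) q ->
        (Lp p%:E Om q
           <= (cI * h `^ (d%:R / p - d%:R / 2))%:E * Lp 2%:E Om q)%E))
  (* interpolation operator *)
  (r : R -> ('rV[R]_d -> R) -> ('rV[R]_d -> R)) (ck ce : R)
  (hr : forall h, H h -> clement Om (T h) (r h) ck ce)
  (* piecewise constant approximation of the datum g *)
  (gh : R -> 'rV[R]_d -> R)
  (hgh : forall h, H h -> piecewise_constant (T h) (gh h))
  (* exact and discrete solutions, a priori error estimate *)
  (u : 'rV[R]_d -> 'rV[R]_d) (p C : 'rV[R]_d -> R) (hVa : Va D Om u p C)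
  (uh : R -> 'rV[R]_d -> 'rV[R]_d) (ph Ch : R -> 'rV[R]_d -> R)
  (hVah : forall h, H h -> Vah D Om (T h) (uh h) (ph h) (Ch h))
  (c1 : R) (hc10 : 0 < c1)
  (hc1 : forall h, H h ->
     (W1seminorm 2%:E Om (C \- Ch h)%R
      + vLp 2%:E Om (fun x => u x - uh h x)%R
      + W1seminorm (3 / 2)%:E Om (p \- ph h)%R <= (c1 * h)%:E)%E)
  (* constant in the bound of the correction velocities *)
  (c2 : R)
  (* regularity and smallness of the exact solution *)
  (hf0 : vinLp 2%:E Om (f0 D))
  (hC2 : H2 Om C)
  (hu13 : forall i, W1 3%:E Om (fun x => u x ord0 i))
  (huoo : vinLp +oo%E Om u)
  (hp2 : H2 Om p)
  (hsmall1 : ((S0 6)%:E * W1seminorm 3%:E Om C + Lp +oo Om C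
     <= (alpha D * mu D * Km
         / (2 * Num.sqrt 2 * rho D * cf1 * S0 2))%:E)%E)
  (hsmall2 : ((S0 6)%:E * W1seminorm 3%:E Om C + Lp +oo Om C
     <= (alpha D * mu D * Km / (8 * rho D * cf1 ^+ 2 * S0 2))%:E)%E) :
  exists c3 : R, 0 < c3 /\
  forall h, H h ->
  (h%:E <= ((1 / (2 * cI * c1))%:E *
      (W1seminorm 3%:E Om C + (S0 6)^-1%:E * Lp +oo Om C))
      `^ (6 / (6 - d%:R)))%E ->
  forall (gamma : R), 0 < gamma ->
  Num.max (gamma_star D Om Km KM cf1 (S0 2) cI h)
          (gamma_star2 D Om Km cf1 (S0 2) cI h) < gamma ->
  forall (ui : nat -> 'rV[R]_d -> 'rV[R]_d) (pri Ci : nat -> 'rV[R]_d -> R),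
  iterates D Om (T h) gamma ui pri Ci ->
  (vLp 2%:E Om (ui 0%N) <= (L1const D Om Km cf1 (S0 2))%:E)%E ->
  forall vr : nat -> 'rV[R]_d -> 'rV[R]_d,
  (forall i, correction_velocity Om (T h) (r h) c2 (ui i.+1) (vr i)) ->
  exists i0 : nat, forall i, (i0 <= i)%N ->
  (vLp 2%:E Om (fun x => u x - ui i.+1 x)%R
   + H1norm Om (C \- Ci i.+1)%R
   + vLp 3%:E Om (vr i)
   <= c3%:E * \sum_(k <- T h)
       (etaD1 D Om k (gh h) (ui i.+1) (Ci i.+1)
        + etaD2 D k gamma (ui i) (Ci i) (ui i.+1) (pri i.+1)
        + etaD3 Om k (ui i.+1)
        + etaL1 k (ui i) (ui i.+1)
        + etaL2 k (Ci i) (Ci i.+1)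
        + (diam (hull k))%:E * Lp 2%:E (elt k) (g D \- gh h)%R
        + vLp 2%:E (elt k) (fun x => rhs D C x - fh D k C)%R))%E.
Proof.
have d0 : (0 < d)%N by case: hd => ->.
have d6 : 0 < 6 - d%:R :> R by case: hd => ->; lra.
have [oOm bOm _ _ _] := hOm.
have mOm : measurable Om := open_measurable_rV oOm.
have fOm : (leb d Om < +oo)%E := leb_bounded_fin bOm mOm.
have [[mu0 rho0 beta0' alpha0 r00] hK _ [cf10 f1l f10] Ig] := hD.
have [b0 hb] := hbeta0.
have hS q : 1 <= q <= 6 -> 0 < S0 q /\ forall v : 'rV[R]_d -> R, H10 Om v ->
    inLp q%:E Om v /\ nrm Om q v <= S0 q * semi Om v.
  move=> /hS0[Sq hSq]; split => // v hv.
  have [h1 _] := H10_approx oOm bOm hv; have [[mv _] _ _] := h1.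
  by apply: inLp_le => //; rewrite EFinM -(W1seminormE h1); exact: hSq.
have [S20 hS2'] : 0 < S0 2 /\ forall v : 'rV[R]_d -> R, H10 Om v ->
    inLp 2%:E Om v /\ nrm Om 2 v <= S0 2 * semi Om v by apply: hS; lra.
have hS2 v : H10 Om v -> nrm Om 2 v <= S0 2 * semi Om v by move=> /hS2'[].
have [S60 hS6] : 0 < S0 6 /\ forall v : 'rV[R]_d -> R, H10 Om v ->
    inLp 6%:E Om v /\ nrm Om 6 v <= S0 6 * semi Om v by apply: hS; lra.
have [S30 hS3] : 0 < S0 (3 / 2) /\ forall v : 'rV[R]_d -> R, H10 Om v ->
    inLp (3 / 2)%:E Om v /\ nrm Om (3 / 2) v <= S0 (3 / 2) * semi Om v by apply: hS; lra.
have [_ _ h0C [_ _ _]] := hVa.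
have [hC _] := H10_approx oOm bOm h0C; have [IC wC G2C] := hC.
have WC0 : (0 <= W1seminorm 3%:E Om C)%E by exact: Lp_ge0.
have LC0 : (0 <= Lp +oo Om C)%E by exact: Lp_ge0.
(* The norms are extended reals; the finite right-hand side of the smallness condition forces them
   to be finite. *)
have WCfin : (W1seminorm 3%:E Om C < +oo)%E.
  rewrite ltNge leye_eq; apply/negP => /eqP W; move: hsmall1.
  by rewrite W gt0_muley ?lte_fin// addye ?leye_eq// gt_eqF// (lt_le_trans _ LC0)// ltNyr.
have LCfin : (Lp +oo Om C < +oo)%E.
  rewrite ltNge leye_eq; apply/negP => /eqP L; move: hsmall1.
  rewrite L addey ?leye_eq// gt_eqF// (@lt_le_trans _ _ 0%E) ?ltNyr//.
  by rewrite mule_ge0// lee_fin ltW.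
have GC : inLp 3%:E Om (gnorm Om C) by split => //; case: G2C.
pose A := nrm Om 3 (gnorm Om C); pose B := fine (Lp +oo Om C).
have WE : W1seminorm 3%:E Om C = A%:E by rewrite /A -LpnE.
have LE : Lp +oo Om C = B%:E by rewrite /B fineK// ge0_fin_numE.
have A0 : 0 <= A by exact: nrm_ge0.
have B0 : 0 <= B by rewrite -lee_fin -LE.
have CB : {ae leb d, forall x, Om x -> `|C x| <= B} by apply: Lp_oo_ae; rewrite LE.
pose N := S0 6 * A + B.
have N0 : 0 <= N by rewrite addr_ge0// mulr_ge0// ltW.
have hN : N <= alpha D * mu D * Km / (2 * Num.sqrt 2 * rho D * cf1 * S0 2).
  by move: hsmall1; rewrite WE LE -EFinM -EFinD lee_fin.
have bu : vbdf Om u.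
  have [mu' ufin] := huoo; have vu := measurable_fun_vmeas mu'.
  apply: enorm_vbdf => //; split; first exact: measurable_enorm.
  exists (fine (vLp +oo Om u)); first by rewrite fine_ge0// Lp_ge0.
  apply: Lp_oo_ae; rewrite fineK//.
  have := ufin; rewrite -ge0_fin_numE//; exact: Lp_ge0.
have Lu := vbdf_vL2 mOm fOm bu.
pose k := 1 / (2 * cI * c1).
have k0 : 0 < k by rewrite divr_gt0// !mulr_gt0.
have hcond h : (h%:E <= ((1 / (2 * cI * c1))%:E *
      (W1seminorm 3%:E Om C + (S0 6)^-1%:E * Lp +oo Om C)) `^ (6 / (6 - d%:R)))%E ->
    h <= (k * (A + B / S0 6)) `^ (6 / (6 - d%:R)).
  by rewrite WE LE -lee_fin (mulrC B).
have [g0|gn0] := eqVneq (nrm Om 1 (g D)) 0.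
  exists 1; split => // h Hh /hcond hle.
  have [s0 n0] := zero_data oOm bOm alpha0 r00 Ig hVa bu g0.
  have Gae : {ae leb d, forall x, Om x -> gnorm Om C x = 0}.
    by apply: (nrm_eq0_ae oOm (ltr0n _ 2) G2C); rewrite -semiE.
  have A00 : A = 0 by apply: (ae0_nrm oOm bOm) => //; case: GC.
  have B00 : B = 0.
    apply/eqP; rewrite eq_le B0 andbT -lee_fin -LE; apply: Lp_oo_le => //.
    by apply: filterS (nrm_eq0_ae oOm (ltr0n _ 2) IC n0) => x /[apply] ->; rewrite normr0.
  have [h0 _ _] := hT _ Hh; move: hle; rewrite A00 B00 mul0r addr0 mulr0 powR0; last first.
    by rewrite mulf_neq0// ?invr_neq0// gt_eqF.
  by rewrite leNgt h0.
have G0 : 0 < nrm Om 1 (g D) by rewrite lt_neqAle eq_sym gn0 nrm_ge0.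
(* The mesh restriction bounds every admissible h by [h1]; therefore the velocity bound [U], and
   with it [Q] and [M], do not depend on h. *)
pose h1 := (k * (A + B / S0 6)) `^ (6 / (6 - d%:R)).
have h10 : 0 <= h1 by exact: powR_ge0.
pose U := vnrm Om 2 u + c1 * h1 + h1.
have U0 : 0 <= U by rewrite !addr_ge0 ?vnrm_ge0 ?mulr_ge0// ltW.
pose Q := nrm Om 2 (cst 1) + U * (S0 2 / alpha D)
    + 2^-1 * (S0 (3 / 2) * (S0 2 / alpha D * nrm Om 2 (g D)))
    + r0 D * (nrm Om 2 (cst 1) * (S0 2 * (S0 2 / alpha D))).
have Q0 : 0 <= Q.
  have q1 := nrm_ge0 Om 2 (cst 1 : 'rV[R]_d -> R); have q2 := nrm_ge0 Om 2 (g D).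
  have q3 : 0 <= S0 2 / alpha D by rewrite divr_ge0// ltW.
  by rewrite /Q !addr_ge0// !mulr_ge0// ?invr_ge0 ?(ltW S20) ?(ltW S30) ?(ltW r00) ?(ltW alpha0).
(* Chosen so that [data_le] with X = x / (beta0 h), x being the sum of the indicators, reads h <= M
   x. *)
pose M := Q / (beta0 * nrm Om 1 (g D)).
have M0 : 0 <= M by rewrite divr_ge0// mulr_ge0// ltW.
have c30 : 0 < `|c2| + (c1 + 1) * (2 + S0 2) * M + 1.
  apply: ltr_wpDl => //; apply: addr_ge0 => //; apply: mulr_ge0 => //.
  by apply: mulr_ge0; apply: addr_ge0 => //; exact: ltW.
(* The velocity error and the concentration seminorm are each at most (c1 + 1) h, and the L^2 part
   of the H^1 norm adds [S0 2] times the latter; with h <= M x this gives the middle term. The first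
   term accounts for [vr], and 1 ensures positivity. *)
exists (`|c2| + (c1 + 1) * (2 + S0 2) * M + 1); split => //.
move=> h Hh /hcond hle gamma gamma0 hgam ui pri Ci hit _ vr hvr.
have [h0 triT _] := hT _ Hh.
have [Xv Mp Yq _] := hVah _ Hh.
have [bv _ _ _] := Xh_facts d0 oOm bOm triT Xv.
have h0q : H10 Om (Ch h) by case: Yq.
have [dl dlE] : {dl | dl = C \- Ch h} by exists (C \- Ch h).
have h0dl := H10B oOm bOm dlE h0C h0q.
have [hdl _] := H10_approx oOm bOm h0dl.
have Luv := vL2B mOm Lu (vbdf_vL2 mOm fOm bv).
have [es eu] : semi Om dl <= c1 * h /\ vnrm Om 2 (fun x => u x - uh h x) <= c1 * h.
  have := hc1 _ Hh; rewrite -dlE (W1seminormE hdl) (vLpE Luv.1.2) -EFinD => H1.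
  have H2 : ((semi Om dl + vnrm Om 2 (fun x => u x - uh h x))%:E <= (c1 * h)%:E)%E.
    by apply: le_trans H1; apply: leeDl; exact: Lp_ge0.
  rewrite lee_fin in H2.
  by split; apply: le_trans H2; rewrite ?lerDl ?lerDr ?vnrm_ge0 ?semi_ge0.
have inv3 z : Xh Om (T h) z ->
    vnrm Om 3 z <= cI * h `^ (d%:R / 3 - d%:R / 2) * vnrm Om 2 z.
  move=> Xz; have [bz _ _ _] := Xh_facts d0 oOm bOm triT Xz.
  have [+ _] := hcI _ Hh 3 (or_introl (erefl (3 : R))); move=> /(_ _ Xz).
  have I3 q : 0 < q -> inLp q%:E Om (fun x => enorm (z x)).
    by move=> q0; apply: nrm_bdf => //; exact: bdf_enorm.
  by rewrite (vLpE (I3 3 _))// (vLpE (I3 2 _))// -EFinM lee_fin.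
have hq : cI * h `^ (d%:R / 3 - d%:R / 2) * S0 6 * semi Om (C \- Ch h) <= N / 2.
  rewrite -dlE.
  have y0 : 0 <= h `^ (d%:R / 3 - d%:R / 2) by exact: powR_ge0.
  (* The exponent d/3 - d/2 + 1 = (6 - d)/6 is the inverse of the one in the mesh restriction, which
     [k] then turns into exactly N / 2. *)
  have hp : h `^ (d%:R / 3 - d%:R / 2) * h <= k * (A + B / S0 6).
    have e1 : h `^ (d%:R / 3 - d%:R / 2) * h = h `^ ((6 - d%:R) / 6).
      rewrite -{2}(powRr1 (ltW h0)) -powRD; first by congr (_ `^ _); field.
      by rewrite (gt_eqF h0) implybT.
    have kA : 0 <= k * (A + B / S0 6).
      by rewrite mulr_ge0 ?(ltW k0)// addr_ge0// divr_ge0// ltW.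
    rewrite e1; apply: le_trans (ge0_ler_powR _ _ _ hle) _; rewrite ?nnegrE ?(ltW h0)//.
      by rewrite divr_ge0// ltW.
    rewrite -powRrM; have -> : 6 / (6 - d%:R) * ((6 - d%:R) / 6) = 1 :> R by field; rewrite gt_eqF.
    by rewrite powRr1.
  apply: (@le_trans _ _ (cI * h `^ (d%:R / 3 - d%:R / 2) * S0 6 * (c1 * h))).
    by rewrite ler_wpM2l// !mulr_ge0// ?(ltW hcI0) ?(ltW S60).
  rewrite (_ : _ * _ = cI * S0 6 * c1 * (h `^ (d%:R / 3 - d%:R / 2) * h)); last by ring.
  apply: (@le_trans _ _ (cI * S0 6 * c1 * (k * (A + B / S0 6)))).
    by rewrite ler_pM2l// !mulr_gt0.
  rewrite le_eqVlt; apply/orP; left; apply/eqP; rewrite /k /N.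
  by field; rewrite !gt_eqF.
have hgam1 : gamma_star D Om Km KM cf1 (S0 2) cI h < gamma.
  by apply: le_lt_trans hgam; rewrite le_max lexx.
(* Tolerance for the velocity error: it is at most h, and [N * e <= alpha D * h] brings the
   concentration error below h as well. The [+ 1] covers N = 0. *)
pose e := Num.min h (alpha D * h / (N + 1)).
have N1 : 0 < N + 1 by rewrite ltr_wpDl.
have e0 : 0 < e by rewrite lt_min h0 divr_gt0// mulr_gt0.
have eN : N * e <= alpha D * h.
  have : e * (N + 1) <= alpha D * h by rewrite -ler_pdivlMr// ge_min lexx orbT.
  by apply: le_trans; rewrite mulrC ler_pM2l// lerDl.
have eh : e <= h by rewrite ge_min lexx.
have [i0 Hi0] := iterates_converge d0 oOm bOm triT hD hf0 S20 S60 hS2 hS6 h0C GC (lexx _) B0 CB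
  (erefl N) hN gamma0 hcI0 inv3 hgam1 (hVah _ Hh) hq hit e0.
exists i0 => i /Hi0 We.
have se := iterate_error d0 oOm bOm triT hD S60 hS6 h0C GC (lexx _) B0 CB
  (erefl N) inv3 (hVah _ Hh) hq hit i.
have [_ _ /(_ i)[Xu' _ Yc' [_ _ dc']]] := hit.
have [h0c _] : H10 Om (Ci i.+1) /\ True by case: Yc'.
have [bu' _ bd' _] := Xh_facts d0 oOm bOm triT Xu'.
have Lu' := vbdf_vL2 mOm fOm bu'; have Lv := vbdf_vL2 mOm fOm bv.
have [en enE] : {en | en = Ci i.+1 \- Ch h} by exists (Ci i.+1 \- Ch h).
rewrite -enE in se.
have Yen := YhB oOm bOm enE Yc' Yq; have [hen h0en] := Yh_H1 oOm bOm Yen.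
have seh : semi Om en <= h.
  rewrite -(ler_pM2l alpha0) (le_trans se)// (le_trans _ eN)// ler_wpM2l//.
have [er erE] : {er | er = C \- Ci i.+1} by exists (C \- Ci i.+1).
have erE' : er = dl \- en.
  by rewrite erE dlE enE; apply/funext => x /=; ring.
have h0er := H10B oOm bOm erE h0C h0c; have [her _] := H10_approx oOm bOm h0er.
have ser : semi Om er <= c1 * h + h.
  have [_ _ Gd] := hdl; have [_ _ Ge] := hen.
  have [_] := (H1B oOm erE' hdl hen).2 2 (ler1n _ 2) Gd Ge.
  by rewrite -!semiE => /le_trans; apply; exact: lerD.
have Wuv : vnrm Om 2 (fun x => ui i.+1 x - uh h x) <= h by exact: le_trans eh.
have uer : vnrm Om 2 (fun x => u x - ui i.+1 x) <= c1 * h + h.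
  have [_] := vL2B mOm Luv.1 (vL2B mOm Lu' Lv).1.
  rewrite (_ : (fun x => (u x - uh h x) - (ui i.+1 x - uh h x)) = (fun x => u x - ui i.+1 x)).
    by move=> /le_trans; apply; exact: lerD.
  by apply/funext => x; rewrite opprB addrA subrK.
have uU : vnrm Om 2 (ui i.+1) <= U.
  have [_] := vL2B mOm Lu (vL2B mOm Lu Lu').1.
  rewrite (_ : (fun x => u x - (u x - ui i.+1 x)) = ui i.+1); last first.
    by apply/funext => x; rewrite opprB addrC subrK.
  move=> /le_trans; apply; rewrite /U -addrA lerD2l (le_trans uer)//.
  by apply: lerD => //; rewrite ler_pM2l.
rewrite -erE (vLpE (vL2B mOm Lu Lu').1.2).
have [mvr vrle] : vinLp 3%:E Om (vr i) /\ (vLp 3%:E Om (vr i) <=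
    `|c2|%:E * \sum_(k <- T h) etaD3 Om k (ui i.+1))%E.
  have [vr1 _ vr2] := hvr i; split => //; apply: le_trans vr2 _.
  apply: lee_wpmul2r; last by rewrite lee_fin ler_norm.
  by apply: sume_ge0 => k' _; exact: etaD3_ge0.
set S := (\sum_(k <- T h) _)%E.
have dk0 k' : 0 <= diam (hull k') :> R by exact: diam_ge0.
have D10 k' := etaD1_ge0 D Om k' (gh h) (ui i.+1) (Ci i.+1).
have D30 k' := etaD3_ge0 Om k' (ui i.+1).
have D20 k' : (0 <= etaD2 D k' gamma (ui i) (Ci i) (ui i.+1) (pri i.+1))%E by exact: Lp_ge0.
have L10 k' : (0 <= etaL1 k' (ui i) (ui i.+1))%E by exact: Lp_ge0.
have L20 k' : (0 <= etaL2 k' (Ci i) (Ci i.+1))%E by exact: poweR_ge0.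
have G1 k' : (0 <= (diam (hull k'))%:E * Lp 2%:E (elt k') (g D \- gh h)%R)%E.
  by apply: mule_ge0; [rewrite lee_fin|exact: Lp_ge0].
have F1 k' : (0 <= vLp 2%:E (elt k') (fun x => rhs D C x - fh D k' C)%R)%E by exact: Lp_ge0.
have S1S : (\sum_(k' <- T h) (etaD1 D Om k' (gh h) (ui i.+1) (Ci i.+1)
    + (diam (hull k'))%:E * Lp 2%:E (elt k') (g D \- gh h)%R) <= S)%E.
  apply: lee_sum => k' _.
  by have [] := le_sum7 (D10 k') (D20 k') (D30 k') (L10 k') (L20 k') (G1 k') (F1 k').
have S3S : (\sum_(k' <- T h) etaD3 Om k' (ui i.+1) <= S)%E.
  apply: lee_sum => k' _.
  by have [] := le_sum7 (D10 k') (D20 k') (D30 k') (L10 k') (L20 k') (G1 k') (F1 k').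
have S30' : (0 <= \sum_(k' <- T h) etaD3 Om k' (ui i.+1))%E by exact: sume_ge0.
have b1 : 0 < beta0 * h by exact: mulr_gt0.
have rle := residual_le d0 oOm bOm triT Xu' Yc'.1 Ig.1 (hgh _ Hh) (ltW b1) (hb _ Hh).
have dle := divergence_le d0 oOm bOm triT Xu' (ltW b1) (hb _ Hh).
clearbody S.
(* An infinite sum of indicators makes the claim trivial because the constant is positive, and
   nonnegativity rules out minus infinity. *)
case: S S1S S3S => [x| |] S1S S3S; last 2 first.
- by rewrite gt0_muley ?lte_fin// leey.
- by have := le_trans S30' S3S.
have x0 : 0 <= x by rewrite -lee_fin (le_trans S30').
have [Ires nres] : inLp 2%:E Om (residual Om D (ui i.+1) (Ci i.+1)) /\
    nrm Om 2 (residual Om D (ui i.+1) (Ci i.+1)) <= (beta0 * h)^-1 * x.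
  apply: inLp_le; first exact: (measurable_residual d0 oOm bOm triT Xu' Yc'.1 Ig.1).
  by rewrite EFinM lee_pdivlMl// (le_trans rle).
have [Idiv ndiv] : inLp 3%:E Om (wdiv Om (ui i.+1)) /\
    nrm Om 3 (wdiv Om (ui i.+1)) <= (beta0 * h)^-1 * x.
  by apply: inLp_le; [exact: bd'.1|rewrite EFinM lee_pdivlMl// (le_trans dle)].
have X0 : 0 <= (beta0 * h)^-1 * x by rewrite mulr_ge0// invr_ge0 ltW.
have := data_le d0 oOm bOm alpha0 r00 Ig S20 S30 hS2 hS3 triT Xu' Yc' dc' X0 nres ndiv uU.
rewrite -/Q => gle.
have hM : h <= M * x.
  rewrite /M mulrAC ler_pdivlMr ?mulr_gt0//.
  rewrite (_ : h * _ = beta0 * h * nrm Om 1 (g D)); last by ring.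
  rewrite -ler_pdivlMl//; apply: le_trans gle _.
  by rewrite le_eqVlt; apply/orP; left; apply/eqP; ring.
have vrx : (vLp 3%:E Om (vr i) <= (`|c2| * x)%:E)%E.
  by rewrite (le_trans vrle)// EFinM lee_wpmul2l.
apply: (@le_trans _ _ ((vnrm Om 2 (fun x => u x - ui i.+1 x))%:E
    + (nrm Om 2 er + semi Om er)%:E + (`|c2| * x)%:E)%E).
  by apply: leeD => //; apply: leeD2l; exact: H1norm_le.
rewrite -!EFinD -EFinM lee_fin.
have ner := hS2 _ h0er.
have t1 : S0 2 * semi Om er <= S0 2 * (c1 * h + h) by rewrite ler_pM2l.
have t2 : (c1 + 1) * (2 + S0 2) * h <= (c1 + 1) * (2 + S0 2) * (M * x).
  by rewrite ler_pM2l// mulr_gt0// addr_gt0.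
move: uer ser ner t1 t2 x0.
move: (vnrm _ _ _) (nrm Om 2 er) (semi Om er) (S0 2) => a b c S2.
by clear; move: M `|c2| => P c2' *; lra.
Qed.
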